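(* In the setting described in the context, let $X=(X(t))_{t\ge0}$ be the solution of $$\mathrm{d}X(t)=AX(t)\,\mathrm{d}t+F(X(t))\,\mathrm{d}t+B\,\mathrm{d}L(t),\quad t\ge0,\qquad X(0)=x,$$ and let $r$ be the stationary process obtained as the limit $r(t)=\lim_{n,m\to\infty}r^{(n)}_m(t)$. Then the (unique) invariant measure for the process $(X(t))_{t\ge0}$ is given by the law $\mathcal{L}(r(t))$ of the stationary process $r$.
   Context: Linear operator. $\mathcal{H}$ is a real separable Hilbert space with inner product $\langle\cdot,\cdot\rangle$ and norm $|\cdot|=|\cdot|_{\mathcal H}$. $A$ is a self-adjoint, strictly negative operator with domain $D(A)$ generating a $C_0$-semigroup $S(t)=e^{tA}$, $t\ge0$, on $\mathcal{H}$, and there is an orthonormal basis $(e_n)_{n\in\mathbb{N}}\subset D(A)$ of $\mathcal{H}$ with $Ae_n=-\lambda_n e_n$, $\lambda_n>0$, $\lambda_n\uparrow+\infty$. The semigroup is of strict negative type: $\langle Au,u\rangle\le-\omega|u|^2$ for $u\in D(A)$, with $\omega>0$. Nonlinearity. $F:D(F)\subset\mathcal{H}\to\mathcal{H}$ is continuous, nonlinear, Fréchet differentiable, and for some $\eta>0$ one has $\langle F(u)-F(v)-\eta(u-v),u-v\rangle<0$ for all $u\neq v$ in $D(F)$. It is assumed that $\omega>\eta$, so that $A+F$ is $m$-dissipative (dissipative, and the range of $\lambda-(A+F)$ is $\mathcal{H}$ for some, hence all, $\lambda>0$). The initial datum is $x\in D(F)$. Banach space. $\mathcal{B}$ is a reflexive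 Banach space continuously embedded into $\mathcal{H}$ as a dense Borel subset. The restrictions $A_{\mathcal{B}}=A_{|\mathcal{B}}$, $F_{|\mathcal{B}}$ to $\mathcal{B}$ are almost $m$-dissipative in $\mathcal{B}$: $A_{\mathcal{B}}+\omega\mathbf{1}$ is $m$-dissipative in $\mathcal{B}$, and $F_{|\mathcal B}+c\mathbf{1}$ is $m$-dissipative in $\mathcal{B}$ for some $c\in\mathbb{R}$. Moreover $D(F)\supset\mathcal{B}$ and $F$ maps bounded subsets of $\mathcal{B}$ into bounded subsets of $\mathcal{H}$. Noise. $L(t)=\sum_{n\ge1}\beta_nL^n(t)e_n$ is a cylindrical Lévy process, where $(\beta_n)$ is a (possibly unbounded) sequence of positive reals and $(L^n)_{n}$ are independent, identically distributed, symmetric real-valued Lévy processes without Gaussian part, with Lévy measure $\nu_{\mathbb{R}}$. Identifying $\mathcal{H}$ with $\ell^2$ through $(e_n)$, $L$ is a Lévy process (with càdlàg paths) in $\mathcal{U}=\ell^2_\rho=\{(x_n)\in\mathbb{R}^{\mathbb{N}}:\sum_n x_n^2\rho_n^2<\infty\}$, where $\rho=(\rho_n)$ is chosen such that $\sum_{n}\big(\rho_n^2\beta_n^2\int_{\rho_n\beta_n|y|<1}y^2\nu_{\mathbb{R}}(\mathrm{d}y)+\int_{\rho_n\beta_n|y|\ge1}\nu_{\mathbb{R}}(\mathrm{d}y)\big)<\infty$. $B:\mathcal{U}\to\mathcal{H}$ is bounded linear of the form $BL(t)=\sum_k b_k\beta_kL^k(t)e_k$ with $\sup_k b_k/\rho_k<\infty$.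 The stochastic convolution $L_A(t)=\int_0^tS(t-s)B\,\mathrm{d}L(s)$, $t\ge0$, is square-integrable and adapted, has a càdlàg version in $D((-A_{\mathcal{B}})^{\alpha})$ for some $\alpha\in[0,1)$, and satisfies $\int_0^T|F(L_A(t))|_{\mathcal{B}}\,\mathrm{d}t<\infty$ $\mathbb{P}$-a.s. for all $T>0$. In addition, $\sup_{t\ge0}\mathbb{E}\big(|L_A(t)|_{\mathcal{H}}+|F(L_A(t))|_{\mathcal{H}}\big)<+\infty$. Solution and invariant measure. For $x\in\mathcal{B}$ the equation for $X$ has a unique adapted mild solution, càdlàg in $\mathcal{B}$, i.e. almost surely $X(t)=S(t)x+\int_0^tS(t-s)F(X(s))\,\mathrm{d}s+L_A(t)$, $t\ge0$; for $x\in\mathcal{H}$ there is a generalized solution, obtained as a limit in $\mathcal{H}$, on each bounded time interval, of mild solutions taking values in $\mathcal{B}$. $X$ defines a Feller Markov semigroup $(P_t)_{t\ge0}$ on $\mathcal{H}$ with kernels $P_t(x,\mathrm{d}y)$. A probability measure $\mu$ on $\mathcal{H}$ is invariant for $X$ if $\mu(\Gamma)=\int\mu(\mathrm{d}x)P_t(x,\Gamma)$ for all Borel $\Gamma\subset\mathcal{H}$ and $t\ge0$. Under the assumptions above there is a unique invariant measure for $(P_t)$ on $\mathcal{H}$ (known). Two-sided noise. $\bar{L}(t)$, $t\in\mathbb{R}$, is the double-sided process with $\bar{L}(t)=L(t)$ for $t\ge0$ and such that $(\bar L(-t))_{t\ge0}$ is independent of $(L(t))_{t\ge0}$ with the same finite-dimensional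 distributions as $(L(t))_{t\ge0}$. $(\mathcal{F}_t)_{t\in\mathbb{R}}$ is the natural filtration associated with $\bar L$. Approximations. $(\mathcal{B}_n)_{n\in\mathbb{N}}$ is a sequence of finite-dimensional subspaces of $\mathcal{B}$ and $\Pi_n$ are self-adjoint operators from $\mathcal{H}$ onto $\mathcal{B}_n$ with $\Pi_nx\to x$ in $\mathcal{B}$ for every $x\in\mathcal{B}$. $F_m$, $m\in\mathbb{N}$, is the $m$-th Yosida approximation of $F$, $F_m(x)=F\big(m(mI-F)^{-1}x\big)$; it is Lipschitz continuous and satisfies $|F_m(x)-F(x)|_{\mathcal{H}}\to0$ as $m\to\infty$ and $|F_m(x)|_{\mathcal{H}}\le|F(x)|_{\mathcal{H}}$ for $x\in D(F)$, and $\langle F_m(x)-F_m(y),x-y\rangle\le m|x-y|^2$ for all $x,y$. The process $r$. Put $\bar{L}^{\infty,n}_A(t)=\lim_{a\to+\infty}\int_{-a}^{t}S(t-s)\,\Pi_nB\,\mathrm{d}\bar{L}(s)$, $t\in\mathbb{R}$ (well-defined $\mathcal{H}$-valued random variables). $r^{(n)}_m=(r^{(n)}_m(t))_{t\in\mathbb{R}}$ is the unique $(\mathcal{F}_t)$-adapted process satisfying, for all $t\in\mathbb{R}$, $r^{(n)}_{m}(t)=\int_{-\infty}^{t}S(t-s)\Pi_{n}F_{m}(\Pi_{n}r^{(n)}_{m}(s))\,\mathrm{d}s+\bar{L}^{\infty,n}_A(t)$ and having $\sup_{t\in\mathbb{R}}\mathbb{E}|r^{(n)}_m(t)|^p_{\mathcal{H}}\le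 C_p$ for every $p\ge2$ with $C_p$ independent of $n,m$; it is stationary (finite-dimensional distributions invariant under time shifts). The process $r$ is the stationary process given as the limit of $r^{(n)}_m$ as $n,m\to\infty$ in $L^p(\Omega;C([0,T];\mathcal{B}))$, $p\ge1$, $T>0$. *)

(* Defs.v *)
From HB Require Import structures.
From mathcomp Require Import all_boot all_order all_algebra.
From mathcomp Require Import all_classical all_reals all_analysis.

Set Implicit Arguments.
Unset Strict Implicit.
Unset Printing Implicit Defensive.
Import Order.TTheory GRing.Theory Num.Theory.
Import numFieldNormedType.Exports.
Local Open Scope classical_set_scope.
Local Open Scope ring_scope.

Notation borel V := (g_sigma_algebraType (@open V)).

Section Functional_analysis.
Context {R : realType}.

Definition inner_product_of (H : normedModType R) (ip : H -> H -> R) :=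
  [/\ forall x y, ip x y = ip y x,
      forall a x y z, ip (a *: x + y) z = a * ip x z + ip y z
    & forall x, ip x x = `|x| ^+ 2].

Definition orthonormal_basis (H : normedModType R) (ip : H -> H -> R)
    (e : nat -> H) :=
  (forall i k, ip (e i) (e k) = (i == k)%:R) /\
  (forall x, series (fun k => ip x (e k) *: e k) @ \oo --> x).

(* Operators, possibly partially defined, are handled through their graphs. *)
Definition graph (V W : Type) (D : set V) (G : V -> W) : set (V * W) :=
  [set p | D p.1 /\ p.2 = G p.1].

Definition shift_op (V : normedModType R) (G : set (V * V)) (c : R) :
    set (V * V) := [set p | G (p.1, p.2 - c *: p.1)].

Definition part_op (V W : Type) (j : W -> V) (G : set (V * V)) : set (W * W) :=
  [set p | G (j p.1, j p.2)].

Definition dissipative (V : normedModType R) (G : set (V * V)) :=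
  forall p q, G p -> G q -> forall a : R, 0 < a ->
    `|p.1 - q.1| <= `|p.1 - q.1 - a *: (p.2 - q.2)|.

Definition mdissipative (V : normedModType R) (G : set (V * V)) :=
  dissipative G /\
  exists2 l : R, 0 < l & forall y, exists2 p, G p & l *: p.1 - p.2 = y.

Definition linear_operator (V : normedModType R) (D : set V) (A : V -> V) :=
  D 0 /\ forall (a : R) x y, D x -> D y ->
    D (a *: x + y) /\ A (a *: x + y) = a *: A x + A y.

Definition adjoint (H : normedModType R) (ip : H -> H -> R)
    (D : set H) (A : H -> H) : set (H * H) :=
  [set p | forall u, D u -> ip (A u) p.1 = ip u p.2].

Definition self_adjoint (H : normedModType R) (ip : H -> H -> R)
    (D : set H) (A : H -> H) :=
  [/\ linear_operator D A, dense D & adjoint ip D A = graph D A].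

Definition C0_semigroup (V : normedModType R) (S : R -> {linear V -> V}) :=
  [/\ forall t, 0 <= t -> continuous (S t),
      forall x, S 0 x = x,
      forall s t, 0 <= s -> 0 <= t -> forall x, S (s + t) x = S s (S t x)
    & forall x, S t x @[t --> (0 : R)^'+] --> x].

Definition generator (V : normedModType R) (S : R -> {linear V -> V}) :
    set (V * V) :=
  [set p | h^-1 *: (S h p.1 - p.1) @[h --> (0 : R)^'+] --> p.2].

Definition dual (V : normedModType R) : set (V -> R) :=
  [set f : V -> R | scalar f /\ continuous f].
Arguments dual : clear implicits.

(* every bounded linear functional on the dual is an evaluation; [`|Phi f|] is
   bounded by a multiple of every Lipschitz constant of [f] *)
Definition reflexive_space (V : normedModType R) :=
  forall Phi : (V -> R) -> R,
    (forall (a : R) f g, dual V f -> dual V g ->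
       Phi (fun x => a * f x + g x) = a * Phi f + Phi g) ->
    (exists C : R, forall f M, dual V f ->
       (forall x, `|f x| <= M * `|x|) -> `|Phi f| <= C * M) ->
    exists x, forall f, dual V f -> Phi f = f x.

Definition finite_dim_subspace (V : normedModType R) (E : set V) :=
  exists (d : nat) (v : 'I_d -> V),
    E = [set x | exists c : 'I_d -> R, x = \sum_(i < d) c i *: v i].

(* The domain [D] need not be open: differentials are taken along [D]. *)
Definition frechet_differentiable_on (V : normedModType R) (D : set V)
    (F : V -> V) :=
  forall u, D u -> exists l : {linear V -> V}, continuous l /\
    forall eps : R, 0 < eps -> \forall v \near within D (nbhs u),
      `|F v - F u - l (v - u)| <= eps * `|v - u|.

Definition cadlag (V : topologicalType) (f : R -> V) :=
  (forall t : R, 0 <= t -> f s @[s --> t^'+] --> f t) /\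
  (forall t : R, 0 < t -> exists l : V, f s @[s --> t^'-] --> l).

(* norm of [h] in a space [W] embedded by [j]; infinite outside the image *)
Definition enorm (V W : normedModType R) (j : W -> V) (h : V) : \bar R :=
  ereal_inf [set (`|y|)%:E | y in [set y | j y = h]].

Definition cadlag_in (V W : normedModType R) (j : W -> V) (f : R -> V) :=
  exists g : R -> W, cadlag g /\ forall t, 0 <= t -> j (g t) = f t.

(* Bochner integral: f is an a.e. limit of integrable simple functions
   sum_(i < k n) 1_(E n i) c n i that also converge to f in L^1. *)
Definition is_bochner_integral d (T : measurableType d)
    (mu : {measure set T -> \bar R}) (V : normedModType R)
    (D : set T) (f : T -> V) (v : V) :=
  exists (k : nat -> nat) (E : nat -> nat -> set T) (c : nat -> nat -> V),
  let phi n x := \sum_(i < k n) (\1_(E n i) x : R) *: c n i in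
  [/\ forall n i, [/\ measurable (E n i), E n i `<=` D
                    & (mu (E n i) < +oo)%E],
      {ae mu, forall x, D x -> phi n x @[n --> \oo] --> f x},
      (\int[mu]_(x in D) (`|f x - phi n x|)%:E)%E @[n --> \oo] --> 0%E
    & \sum_(i < k n) fine (mu (E n i)) *: c n i @[n --> \oo] --> v].

(* Graph of (-G)^alpha, 0 <= alpha < 1, through Balakrishnan's formula
   (-G)^-alpha y
     = sin(pi alpha) / pi int_0^oo l^-alpha (l - G)^-1 y dl. *)
Definition frac_pow (V : normedModType R) (G : set (V * V)) (alpha : R) :
    set (V * V) :=
  [set p | if alpha == 0 then p.1 = p.2 else
    exists (res : R -> V) (I : V),
    [/\ forall l, 0 < l -> G (res l, l *: res l - p.2),
        is_bochner_integral (lebesgue_measure : {measure set _ -> \bar R})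
          `]0, +oo[ (fun l => (l `^ (- alpha)) *: res l) I
      & p.1 = (sin (pi * alpha) / pi) *: I]].

(* y = m(mI - F)^-1 x is understood as y = ((mI - F)/m)^-1 x, i.e.
   y = (I - F/m)^-1 x; for nonlinear F multiplying (mI - F)^-1 x by m would
   not give an approximation of x. *)
Definition yosida (V : normedModType R) (D : set V) (F : V -> V) (m : nat)
    (Fm : V -> V) :=
  forall x, exists y, [/\ D y, y - m%:R^-1 *: F y = x & Fm x = F y].

End Functional_analysis.

Arguments dual {R} V.

Section Processes.
Context {R : realType} {d : measure_display} {Om : measurableType d}
  (P : probability Om R).

Definition same_fdd d' (V : measurableType d') (I : Type) (J : set I)
    (X Y : I -> Om -> V) :=
  forall n (i : nat -> I) (E : nat -> set V),
    (forall k, J (i k)) -> (forall k, measurable (E k)) ->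
    P (\bigcap_(k in `I_n) (X (i k) @^-1` E k)) =
    P (\bigcap_(k in `I_n) (Y (i k) @^-1` E k)).

Definition sigma_of d' (V : measurableType d') (I : Type) (J : set I)
    (X : I -> Om -> V) : set (set Om) :=
  <<s [set E | exists i B, [/\ J i, measurable B & E = X i @^-1` B]] >>.

Definition independent_sigma (I : choiceType) (G : I -> set (set Om)) :=
  forall (s : seq I) (E : I -> set Om), uniq s -> (forall i, G i (E i)) ->
    P (\bigcap_(i in [set` s]) E i) = (\prod_(i <- s) P (E i))%E.

Definition independent_sigma2 (G1 G2 : set (set Om)) :=
  forall E1 E2, G1 E1 -> G2 E2 -> P (E1 `&` E2) = (P E1 * P E2)%E.

Definition levy_process (X : R -> Om -> R) :=
  [/\ forall t, 0 <= t -> measurable_fun setT (X t),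
      {ae P, forall w, X 0 w = 0},
      forall n (t : nat -> R) (E : nat -> set R),
        0 <= t 0%N -> {homo t : i k / (i <= k)%N >-> i <= k} ->
        (forall i, measurable (E i)) ->
        let D i := [set w | E i (X (t i.+1) w - X (t i) w)] in
        P (\bigcap_(i in `I_n) D i) = (\prod_(i < n) P (D i))%E,
      forall s t (E : set R), 0 <= s -> s <= t -> measurable E ->
        P [set w | E (X t w - X s w)] = P [set w | E (X (t - s) w)]
    & {ae P, forall w, cadlag (X ^~ w)}].

Definition symmetric_process (X : R -> Om -> R) :=
  forall t (E : set R), 0 <= t -> measurable E ->
    P [set w | E (X t w)] = P [set w | E (- X t w)].

Definition levy_measure (nu : {measure set R -> \bar R}) :=
  nu [set 0] = 0%E /\ (\int[nu]_y (Num.min 1 (y ^+ 2))%:E < +oo)%E.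

(* Levy-Khintchine formula E exp(iuX(t)) = exp(t (re u + i im u)), split into
   real and imaginary parts. *)
Definition levy_triplet (X : R -> Om -> R) (gamma sigma2 : R)
    (nu : {measure set R -> \bar R}) :=
  let re u := - sigma2 * u ^+ 2 / 2
    + fine (\int[nu]_y (cos (u * y) - 1)%:E)%E in
  let im u := gamma * u
    + fine (\int[nu]_y
        (sin (u * y) - u * y * \1_([set z : R | `|z| < 1]) y)%:E)%E in
  forall t u, 0 <= t ->
    (\int[P]_w (cos (u * X t w))%:E
       = (expR (t * re u) * cos (t * im u))%:E)%E /\
    (\int[P]_w (sin (u * X t w))%:E
       = (expR (t * re u) * sin (t * im u))%:E)%E.

(* squared norm of the weighted sequence space l^2_rho *)
Definition wl2 (rho x : nat -> R) : \bar R :=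
  (\sum_(0 <= k <oo) ((x k) ^+ 2 * (rho k) ^+ 2)%:E)%E.

Definition cadlag_wl2 (rho : nat -> R) (u : R -> nat -> R) :=
  [/\ forall t, 0 <= t -> (wl2 rho (u t) < +oo)%E,
      forall t, 0 <= t -> wl2 rho (u s \- u t) @[s --> t^'+] --> 0%E
    & forall t, 0 < t -> exists2 l, (wl2 rho l < +oo)%E &
        wl2 rho (u s \- l) @[s --> t^'-] --> 0%E].

(* The sequence-valued process [L] is seen as the family of its coordinates. *)
Definition coordinates (L : R -> Om -> nat -> R) : R * nat -> Om -> R :=
  fun p w => L p.1 w p.2.

(* natural filtration, augmented by the null events *)
Definition natural_filtration (L : R -> Om -> nat -> R) (t : R) :
    set (set Om) :=
  <<s sigma_of [set p : R * nat | p.1 <= t] (coordinates L)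
      `|` [set N | measurable N /\ P N = 0%E] >>.

Context {H : normedModType R}.

Definition random_variable (Y : Om -> H) :=
  measurable_fun setT (Y : Om -> borel H).

Definition adapted (G : R -> set (set Om)) (J : set R) (Y : R -> Om -> H) :=
  forall t, J t -> random_variable (Y t) /\
    forall E, @measurable _ (borel H) E -> G t (Y t @^-1` E).

Definition riemann_sum (Phi : R -> (nat -> R) -> H) (L : R -> Om -> nat -> R)
    (a : R) (s : seq R) (w : Om) : H :=
  \sum_(i < size s) Phi (nth a (a :: s) i)
    (L (nth a (a :: s) i.+1) w \- L (nth a (a :: s) i) w).

(* Stochastic integral over [a, b] of a deterministic operator-valued
   integrand: limit in probability of the left-point Riemann sums. *)
Definition is_stoch_integral (Phi : R -> (nat -> R) -> H)
    (L : R -> Om -> nat -> R) (a b : R) (Y : Om -> H) :=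
  random_variable Y /\
  forall eps : R, 0 < eps -> exists2 delta : R, 0 < delta &
    forall s, itv_partition a b s ->
      (forall i, (i < size s)%N ->
         nth a (a :: s) i.+1 - nth a (a :: s) i < delta) ->
      (P [set w | (eps <= `|Y w - riemann_sum Phi L a s w|)%R] <= eps%:E)%E.

(* integral over ]-oo, t], as a limit in probability *)
Definition is_stoch_integral_ninfty (Phi : R -> (nat -> R) -> H)
    (L : R -> Om -> nat -> R) (t : R) (Y : Om -> H) :=
  random_variable Y /\
  exists I : R -> Om -> H,
    (\forall a \near +oo, is_stoch_integral Phi L (- a) t (I a)) /\
    (forall eps : R, 0 < eps ->
       P [set w | (eps <= `|I a w - Y w|)%R] @[a --> +oo] --> 0%E).

Definition stationary (J : set R) (Y : R -> Om -> H) :=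
  forall h, (forall t, J t -> J (t + h)) ->
    same_fdd J (Y : R -> Om -> borel H) (fun t => Y (t + h)).

End Processes.

Section Setting.
Context {R : realType} {d : measure_display} {Om : measurableType d}
  (P : probability Om R) {H B : completeNormedModType R}
  (ip : H -> H -> R) (j : {linear B -> H}).

(* [omega > 0] together with the last item also gives strict negativity. *)
Definition linear_part (DA : set H) (A : H -> H) (S : R -> {linear H -> H})
    (e : nat -> H) (lam : nat -> R) (omega : R) :=
  [/\ self_adjoint ip DA A,
      C0_semigroup S /\ generator S = graph DA A,
      [/\ orthonormal_basis ip e,
          forall n, [/\ DA (e n), A (e n) = - lam n *: e n & 0 < lam n],
          {homo lam : n k / (n <= k)%N >-> n <= k}
        & lam n @[n --> \oo] --> +oo],
      0 < omega
    & forall u, DA u -> ip (A u) u <= - omega * `|u| ^+ 2].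

Definition nonlinear_part (DF : set H) (F : H -> H) (eta : R) :=
  [/\ {within DF, continuous F},
      frechet_differentiable_on DF F,
      0 < eta
    & forall u v, DF u -> DF v -> u != v ->
        ip (F u - F v - eta *: (u - v)) (u - v) < 0].

Definition banach_embedding :=
  [/\ reflexive_space B, continuous j, injective j, dense (range j)
    & @measurable _ (borel H) (range j)].

Definition restriction_to_B (DA : set H) (A : H -> H) (omega : R)
    (DF : set H) (F : H -> H) :=
  [/\ mdissipative (shift_op (part_op j (graph DA A)) omega),
      exists c : R, mdissipative (shift_op (part_op j (graph DF F)) c),
      range j `<=` DF
    & forall C : set B, bounded_set C -> bounded_set [set F (j x) | x in C]].

(* [Lk k] is the k-th scalar Levy process and [L] the sequence
   (beta_k Lk k)_k. *)
Definition cylindrical_levy (nu : {measure set R -> \bar R})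
    (beta rho : nat -> R) (Lk : nat -> R -> Om -> R)
    (L : R -> Om -> nat -> R) :=
  [/\ forall k, 0 < beta k /\ 0 < rho k,
      levy_measure nu /\
        (forall k, [/\ levy_process P (Lk k), symmetric_process P (Lk k)
          & exists gamma, levy_triplet P (Lk k) gamma 0 nu]),
      independent_sigma P (fun k => sigma_of [set t : R | 0 <= t] (Lk k)) /\
        (forall k l, same_fdd P [set t : R | 0 <= t] (Lk k) (Lk l)),
      (\sum_(0 <= k <oo)
        ((rho k ^+ 2 * beta k ^+ 2)%:E *
           \int[nu]_(y in [set y : R | (rho k * beta k * `|y| < 1)%R]) (y ^+ 2)%:E
         + nu [set y : R | (1 <= rho k * beta k * `|y|)%R]) < +oo)%E
    & (forall t, 0 <= t -> forall w k, L t w k = beta k * Lk k t w) /\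
        {ae P, forall w, cadlag_wl2 rho (L ^~ w)}].

Definition diag_op (e : nat -> H) (b x : nat -> R) : H :=
  lim (series (fun k => (b k * x k) *: e k) @ \oo).

Definition bounded_diag (rho b : nat -> R) :=
  exists C : R, forall k, `|b k| / rho k <= C.

Definition double_sided (L Lbar : R -> Om -> nat -> R) :=
  [/\ forall t, 0 <= t -> Lbar t = L t,
      forall t k, measurable_fun setT (fun w => Lbar t w k),
      independent_sigma2 P
        (sigma_of [set p : R * nat | 0 <= p.1]
           (coordinates (fun t => Lbar (- t))))
        (sigma_of [set p : R * nat | 0 <= p.1] (coordinates L))
    & same_fdd P [set p : R * nat | 0 <= p.1]
        (coordinates (fun t => Lbar (- t))) (coordinates L)].

(* [LA] stands for the version with cadlag paths in D((-A_B)^alpha), the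
   latter carrying the graph norm. *)
Definition stoch_convolution (DA : set H) (A : H -> H) (F : H -> H)
    (S : R -> {linear H -> H}) (BL : (nat -> R) -> H)
    (L : R -> Om -> nat -> R) (G : R -> set (set Om)) (LA : R -> Om -> H) :=
  [/\ forall t, 0 <= t ->
        is_stoch_integral P (fun s x => S (t - s) (BL x)) L 0 t (LA t) /\
        (\int[P]_w (`|LA t w| ^+ 2)%:E < +oo)%E,
      adapted G [set t : R | 0 <= t] LA,
      exists alpha : R, [/\ 0 <= alpha, alpha < 1 & {ae P, forall w,
        exists y z : R -> B, [/\ cadlag y, cadlag z & forall t, 0 <= t ->
          frac_pow (part_op j (graph DA A)) alpha (y t, z t) /\
          j (y t) = LA t w]}],
      {ae P, forall w, forall T : R, 0 < T ->
        (\int[lebesgue_measure]_(t in `[0%R, T])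
           enorm j (F (LA t w)) < +oo)%E}
    & exists K : R, forall t, 0 <= t ->
        (\int[P]_w (`|LA t w| + `|F (LA t w)|)%:E <= K%:E)%E].

Definition mild_solution (S : R -> {linear H -> H}) (F : H -> H)
    (G : R -> set (set Om)) (LA : R -> Om -> H) (y : B) (X : R -> Om -> H) :=
  [/\ adapted G [set t : R | 0 <= t] X,
      {ae P, forall w, cadlag_in j (X ^~ w)}
    & {ae P, forall w, forall t, 0 <= t -> exists v,
        is_bochner_integral (lebesgue_measure : {measure set _ -> \bar R})
          `[0, t] (fun s => S (t - s) (F (X s w))) v /\
        X t w = S t (j y) + v + LA t w}].

Definition generalized_solution (S : R -> {linear H -> H}) (F : H -> H)
    (G : R -> set (set Om)) (LA : R -> Om -> H) (x : H) (X : R -> Om -> H) :=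
  adapted G [set t : R | 0 <= t] X /\
  exists (y : nat -> B) (Y : nat -> R -> Om -> H),
    [/\ j (y n) @[n --> \oo] --> x,
        forall n, mild_solution S F G LA (y n) (Y n)
      & {ae P, forall w, forall T : R, 0 < T ->
          ereal_sup [set (`|Y n t w - X t w|)%:E | t in `[0, T]]
            @[n --> \oo] --> 0%E}].

Definition solution (S : R -> {linear H -> H}) (F : H -> H)
    (G : R -> set (set Om)) (LA : R -> Om -> H) (x : H) (X : R -> Om -> H) :=
  (exists2 y, j y = x & mild_solution S F G LA y X) \/
  generalized_solution S F G LA x X.

Definition well_posed (S : R -> {linear H -> H}) (F : H -> H)
    (G : R -> set (set Om)) (LA : R -> Om -> H) :=
  (forall y, exists2 X, mild_solution S F G LA y X &
     forall X', mild_solution S F G LA y X' ->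
       {ae P, forall w, forall t, 0 <= t -> X' t w = X t w}) /\
  (forall x, exists X, generalized_solution S F G LA x X).

Definition transition_semigroup (S : R -> {linear H -> H}) (F : H -> H)
    (G : R -> set (set Om)) (LA : R -> Om -> H)
    (Pt : R -> R.-pker borel H ~> borel H) :=
  [/\ forall x X, solution S F G LA x X ->
        forall t (E : set (borel H)), 0 <= t -> measurable E ->
          Pt t x E = P (X t @^-1` E),
      forall s t x (E : set (borel H)), 0 <= s -> 0 <= t -> measurable E ->
        Pt (s + t) x E = (\int[Pt s x]_y Pt t y E)%E
    & forall t (phi : H -> R), 0 <= t -> continuous phi ->
        (exists C : R, forall x, `|phi x| <= C) ->
        continuous (fun x : H => fine (\int[Pt t x]_y (phi y)%:E)%E : R)].

Definition invariant (Pt : R -> R.-pker borel H ~> borel H)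
    (mu : probability (borel H) R) :=
  forall t (E : set (borel H)), 0 <= t -> measurable E ->
    mu E = (\int[mu]_x Pt t x E)%E.

Definition unique_invariant (Pt : R -> R.-pker borel H ~> borel H)
    (mu : probability (borel H) R) :=
  invariant Pt mu /\
  forall mu' : probability (borel H) R, invariant Pt mu' ->
    forall E, measurable E -> mu' E = mu E.

Definition projections (Bn : nat -> set B) (Pi : nat -> {linear H -> B}) :=
  [/\ forall n, finite_dim_subspace (Bn n),
      forall n, range (Pi n) = Bn n,
      forall n x y, ip (j (Pi n x)) y = ip x (j (Pi n y))
    & forall x : B, Pi n (j x) @[n --> \oo] --> x].

(* (mI - F)^-1 is single-valued only for m > eta, whence the threshold [m0]. *)
Definition yosida_approximations (DF : set H) (F : H -> H) (eta : R)
    (m0 : nat) (Fm : nat -> H -> H) :=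
  [/\ eta < m0%:R,
      forall m, (m0 <= m)%N -> yosida DF F m (Fm m),
      forall m, (m0 <= m)%N ->
        (exists k : R, forall x y, `|Fm m x - Fm m y| <= k * `|x - y|) /\
        (forall x y, ip (Fm m x - Fm m y) (x - y) <= m%:R * `|x - y| ^+ 2),
      forall x, DF x -> `|Fm m x - F x| @[m --> \oo] --> 0
    & forall m x, (m0 <= m)%N -> DF x -> `|Fm m x| <= `|F x|].

Definition approximate_process (S : R -> {linear H -> H})
    (G : R -> set (set Om)) (Pin : {linear H -> B}) (Fm : H -> H)
    (Linf : R -> Om -> H) (C : R -> R) (rho : R -> Om -> H) :=
  [/\ adapted G setT rho,
      forall t, {ae P, forall w, exists v,
        is_bochner_integral (lebesgue_measure : {measure set _ -> \bar R})
          `]-oo, t] (fun s => S (t - s) (j (Pin (Fm (j (Pin (rho s w))))))) v /\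
        rho t w = v + Linf t w}
    & forall p t, 2 <= p -> (\int[P]_w (`|rho t w| `^ p)%:E <= (C p)%:E)%E].

Definition approximate_processes (S : R -> {linear H -> H})
    (BL : (nat -> R) -> H) (Lbar : R -> Om -> nat -> R)
    (G : R -> set (set Om)) (Pi : nat -> {linear H -> B}) (m0 : nat)
    (Fm : nat -> H -> H) (Linf : nat -> R -> Om -> H) (C : R -> R)
    (rnm : nat -> nat -> R -> Om -> H) :=
  (forall n t, is_stoch_integral_ninfty P
     (fun s x => S (t - s) (j (Pi n (BL x)))) Lbar t (Linf n t)) /\
  (forall n m, (m0 <= m)%N ->
     [/\ approximate_process S G (Pi n) (Fm m) (Linf n) C (rnm n m),
         forall rho,
           approximate_process S G (Pi n) (Fm m) (Linf n) C rho ->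
           forall t, {ae P, forall w, rho t w = rnm n m t w}
       & stationary P setT (rnm n m)]).

(* Limit in L^p(Omega; C([0,T]; B)): the supremum norm of B-valued paths, which
   here are only cadlag because of the jumps of the noise. *)
Definition limit_process (m0 : nat) (rnm : nat -> nat -> R -> Om -> H)
    (r : R -> Om -> H) :=
  [/\ forall t, 0 <= t -> random_variable (r t),
      forall n m, (m0 <= m)%N ->
        {ae P, forall w, cadlag_in j (fun t => rnm n m t w)},
      {ae P, forall w, cadlag_in j (fun t => r t w)},
      forall p T : R, 1 <= p -> 0 < T ->
        (\int[P]_w poweR
          (ereal_sup [set enorm j (rnm q.1 q.2 t w - r t w)%R | t in `[0%R, T]])
          p)%E
        @[q --> filter_prod \oo \oo] --> 0%E
    & stationary P [set t : R | 0 <= t] r].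

End Setting.

(* Main.v *)
Require Import Defs.
From HB Require Import structures.
From mathcomp Require Import all_boot all_order all_algebra.
From mathcomp Require Import all_classical all_reals all_analysis.
From mathcomp Require Import measurable_realfun zify ring lra.
Import Order.TTheory GRing.Theory Num.Theory.
Import numFieldNormedType.Exports.

(** The limit process r attracts every solution, path by path. Almost surely
    [(1 + c t) |X(t) - r(t)| <= |x - r(0)|] for all t, where
    [c = (omega - eta) / 2]; so the laws of X(n) and of r(n) merge, whatever the
    starting point x. Since r is stationary its law does not depend on n, and it
    must then be the invariant measure mu: averaging over the starting points
    with respect to mu and using Fatou's lemma gives [P(r(0) in U) <= mu(U)] for
    every open U ([limn_einf_merging], [invariant_ge_of_limit]), and an
    inequality between two probabilities on all open sets is an equality
    ([probability_eq_of_le_open]).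

    The estimate holds because X and r solve the same mild equation with the same
    noise, so that their difference D has no noise in it. With
    [G = F(X) - F(r)], it satisfies [D(t + h) = S(h) D(t) + h G(t) + o(h)]
    ([variation_of_constants]), where [|S(h)| <= exp(- omega h)] and
    [<G, D> <= eta |D|^2]. This bounds the Dini derivative of
    [(1 + c t) |D(t)|] by 0 ([orbit_contraction]). Solutions starting in B have
    paths in B, where F is bounded on bounded sets; generalized solutions follow
    by passing to the limit.

    Most of the work is to show that r solves the mild equation
    ([limit_process_equation]); this is done one coordinate at a time in the
    eigenbasis. There the semigroup is scalar ([semigroup_coord]), and a
    convolution with it becomes an ordinary primitive: the approximate process
    satisfies, with [l] the k-th eigenvalue,
    [exp(l t) <r_nm(t), e_k> - <r_nm(0), e_k>
       = int_0^t exp(l s) <Pi_n F_m(Pi_n r_nm(s)), e_k> ds + noise],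
    the contributions of negative times cancelling. The noise is close to
    [exp(l t) <L_A(t), e_k>]: the error is the integral of a monotone scalar
    function against the noise tested on [Pi_n e_k - e_k], and
    summation by parts bounds it by the supremum of the noise up to time t times
    [|Pi_n e_k - e_k|], pathwise ([stoch_integral_increment]). Along a
    subsequence the paths of r_nm converge to those of r locally uniformly in B,
    almost surely ([fast_subsequence_paths]), and dominated convergence applies
    to the integrals. This uses that the projections are bounded uniformly in n,
    for the norm of B and then also for the norm of H ([projection_bound_B],
    [projection_bound_H]). *)

Set Implicit Arguments.
Unset Strict Implicit.
Unset Printing Implicit Defensive.
Local Open Scope classical_set_scope.
Local Open Scope ring_scope.

(** * Real functions and partitions *)

Section RealLine.
Context {R : realType}.
Implicit Types (a b T delta : R).

Lemma loc_bounded_on_segment (f : R -> R) T :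
  (forall t : R, 0 <= t -> exists M : R, \forall s \near t, 0 <= s -> f s <= M) ->
  exists M : R, forall t, 0 <= t -> t <= T -> f t <= M.
Proof.
move=> floc; have := @segment_compact R 0 T.
rewrite compact_near_coveringP => /(_ R +oo (fun M s => 0 <= s -> f s <= M) _).
have H (t : R) : t \in `[0, T] -> \forall t' \near t & M \near +oo, 0 <= t' -> f t' <= M.
  rewrite in_itv/= => /andP[t0 _]; have [M HM] := floc t t0.
  near=> t' M'; move=> /= t'0; apply: (@le_trans _ _ M).
    by move: t'0; near: t'.
  by near: M'; apply: nbhs_pinfty_ge; exact: num_real.
move=> /(_ H) [M [Mr HM]]; exists (M + 1) => t t0 tT.
by apply: (HM (M + 1)) => //=; rewrite ?ltrDl// in_itv/= t0.
Unshelve. all: by end_near. Qed.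

Lemma bounded_of_one_sided (f : R -> R) T :
  (forall t : R, 0 <= t -> exists M : R, \forall s \near t^'+, f s <= M) ->
  (forall t : R, 0 < t -> exists M : R, \forall s \near t^'-, f s <= M) ->
  exists M : R, forall t, 0 <= t -> t <= T -> f t <= M.
Proof.
move=> fr fl; apply: loc_bounded_on_segment => t t0.
have [Mr rgt] := fr t t0.
have [t0E|tN] := eqVneq t 0.
  exists (Num.max (f t) Mr).
  near=> s => s0; rewrite le_max; have [st|st|->] := ltgtP s t.
  - by move: st; rewrite t0E ltNge s0.
  - by apply/orP; right; move: st; near: s; exact: rgt.
  - by rewrite lexx.
have tp : 0 < t by rewrite lt0r tN.
have [Ml lft] := fl t tp.
exists (Num.max (f t) (Num.max Mr Ml)).
near=> s => _; rewrite !le_max; have [st|st|->] := ltgtP s t.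
- by apply/or3P; apply: Or33; move: st; near: s; exact: lft.
- by apply/or3P; apply: Or32; move: st; near: s; exact: rgt.
- by rewrite lexx.
Unshelve. all: by end_near. Qed.

Lemma exists_invS_lt (x : R) : 0 < x -> exists n : nat, n.+1%:R^-1 < x.
Proof.
by move=> x0; exists (Num.truncn x^-1); rewrite invf_plt ?posrE// truncnS_gt.
Qed.

Lemma path_le_last (x : R) s : path <%R x s -> x <= last x s.
Proof. elim: s x => [|y s IH] x //= /andP[xy] /IH; exact/le_trans/ltW. Qed.

(** For each slope e > 0, consider the times up to which u stays below the
    line of slope e through its initial value. Their supremum is one of them
    by the condition on the left, and if it were less than T the condition on
    the right would push it further. *)
Lemma le_of_dini (u : R -> R) T : 0 <= T ->
  (forall t e, 0 <= t -> t < T -> 0 < e ->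
     \forall h \near 0^'+, u (t + h) <= u t + e * h) ->
  (forall t e delta, 0 < t -> t <= T -> 0 < e -> 0 < delta ->
     exists s, [/\ 0 <= s, t - delta < s, s < t & u t <= u s + e]) ->
  u T <= u 0.
Proof.
move=> T0 uR uL; apply/ler_addgt0Pr => e0 e0_gt0.
pose e := e0 / (T + 1).
have e_gt0 : 0 < e by rewrite divr_gt0// ltr_pwDr.
have eT : e * T <= e0.
  by rewrite /e -mulrAC ler_pdivrMr ?ltr_pwDr// ler_pM2l// lerDl.
pose E := [set t | [/\ 0 <= t, t <= T
  & forall s, 0 <= s -> s <= t -> u s <= u 0 + e * s]].
have E0 : E 0.
  split => // s s0 s0'; have -> : s = 0 by apply/eqP; rewrite eq_le s0 s0'.
  by rewrite mulr0 addr0.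
have supE : has_sup E by split; [exists 0 | exists T => t []].
pose c := sup E.
have c0 : 0 <= c by apply: ub_le_sup => //; case: supE.
have cT : c <= T by apply: ge_sup => [|t []//]; exists 0.
have ltc s : 0 <= s -> s < c -> u s <= u 0 + e * s.
  move=> s0 sc; have cs0 : 0 < c - s by rewrite subr_gt0.
  have [t [_ _ Et]] := sup_adherent cs0 supE.
  rewrite opprB addrCA subrr addr0 => /ltW; exact: Et.
have Ec : E c.
  split => // s s0; rewrite le_eqVlt => /predU1P[->|]; last exact: ltc.
  have [->|cn0] := eqVneq c 0; first by rewrite mulr0 addr0.
  have cp : 0 < c by rewrite lt0r cn0.
  apply/ler_addgt0Pr => e' e'0.
  have [s' [s'0 _ s'c us']] := uL c e' 1 cp cT e'0 ltr01.
  rewrite (le_trans us')// lerD2r (le_trans (ltc _ s'0 s'c))// lerD2l.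
  by rewrite ler_pM2l// ltW.
suff cTE : c = T.
  case: Ec => _ _ /(_ T T0); rewrite cTE lexx => /(_ isT) /le_trans; apply.
  by rewrite lerD2l.
apply/eqP; rewrite eq_le cT/= leNgt; apply/negP => ltcT.
have [h0 /= h00 Hh] := uR c e c0 ltcT e_gt0.
pose h := Num.min (h0 / 2) (T - c).
have h_gt0 : 0 < h by rewrite lt_min divr_gt0//= subr_gt0.
have : c + h <= c.
  apply: ub_le_sup; first by case: supE.
  split; first by rewrite addr_ge0// ltW.
    by rewrite -lerBrDl /h ge_min lexx orbT.
  move=> s s0 sch; have [sc|cs] := leP s c; first by case: Ec => _ _; exact.
  have -> : s = c + (s - c) by rewrite addrC subrK.
  have sc0 : 0 < s - c by rewrite subr_gt0.
  apply: (le_trans (Hh (s - c) _ sc0)).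
    rewrite /= sub0r normrN gtr0_norm//.
    apply: (@le_lt_trans _ _ (h0 / 2)); last by rewrite ltr_pdivrMr// ltr_pMr// ltr1n.
    by apply: (@le_trans _ _ h); [rewrite lerBlDl | rewrite /h ge_min lexx].
  rewrite (mulrDr e c (s - c)) addrA lerD2r; case: Ec => _ _; exact.
by rewrite gerDl leNgt h_gt0.
Qed.

(** The summand depends on both end points, so that Riemann sums in H and the
    sums of their coordinates are both instances. *)
Definition partition_sum (V : zmodType) (f : R -> R -> V) a (s : seq R) : V :=
  \sum_(i < size s) f (nth a (a :: s) i) (nth a (a :: s) i.+1).

Lemma partition_sum_cons (V : zmodType) (f : R -> R -> V) a b s :
  partition_sum f a (b :: s) = f a b + partition_sum f b s.
Proof.
rewrite /partition_sum big_ord_recl/=; congr (_ + _).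
apply: eq_bigr => i _; congr (f _ _); apply: set_nth_default; rewrite /= add0n.
  by rewrite ltnS ltnW.
exact: ltn_ord.
Qed.

Lemma partition_sum_cat (V : zmodType) (f : R -> R -> V) a s s' :
  partition_sum f a (s ++ s') =
  partition_sum f a s + partition_sum f (last a s) s'.
Proof.
elim: s a => [|b s IH] a /=; last by rewrite !partition_sum_cons IH addrA.
by rewrite {2}/partition_sum big_ord0 add0r.
Qed.

(** A partition of mesh less than delta is a path for this relation, so
    partitions can be concatenated and refined as paths. *)
Definition finer_than delta : rel R := fun x y => (x < y) && (y - x < delta).

Lemma exists_finer_partition a b delta : a <= b -> 0 < delta ->
  exists s, path (finer_than delta) a s /\ last a s = b.
Proof.
move=> ab d0; have d2 : 0 < delta / 2 by rewrite divr_gt0.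
have [n] : exists n : nat, b - a < n%:R * (delta / 2).
  exists (Num.truncn ((b - a) / (delta / 2))).+1.
  by rewrite -ltr_pdivrMr// truncnS_gt.
elim: n a ab => [|n IH] a ab; first by rewrite mul0r subr_lt0 ltNge ab.
move=> Hn; have [->|aNb] := eqVneq a b; first by exists [::].
have altb : a < b by rewrite lt_neqAle aNb.
have [ltd|led] := ltP (b - a) delta.
  by exists [:: b]; rewrite /= /finer_than altb ltd.
have ab' : a + delta / 2 <= b by lra.
have [|s [ps ls]] := IH (a + delta / 2) ab'.
  by move: Hn; rewrite -natr1 mulrDl mul1r; lra.
exists (a + delta / 2 :: s); split => //=; rewrite ps andbT /finer_than.
by apply/andP; split; lra.
Qed.

Lemma finer_partitionP a b delta (s : seq R) :
  path (finer_than delta) a s -> last a s = b ->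
  itv_partition a b s /\ forall i, (i < size s)%N ->
    nth a (a :: s) i.+1 - nth a (a :: s) i < delta.
Proof.
move=> ps ls; split.
  split; last by rewrite ls.
  by apply: sub_path ps => x y /andP[].
by move=> i si; have /(pathP a)/(_ i si)/andP[] := ps.
Qed.

(** Summation by parts moves the increments onto the monotone weight c, whose
    variation telescopes. *)
Lemma abel_bound (c l : R -> R) (A : R) a s :
  (forall x y, x <= y -> c x <= c y) -> 0 <= c a ->
  (forall x, a <= x -> x <= last a s -> `|l x| <= A) ->
  path <%R a s ->
  `|partition_sum (fun x y => c x * (l y - l x)) a s| <= 2 * A * c (last a s).
Proof.
move=> cmon ca0 lA ps; set S := partition_sum _ a s.
(* With the boundary term at a included, putting a new point in front of y
   changes the quantity by a multiple of l y alone. *)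
suff H : `|S + c a * l a| <= A * (2 * c (last a s) - c a).
  have -> : S = (S + c a * l a) - c a * l a by rewrite addrK.
  rewrite (le_trans (ler_normB _ _))//.
  have : `|c a * l a| <= c a * A.
    by rewrite normrM ger0_norm// ler_wpM2l// lA// path_le_last.
  by move: H; set X := `|_|; set Y := `|_|; set Z := c _; lra.
rewrite {}/S; elim: s a ca0 lA ps => [|y s IH] a ca0 lA /=.
  move=> _; rewrite /partition_sum big_ord0 add0r normrM ger0_norm//.
  by have := lA a (lexx _) (lexx _) => /(ler_wpM2l ca0); lra.
move=> /andP[ay ps]; rewrite partition_sum_cons.
have cay := cmon a y (ltW ay); have cy0 := le_trans ca0 cay.
have /= H := IH y cy0 _ ps.
have yl := path_le_last ps.
have lyA : `|l y| <= A by apply: lA => //=; exact: ltW.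
set S := partition_sum _ y s in H *.
have -> : c a * (l y - l a) + S + c a * l a = (c a - c y) * l y + (S + c y * l y).
  by ring.
rewrite (le_trans (ler_normD _ _))//.
have : `|(c a - c y) * l y| <= (c y - c a) * A.
  rewrite normrM distrC [`|c y - c a|]ger0_norm ?subr_ge0//.
  by apply: ler_wpM2l; rewrite ?subr_ge0.
have : `|S + c y * l y| <= A * (2 * c (last y s) - c y).
  by apply: H => x yx xl; apply: lA => //=; apply: le_trans yx; exact: ltW.
by set X := `|_|; set Y := `|_|; set Z := c _; lra.
Qed.

End RealLine.

(** * Integrals of functions given almost everywhere *)

Section AeIntegral.
Context {R : realType} {d : measure_display} {T : measurableType d}.
Variable mu : {measure set T -> \bar R}.
Implicit Types (D : set T) (f : T -> R) (I : R).

(** A Bochner integral controls its integrand only almost everywhere, and for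
    Lebesgue measure on the Borel sets this leaves the integrand possibly not
    measurable; hence the representative g. *)
Definition ae_integral D f I := exists g : T -> R,
  [/\ mu.-integrable D (EFin \o g),
      {ae mu, forall x, D x -> f x = g x}
    & (\int[mu]_(x in D) (g x)%:E = I%:E)%E].

(** The larger function v is later the distance between an integrand and a
    simple function, whose measurability is unknown. The simple functions
    below u, cut off on the null set, lie below v everywhere. *)
Lemma ge0_le_integral_ae D (u v : T -> \bar R) : measurable D ->
  measurable_fun D u ->
  (forall x, D x -> (0 <= u x)%E) -> (forall x, D x -> (0 <= v x)%E) ->
  {ae mu, forall x, D x -> (u x <= v x)%E} ->
  (\int[mu]_(x in D) u x <= \int[mu]_(x in D) v x)%E.
Proof.
move=> mD mu_ u0 v0 [N [mN N0 HN]].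
pose u' x := (u x * (\1_(~` N) x)%:E)%E.
have mu' : measurable_fun D u'.
  apply: emeasurable_funM => //; apply/measurable_EFinP.
  exact/measurable_indic/measurableC.
have u'0 x : D x -> (0 <= u' x)%E by move=> Dx; rewrite mule_ge0// ?u0// lee_fin.
have -> : (\int[mu]_(x in D) u x = \int[mu]_(x in D) u' x)%E.
  apply: ge0_ae_eq_integral => //.
  exists N; split => // x /= /not_implyP[Dx]; apply: contra_notP => xN.
  by rewrite /u' indicE mem_set// mule1.
rewrite !ge0_integralE//; apply: ub_ereal_sup => _ [h /= hu' <-].
apply: ereal_sup_ubound; exists h => // x; apply: (le_trans (hu' x)).
rewrite /patch; case: ifPn => // /set_mem Dx; rewrite /u' indicE.
have [xN|xN] := boolP (x \in ~` N); last by rewrite mule0 v0.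
rewrite mule1; move/set_mem: xN; apply: contra_notP => uv; apply: HN => /=.
by move=> /(_ Dx).
Qed.

Lemma ae_integral_linear D f f' I I' a : measurable D ->
  ae_integral D f I -> ae_integral D f' I' ->
  ae_integral D (fun x => a * f x + f' x) (a * I + I').
Proof.
move=> mD [g [ig fg gI]] [g' [ig' fg' gI']].
have iag : mu.-integrable D (fun x => (a%:E * (g x)%:E)%E).
  exact: (integrableZl mD a ig).
exists (fun x => a * g x + g' x); split.
- have := integrableD mD iag ig'; apply: eq_integrable => // x _ /=.
- by apply: filterS2 fg fg' => x Hx Hx' Dx; rewrite Hx// Hx'.
- under eq_integral do rewrite EFinD EFinM.
  rewrite (integralD mD iag ig') integralZl//.
  by rewrite gI gI' -EFinM -EFinD.
Qed.

Lemma eq_ae_integral D f f' I :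
  {ae mu, forall x, D x -> f' x = f x} -> ae_integral D f I ->
  ae_integral D f' I.
Proof.
move=> ff' [g [ig fg gI]]; exists g; split => //.
by apply: filterS2 ff' fg => x Hx Hx' Dx; rewrite Hx// Hx'.
Qed.

Lemma ae_integral_null D f : measurable D -> mu D = 0%E -> ae_integral D f 0.
Proof.
move=> mD D0; exists (cst 0); split.
- exact: integrable0.
- by exists D; split => // x /not_implyP[].
- by rewrite integral0.
Qed.

Lemma ae_integral_diff D1 D2 f I I1 : measurable D1 -> measurable D2 ->
  [disjoint D1 & D2] ->
  ae_integral (D1 `|` D2) f I -> ae_integral D1 f I1 ->
  ae_integral D2 f (I - I1).
Proof.
move=> mD1 mD2 D12 [g [ig fg gI]] [g1 [ig1 fg1 gI1]].
have mU : measurable (D1 `|` D2) by exact: measurableU.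
have igD1 : mu.-integrable D1 (EFin \o g).
  by apply: integrableS ig => //; exact: subsetUl.
have igD2 : mu.-integrable D2 (EFin \o g).
  by apply: integrableS ig => //; exact: subsetUr.
exists g; split => //.
  by apply: filterS fg => x + D2x; apply; right.
have := gI; rewrite integral_setU//; last exact: measurable_int ig.
have -> : (\int[mu]_(x in D1) (g x)%:E = I1%:E)%E.
  rewrite -gI1; apply: ae_eq_integral => //.
  - exact: measurable_int igD1.
  - exact: measurable_int ig1.
  - by apply: filterS2 fg fg1 => x H H1 D1x; rewrite -H1//; congr EFin; rewrite H//; left.
have : (\int[mu]_(x in D2) (g x)%:E)%E \is a fin_num by exact: integrable_fin_num.
case: (integral _ _ _) => // r _ /=; rewrite -EFinD => -[<-].
by rewrite addrC addKr.
Qed.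

Lemma ae_integral_bound D f I (K c : R) : measurable D -> mu D = c%:E ->
  (forall x, D x -> `|f x| <= K) -> ae_integral D f I -> `|I| <= K * c.
Proof.
move=> mD Dc fK [g [ig fg gI]].
have mg := measurable_int _ ig.
rewrite -lee_fin -abse_EFin -gI (le_trans (le_abse_integral _ mD mg))//.
rewrite EFinM -Dc -integral_cst//.
have [Dx0|/set0P[x0 Dx0]] := eqVneq D set0; first by rewrite Dx0 !integral_set0.
apply: ge0_le_integral_ae => //.
- exact: measurableT_comp.
- by move=> x Dx; rewrite lee_fin (le_trans _ (fK x0 Dx0)).
- by apply: filterS fg => x H Dx; rewrite /= -H// lee_fin fK.
Qed.

(** The exceptional sets of all the representatives are cut out together; on
    what remains the convergence is pointwise. *)
Lemma ae_integral_dominated D (f_ : nat -> T -> R) f (I_ : nat -> R) I K :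
  measurable D -> (mu D < +oo)%E ->
  (forall n, ae_integral D (f_ n) (I_ n)) ->
  (forall n x, D x -> `|f_ n x| <= K) ->
  (forall x, D x -> f_ n x @[n --> \oo] --> f x) ->
  I_ n @[n --> \oo] --> I ->
  ae_integral D f I.
Proof.
move=> mD Doo /choice[g_ g_P] fK ff II.
have /ae_foralln[N [mN N0 HN]] : forall n, {ae mu, forall x, D x -> f_ n x = g_ n x}.
  by move=> n; case: (g_P n).
have E n x : D x -> ~ N x -> f_ n x = g_ n x.
  by move=> Dx; apply: contra_notP => H; apply: HN => /= /(_ n Dx).
pose g x := f x * \1_(~` N) x.
pose h n x := g_ n x * \1_(~` N) x.
have mh n : measurable_fun D (h n).
  apply: measurable_funM; first by case: (g_P n) => /measurable_int/measurable_EFinP.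
  exact/measurable_indic/measurableC.
have hg x : D x -> h n x @[n --> \oo] --> g x.
  move=> Dx; rewrite /h /g indicE; have [/set_mem xN|_] := boolP (x \in ~` N).
    rewrite !mulr1; under eq_fun do rewrite mulr1 -E//; exact: ff.
  by under eq_fun do rewrite mulr0; rewrite mulr0; exact: cvg_cst.
have mg : measurable_fun D g.
  exact: (@measurable_fun_cvg _ _ _ D h).
have Kint : mu.-integrable D (EFin \o cst `|K|).
  apply: measurable_bounded_integrable => //.
  by exists `|K|; split => [|M KM x _ /=]; rewrite ?num_real// normr_id ltW.
have [] := @dominated_convergence _ _ _ mu D mD (fun n x => (h n x)%:E) (EFin \o g)
    (EFin \o cst `|K|).
- by move=> n; exact/measurable_EFinP.
- exact/measurable_EFinP.
- by apply: aeW => x Dx; apply: cvg_EFin; [exact: nearW|exact: hg].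
- exact: Kint.
- apply: aeW => x n Dx /=; rewrite lee_fin /h indicE.
  have [/set_mem xN|_] := boolP (x \in ~` N); last by rewrite mulr0 normr0.
  by rewrite mulr1 -E// (le_trans (fK n x Dx))// ler_norm.
move=> ig _ cI; exists g; split => //.
  exists N; split => // x /= /not_implyP[Dx]; apply: contra_notP => xN.
  by rewrite /g indicE mem_set// mulr1.
apply/esym; apply: (cvg_unique _ _ cI) => //=.
rewrite (_ : (fun n => _) = EFin \o I_); first by apply: cvg_EFin => //; exact: nearW.
apply/funext => n /=; have [ign _ <-] := g_P n.
apply: ae_eq_integral => //.
- exact/measurable_EFinP.
- exact: measurable_int ign.
- exists N; split => // x /= /not_implyP[Dx]; apply: contra_notP => xN.
  by rewrite /h indicE mem_set// mulr1.
Qed.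

(** The functional maps the simple functions approximating f to scalar ones
    and, being Lipschitz, preserves their convergence in L^1, hence that of
    their integrals. *)
Lemma bochner_ae_integral (V : normedModType R) D (f : T -> V) (v : V)
    (l : V -> R) (C : R) : measurable D ->
  (forall a x y, l (a *: x + y) = a * l x + l y) ->
  (forall x, `|l x| <= C * `|x|) ->
  is_bochner_integral mu D f v -> ae_integral D (fun x => l (f x)) (l v).
Proof.
move=> mD llin lC [k [E [c]]] /= [EP [N [mN N0 HN]] L1 cv].
pose phi n x : V := \sum_(i < k n) (\1_(E n i) x : R) *: c n i.
have l0 : l 0 = 0 by have := llin 1 0 0; rewrite scale1r addr0 mul1r => /eqP; rewrite -subr_eq subrr eq_sym => /eqP.
have lD x y : l (x + y) = l x + l y by rewrite -[x]scale1r llin mul1r scale1r.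
have lZ a x : l (a *: x) = a * l x by rewrite -[_ *: x]addr0 llin l0 addr0.
have lB x y : l (x - y) = l x - l y by rewrite lD -scaleN1r lZ mulN1r.
have C0 : 0 <= `|C| by [].
have lC' x : `|l x| <= `|C| * `|x|.
  by rewrite (le_trans (lC x))// ler_wpM2r// ler_norm.
have lsum n (F : 'I_n -> V) : l (\sum_(i < n) F i) = \sum_(i < n) l (F i).
  exact: (big_morph l lD l0).
have lcont (u : nat -> V) x : u n @[n --> \oo] --> x -> l (u n) @[n --> \oo] --> l x.
  move=> ux; apply/cvgrPdist_le => e e0.
  have Ce : 0 < e / (`|C| + 1) by rewrite divr_gt0// ltr_pwDr.
  near=> n; rewrite -lB (le_trans (lC' _))//.
  have : `|x - u n| <= e / (`|C| + 1).
    by near: n; move/cvgrPdist_le : ux; apply.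
  rewrite ler_pdivlMr ?ltr_pwDr// => H; apply: le_trans H; rewrite mulrC.
  by apply: ler_wpM2l => //; rewrite lerDl.
pose psi n x := \sum_(i < k n) l (c n i) * \1_(E n i) x.
have psiE n x : l (phi n x) = psi n x.
  by rewrite /phi lsum; apply: eq_bigr => i _; rewrite lZ mulrC.
have iE n i : mu.-integrable D (fun x => (l (c n i))%:E * (\1_(E n i) x)%:E)%E.
  have [mE ED Eoo] := EP n i; apply: integrableZl => //.
  apply/integrableP; split; first exact/measurable_EFinP/measurable_indic.
  under eq_integral do rewrite gee0_abs ?lee_fin//.
  by rewrite integral_indic// setIidl.
have psiEe n x : (psi n x)%:E = (\sum_(i < k n) (l (c n i))%:E * (\1_(E n i) x)%:E)%E.
  by rewrite -sumEFin; apply: eq_bigr => i _; rewrite EFinM.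
have ipsi n : mu.-integrable D (EFin \o psi n).
  have := integrable_sum mD (index_enum 'I_(k n)) (P := xpredT) (fun i _ => iE n i).
  by apply: eq_integrable => // x _ /=; rewrite psiEe.
have Ipsi n : (\int[mu]_(x in D) (psi n x)%:E =
    (l (\sum_(i < k n) fine (mu (E n i)) *: c n i))%:E)%E.
  under eq_integral do rewrite psiEe.
  rewrite (@integral_sum _ _ _ mu D mD _ (fun i : 'I_(k n) => _) (fun i => iE n i)) lsum -sumEFin; apply: eq_bigr => i _.
  have [mE ED Eoo] := EP n i.
  rewrite integralZl//; last first.
    apply/integrableP; split; first exact/measurable_EFinP/measurable_indic.
    under eq_integral do rewrite gee0_abs ?lee_fin//.
    by rewrite integral_indic// setIidl.
  rewrite integral_indic// setIidl// lZ mulrC EFinM fineK//.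
  by rewrite ge0_fin_numE.
pose g x := l (f x) * \1_(~` N) x.
have cvN x : D x -> ~ N x -> phi n x @[n --> \oo] --> f x.
  by move=> Dx; apply: contra_notP => H; apply: HN => /= /(_ Dx).
have mg : measurable_fun D g.
  apply: (@measurable_fun_cvg _ _ _ D (fun n x => psi n x * \1_(~` N) x)).
    move=> n; apply: measurable_funM; first exact/measurable_EFinP/(measurable_int _ (ipsi n)).
    exact/measurable_indic/measurableC.
  move=> x Dx; rewrite /g indicE; have [/set_mem xN|_] := boolP (x \in ~` N).
    rewrite mulr1; under eq_fun do rewrite mulr1 -psiE; exact/lcont/cvN.
  by under eq_fun do rewrite mulr0; rewrite mulr0; exact: cvg_cst.
have lfg : {ae mu, forall x, D x -> l (f x) = g x}.
  exists N; split => // x /= /not_implyP[Dx]; apply: contra_notP => xN.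
  by rewrite /g indicE mem_set// mulr1.
have mpsi n : measurable_fun D (psi n) by exact/measurable_EFinP/(measurable_int _ (ipsi n)).
pose u n := (\int[mu]_(x in D) (`|g x - psi n x|)%:E)%E.
have u0 n : (0 <= u n)%E by apply: integral_ge0 => x _; rewrite lee_fin.
have u_le n : (u n <= (`|C| + 1)%:E * \int[mu]_(x in D) (`|f x - phi n x|)%:E)%E.
  have C1 : 0 < `|C| + 1 by rewrite ltr_pwDr.
  rewrite -lee_pdivrMl// -ge0_integralZl//; last first.
    apply/measurable_EFinP/measurableT_comp => //; exact: measurable_funB.
  apply: ge0_le_integral_ae => //.
  - apply: emeasurable_funM => //; apply/measurable_EFinP/measurableT_comp => //.
    exact: measurable_funB.
  - apply: filterS lfg => x H Dx; rewrite -H// -psiE -lB -EFinM lee_fin.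
    rewrite ler_pdivrMl//  (le_trans (lC' _))// ler_wpM2r// lerDl//.
have u_cvg : u n @[n --> \oo] --> 0%E.
  apply: (@squeeze_cvge _ _ _ _ (cst 0%E) _
    (fun n => (`|C| + 1)%:E * \int[mu]_(x in D) (`|f x - phi n x|)%:E)%E).
  - by apply: nearW => n; rewrite u0 u_le.
  - exact: cvg_cst.
  - rewrite -(mule0 (`|C| + 1)%:E); exact: cvgeZl.
have /fine_cvgP[ufin uc] := u_cvg.
have ipsiB n : u n \is a fin_num -> mu.-integrable D (fun x => (g x - psi n x)%:E).
  move=> un; apply/integrableP; split; first exact/measurable_EFinP/measurable_funB.
  by rewrite ltey_eq; apply/orP; left; exact: un.
have ig : mu.-integrable D (EFin \o g).
  have [n _ /(_ n (leqnn n)) /ipsiB iB] := ufin.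
  have := integrableD mD iB (ipsi n); apply: eq_integrable => // x _ /=.
  by rewrite -EFinD subrK.
exists g; split => //.
have Ifin : (\int[mu]_(x in D) (g x)%:E)%E \is a fin_num by exact: integrable_fin_num.
rewrite -(fineK Ifin); congr EFin.
pose s n := \sum_(i < k n) fine (mu (E n i)) *: c n i.
suff : l (s n) @[n --> \oo] --> fine (\int[mu]_(x in D) (g x)%:E).
  by move/cvg_unique; apply => //; exact: lcont.
apply/cvgrPdist_le => e e0; near=> n.
have un : u n \is a fin_num by near: n.
have -> : fine (\int[mu]_(x in D) (g x)%:E) - l (s n) =
    fine (\int[mu]_(x in D) (g x - psi n x)%:E).
  apply: EFin_inj; rewrite EFinB fineK// -Ipsi fineK; last exact: integrable_fin_num (ipsiB n un).
  by rewrite -integralB_EFin.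
rewrite -lee_fin -abse_EFin fineK; last exact: integrable_fin_num (ipsiB n un).
apply: (@le_trans _ _ (u n)).
  by apply: le_abse_integral => //; exact: measurable_int (ipsiB n un).
rewrite -(fineK un) lee_fin (le_trans (ler_norm _))// -normrN -sub0r.
by near: n; move/cvgrPdist_le: uc; apply.
Unshelve. all: by end_near. Qed.

Lemma ae_integral_restrict (D D' : set T) (f : T -> R) I :
  measurable D -> measurable D' -> D' `<=` D -> ae_integral D f I ->
  exists J, ae_integral D' f J.
Proof.
move=> mD mD' DD [g [ig fg _]].
have ig' : mu.-integrable D' (EFin \o g) by exact: integrableS ig.
exists (fine (\int[mu]_(x in D') (g x)%:E)); exists g; split => //.
  by apply: filterS fg => x + D'x; apply; exact: DD.
by rewrite fineK//; exact: integrable_fin_num.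
Qed.

Lemma ae_integral_cst (D : set T) (a c : R) : measurable D -> mu D = c%:E ->
  ae_integral D (fun=> a) (a * c).
Proof.
move=> mD Dc; exists (cst a); split; last first.
  by rewrite (_ : (fun x => (cst a x)%:E) = cst a%:E)// integral_cst// Dc EFinM.
  exact: aeW.
apply: measurable_bounded_integrable => //; first by rewrite Dc ltry.
by exists `|a|; split => [|M aM x _ /=]; [exact: num_real | exact: ltW].
Qed.

Lemma ae_integral_sum (D : set T) n (a : 'I_n -> R) (f : 'I_n -> T -> R) (I : 'I_n -> R) :
  measurable D -> (forall k, ae_integral D (f k) (I k)) ->
  ae_integral D (fun x => \sum_(k < n) a k * f k x) (\sum_(k < n) a k * I k).
Proof.
move=> mD; elim: n a f I => [|n IH] a f I fI.
  under eq_fun do rewrite big_ord0; rewrite big_ord0.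
  by exists (cst 0); split; [exact: integrable0 | exact: aeW | rewrite integral0].
under eq_fun do rewrite big_ord_recl; rewrite big_ord_recl.
apply: ae_integral_linear => //.
exact: (IH (fun i => a (lift ord0 i)) (fun i => f (lift ord0 i)) (fun i => I (lift ord0 i))).
Qed.

End AeIntegral.

(** * Coordinates and measurability in a Hilbert space *)

Lemma continuous_measurable_borel {R : realType} {V : normedModType R}
    (f : V -> R) : continuous f -> measurable_fun setT (f : borel V -> R).
Proof.
move=> cf; apply: (measurability _ (RGenOInfty.measurableE R)).
move=> _ [_ [x ->] <-]; rewrite setTI; apply: sub_sigma_algebra.
by apply: open_comp => //; exact: open_gt.
Qed.

Lemma continuous_measurable_comp {R : realType} {V : normedModType R}
    {d : measure_display} {Om : measurableType d} (f : V -> R) (Y : Om -> V) :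
  continuous f -> measurable_fun setT (Y : Om -> borel V) ->
  measurable_fun setT (fun w => f (Y w)).
Proof.
move=> /continuous_measurable_borel mf mY; exact: (measurableT_comp mf mY).
Qed.

Section Hilbert.
Context {R : realType} {H : completeNormedModType R}.
Variables (ip : H -> H -> R) (e : nat -> H).
Hypothesis ipP : inner_product_of ip.

Lemma ipC x y : ip x y = ip y x. Proof. by case: ipP. Qed.
Lemma ipxx x : ip x x = `|x| ^+ 2. Proof. by case: ipP. Qed.
Lemma ip_linl z a x y : ip (a *: x + y) z = a * ip x z + ip y z.
Proof. by case: ipP. Qed.
Lemma ip0l z : ip 0 z = 0.
Proof.
have := ip_linl z 1 0 0; rewrite scale1r addr0 mul1r => /eqP.
by rewrite -subr_eq subrr eq_sym => /eqP.
Qed.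
Lemma ipDl x y z : ip (x + y) z = ip x z + ip y z.
Proof. by rewrite -[x]scale1r ip_linl mul1r scale1r. Qed.
Lemma ipZl a x z : ip (a *: x) z = a * ip x z.
Proof. by rewrite -[_ *: x]addr0 ip_linl ip0l addr0. Qed.
Lemma ipNl x z : ip (- x) z = - ip x z.
Proof. by rewrite -scaleN1r ipZl mulN1r. Qed.
Lemma ipBl x y z : ip (x - y) z = ip x z - ip y z.
Proof. by rewrite ipDl ipNl. Qed.
Lemma ip0r z : ip z 0 = 0. Proof. by rewrite ipC ip0l. Qed.
Lemma ipDr x y z : ip z (x + y) = ip z x + ip z y.
Proof. by rewrite !(ipC z) ipDl. Qed.
Lemma ipZr a x z : ip z (a *: x) = a * ip z x.
Proof. by rewrite !(ipC z) ipZl. Qed.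
Lemma ipBr x y z : ip z (x - y) = ip z x - ip z y.
Proof. by rewrite !(ipC z) ipBl. Qed.
Lemma ip_suml (I : Type) (s : seq I) (Q : pred I) (F : I -> H) z :
  ip (\sum_(i <- s | Q i) F i) z = \sum_(i <- s | Q i) ip (F i) z.
Proof. exact: (big_morph (ip ^~ z) (fun x y => ipDl x y z) (ip0l z)). Qed.
Lemma ip_sumr (I : Type) (s : seq I) (Q : pred I) (F : I -> H) z :
  ip z (\sum_(i <- s | Q i) F i) = \sum_(i <- s | Q i) ip z (F i).
Proof. exact: (big_morph (ip z) (fun x y => ipDr x y z) (ip0r z)). Qed.

Lemma cauchy_schwarz x y : `|ip x y| <= `|x| * `|y|.
Proof.
have [->|y0] := eqVneq y 0; first by rewrite ip0r !normr0 mulr0.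
have y2 : 0 < `|y| ^+ 2 by rewrite exprn_gt0// normr_gt0.
have := sqr_ge0 `|x - (ip x y / `|y| ^+ 2) *: y|.
rewrite -(ipxx (x - _)) ipBl !ipBr !ipZl !ipZr !ipxx (ipC y x).
set a := ip x y; set X := `|x|; set Y := `|y| ^+ 2 in y2 *.
have -> : X ^+ 2 - a / Y * a - (a / Y * a - a / Y * (a / Y * Y)) = X ^+ 2 - a ^+ 2 / Y.
  by field; rewrite gt_eqF.
rewrite subr_ge0 ler_pdivrMr// /Y -exprMn => h.
have : `|a| ^+ 2 <= (X * `|y|) ^+ 2 by rewrite real_normK ?num_real.
by rewrite ler_pXn2r// nnegrE /X mulr_ge0.
Qed.

Lemma cvg_ipl {T : Type} (F : set_system T) {FF : Filter F} (u : T -> H) x z :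
  u @ F --> x -> ip (u t) z @[t --> F] --> ip x z.
Proof.
move=> ux; apply/cvgrPdist_le => eps eps0.
have ez : 0 < eps / (`|z| + 1) by rewrite divr_gt0// ltr_pwDr.
near=> t; rewrite -ipBl (le_trans (cauchy_schwarz _ _))//.
have : `|x - u t| <= eps / (`|z| + 1).
  by near: t; move/cvgrPdist_le : ux; apply.
rewrite ler_pdivlMr ?ltr_pwDr// => h; apply: le_trans h.
by rewrite ler_wpM2l// lerDl.
Unshelve. all: by end_near. Qed.

Hypothesis eP : orthonormal_basis ip e.

Lemma ip_ee i k : ip (e i) (e k) = (i == k)%:R.
Proof. by case: eP. Qed.

Lemma basis_norm1 k : `|e k| = 1.
Proof. by apply/eqP; rewrite -(@eqrXn2 _ 2)// -ipxx ip_ee eqxx expr1n. Qed.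

Definition coord_sum n x := \sum_(k < n) ip x (e k) *: e k.

Lemma ip_span n (a : nat -> R) k :
  ip (\sum_(i < n) a i *: e i) (e k) = if (k < n)%N then a k else 0.
Proof.
rewrite ip_suml; under eq_bigr do rewrite ipZl ip_ee.
case: ifPn => kn.
  rewrite (bigD1 (Ordinal kn))//= eqxx mulr1 big1 ?addr0// => i /negP ik.
  case: eqP => [E|]; last by rewrite mulr0.
  by exfalso; apply: ik; apply/eqP/val_inj.
rewrite big1// => i _; case: eqP => [E|]; last by rewrite mulr0.
by exfalso; move: kn; rewrite -E ltn_ord.
Qed.

Lemma norm_span n (a : nat -> R) :
  `|\sum_(i < n) a i *: e i| ^+ 2 = \sum_(i < n) a i ^+ 2.
Proof.
rewrite -ipxx ip_sumr; apply: eq_bigr => i _.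
by rewrite ipZr ip_span ltn_ord expr2.
Qed.

Lemma coord_sum_cvg x : coord_sum n x @[n --> \oo] --> x.
Proof.
have := eP.2 x; rewrite (_ : series _ = coord_sum ^~ x)//.
by apply/funext => n; rewrite /series/= big_mkord.
Qed.

Lemma norm_coord_sum n x : `|coord_sum n x| ^+ 2 = \sum_(k < n) ip x (e k) ^+ 2.
Proof. by rewrite /coord_sum (norm_span n (fun k => ip x (e k))). Qed.

Lemma parseval x : \sum_(k < n) ip x (e k) ^+ 2 @[n --> \oo] --> `|x| ^+ 2.
Proof.
under eq_fun do rewrite -norm_coord_sum expr2.
by rewrite expr2; apply: cvgM; apply: cvg_norm; exact: coord_sum_cvg.
Qed.

Lemma norm_le_coord x y (c : R) : 0 <= c ->
  (forall k, `|ip y (e k)| <= c * `|ip x (e k)|) -> `|y| <= c * `|x|.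
Proof.
move=> c0 yx; rewrite -(@ler_pXn2r _ 2)// ?nnegrE ?mulr_ge0// exprMn.
have cx : c ^+ 2 * \sum_(k < n) ip x (e k) ^+ 2 @[n --> \oo] --> c ^+ 2 * `|x| ^+ 2.
  by apply: cvgM; [exact: cvg_cst | exact: parseval].
apply: (ler_cvg_to (@parseval y) cx); apply: nearW => n.
rewrite mulr_sumr; apply: ler_sum => k _.
rewrite -exprMn -[X in X <= _]real_normK ?num_real//.
rewrite -[X in _ <= X]real_normK ?num_real//.
by rewrite ler_pXn2r ?nnegrE// normrM (ger0_norm c0).
Qed.

Lemma eq_coord x y : (forall k, ip x (e k) = ip y (e k)) -> x = y.
Proof.
move=> xy; apply/eqP; rewrite -subr_eq0 -normr_le0.
have := @norm_le_coord 0 (x - y) 0 (lexx _); rewrite mul0r; apply => k.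
by rewrite ipBl xy subrr normr0 mul0r.
Qed.

(** Test against the partial sums of the expansion of y itself. *)
Lemma norm_le_span y (M : R) : 0 <= M ->
  (forall n (a : nat -> R), ip y (\sum_(i < n) a i *: e i) <=
     M * `|\sum_(i < n) a i *: e i|) -> `|y| <= M.
Proof.
move=> M0 yM.
apply: (ler_cvg_to (cvg_norm (@coord_sum_cvg y)) (cvg_cst M)); apply: nearW => n.
have [->|s0] := eqVneq (coord_sum n y) 0; first by rewrite normr0.
rewrite -(@ler_pM2r _ `|coord_sum n y|) ?normr_gt0// -expr2.
apply: le_trans (yM n (fun k => ip y (e k))).
rewrite norm_coord_sum ip_sumr; apply: ler_sum => k _.
by rewrite ipZr expr2.
Qed.

Definition rational_point (c : seq rat) : H :=
  \sum_(i < size c) (ratr (c`_i) : R) *: e i.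

Lemma rational_point_dense x (eps : R) : 0 < eps ->
  exists c, `|x - rational_point c| < eps.
Proof.
move=> eps0; have e2 : 0 < eps / 2 by rewrite divr_gt0.
have /cvgrPdist_lt/(_ _ e2)[n _ /(_ n (leqnn n)) /= xn] := @coord_sum_cvg x.
have dn : 0 < eps / 2 / n.+1%:R by rewrite divr_gt0.
have /choice[q qP] : forall k, exists q : rat,
    `|ip x (e k) - ratr q| < eps / 2 / n.+1%:R.
  move=> k; have [|q] := @rat_in_itvoo R (ip x (e k) - eps / 2 / n.+1%:R) (ip x (e k) + eps / 2 / n.+1%:R).
    by rewrite ltrBlDr -addrA ltrDl addr_gt0.
  by rewrite in_itv/= => /andP[q1 q2]; exists q; rewrite distrC ltr_distl q1.
exists (mkseq q n).
rewrite (le_lt_trans (ler_distD (coord_sum n x) _ _))//.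
rewrite [eps]splitr ltr_leD//.
have -> : rational_point (mkseq q n) = \sum_(i < n) (ratr (q i) : R) *: e i.
  rewrite /rational_point size_mkseq; apply: eq_bigr => i _.
  by rewrite nth_mkseq.
rewrite /coord_sum -sumrB; under eq_bigr do rewrite -scalerBl.
rewrite (le_trans (ler_norm_sum _ _ _))//.
apply: (@le_trans _ _ (\sum_(i < n) eps / 2 / n.+1%:R)).
  by apply: ler_sum => i _; rewrite normrZ basis_norm1 mulr1 ltW.
rewrite sumr_const card_ord -[X in X <= _]mulr_natr mulrAC ler_pdivrMr// ler_pM2l//.
by rewrite ler_nat.
Qed.

Section Measurability.
Context {d : measure_display} {Om : measurableType d}.

(** Distances to a fixed point are measurable by Parseval's identity, and an
    open set is a countable union of balls centred at rational combinations of
    the basis vectors. *)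
Lemma weakly_measurable (Y : Om -> H) :
  (forall k, measurable_fun setT (fun w => ip (Y w) (e k))) ->
  measurable_fun setT (Y : Om -> borel H).
Proof.
move=> mY.
have mball a (r : R) : measurable [set w | `|a - Y w| < r].
  have [r0|r0] := leP r 0.
    rewrite (_ : mkset _ = set0)//; apply/seteqP; split => // w /=.
    by move=> /lt_le_trans /(_ r0); rewrite normr_lt0.
  have mf : measurable_fun setT (fun w => `|a - Y w| ^+ 2).
    apply: (@measurable_fun_cvg _ _ _ setT
      (fun n w => \sum_(k < n) ip (a - Y w) (e k) ^+ 2)); last first.
      by move=> w _; exact: parseval.
    move=> n; apply: measurable_sum => k.
    apply: measurable_funX; under eq_fun do rewrite ipBl.
    exact: measurable_funB.
  rewrite (_ : mkset _ = setT `&` (fun w => `|a - Y w| ^+ 2) @^-1` `]-oo, r ^+ 2[).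
    exact: mf.
  rewrite setTI; apply/seteqP; split => w /=; rewrite in_itv/=;
    by rewrite ltr_pXn2r ?nnegrE ?(ltW r0).
apply: (@measurability _ _ Om (borel H) setT Y (@open H)) => // _ [U oU <-]; rewrite setTI.
pose ok (p : seq rat * nat) := forall h, `|rational_point p.1 - h| < p.2.+1%:R^-1 -> U h.
have -> : Y @^-1` U = \bigcup_p [set w | ok p /\ `|rational_point p.1 - Y w| < p.2.+1%:R^-1].
  apply/seteqP; split => [w /= Uw|w [p _ [okp]]]; last exact: okp.
  have /nbhs_ballP[r /= r0 rU] : nbhs (Y w) U by exact: open_nbhs_nbhs.
  have [n nr] : exists n : nat, n.+1%:R^-1 < r / 2.
    by apply: exists_invS_lt; rewrite divr_gt0.
  have n0 : 0 < n.+1%:R^-1 :> R by [].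
  have [c cY] := rational_point_dense (Y w) n0.
  exists (c, n) => //; split; last by rewrite /= distrC.
  move=> h /= ch; apply: rU; rewrite -ball_normE /=.
  rewrite (le_lt_trans (ler_distD (rational_point c) _ _))//.
  by rewrite [r]splitr ltrD// (lt_trans _ nr).
apply: countable_bigcupT_measurable => // p.
have [okp|nokp] := pselect (ok p).
  rewrite (_ : mkset _ = [set w | `|rational_point p.1 - Y w| < p.2.+1%:R^-1])//.
  by apply/seteqP; split => w /=; [case|].
by rewrite (_ : mkset _ = set0)//; apply/seteqP; split => w //= -[].
Qed.

Lemma measurable_dist_ge (Y Z : Om -> H) (eps : R) :
  measurable_fun setT (Y : Om -> borel H) ->
  measurable_fun setT (Z : Om -> borel H) ->
  measurable [set w | eps <= `|Y w - Z w|].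
Proof.
move=> mY mZ.
have mD : measurable_fun setT ((fun w => Y w - Z w) : Om -> borel H).
  apply: (weakly_measurable) => k; under eq_fun do rewrite ipBl.
  apply: measurable_funB;
    by apply: (continuous_measurable_comp (f := ip ^~ (e k))) => // y; exact: cvg_ipl.
rewrite -[X in measurable X]setTI; apply: measurable_fun_le => //.
by apply: (continuous_measurable_comp (f := fun h : H => `|h|)) => //; exact: norm_continuous.
Qed.

End Measurability.
End Hilbert.

(** * The semigroup in the eigenbasis *)

Section BoundedLinear.
Context {R : realType} {V W : normedModType R}.

Lemma linear_continuous_bound (f : {linear V -> W}) : continuous f ->
  exists2 M : R, 0 <= M & forall x, `|f x| <= M * `|x|.
Proof.
move=> /(_ 0) /(continuous_linear_bounded (0 : V)) /linear_boundedP [M [Mr HM]].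
exists (`|M| + 1) => [|x]; first by rewrite addr_ge0.
by apply: (HM (`|M| + 1)); rewrite (le_lt_trans (ler_norm M))// ltrDl.
Qed.

Lemma linear_bound_continuous (f : {linear V -> W}) (M : R) :
  (forall x, `|f x| <= M * `|x|) -> continuous f.
Proof.
move=> fM; apply/linear_bounded_continuous/linear_boundedP.
near=> r => x; rewrite (le_trans (fM x))// ler_wpM2r//.
Unshelve. all: by end_near. Qed.

Lemma linear_bound_fun_norm (f : {linear V -> W}) (M : R) : 0 <= M ->
  (forall x, `|f x| <= M * `|x|) -> bounded_fun_norm f.
Proof.
move=> M0 fM r; exists (M * r) => x xr.
by rewrite (le_trans (fM x))// ler_wpM2l.
Qed.

End BoundedLinear.

Lemma uniform_boundedness {R : realType} {V : completeNormedModType R}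
    {W : normedModType R} (f : nat -> {linear V -> W}) :
  (forall n, continuous (f n)) ->
  (forall x, exists M : R, forall n, `|f n x| <= M) ->
  exists2 M : R, 0 <= M & forall n x, `|f n x| <= M * `|x|.
Proof.
move=> fc fb.
have [||M HM] := @Banach_Steinhauss R V W [set g : V -> W | exists n, g = f n :> (V -> W)] _ _ 1.
- move=> _ [n ->]; split; last exact: linearP.
  have [C C0 HC] := linear_continuous_bound (fc n).
  exact: linear_bound_fun_norm HC.
- by move=> x; have [M HM] := fb x; exists M => _ [n ->].
exists `|M| => // n x; have [->|x0] := eqVneq x 0.
  by rewrite linear0 !normr0 mulr0.
have nx0 : 0 < `|x| by rewrite normr_gt0.
have := HM (f n) (ex_intro _ n erefl) (`|x|^-1 *: x).
rewrite normrZ normrV ?unitfE ?normr_eq0// normr_id mulVf ?normr_eq0//.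
rewrite lexx linearZ normrZ normrV ?unitfE ?normr_eq0// normr_id => /(_ isT).
by rewrite ler_pdivrMl// mulrC => /le_trans; apply; rewrite ler_wpM2r// ler_norm.
Qed.

Section Semigroup.
Context {R : realType} {V : completeNormedModType R}.
Variable S : R -> {linear V -> V}.
Hypothesis SP : C0_semigroup S.

(** Otherwise some times tending to 0 would have operator norms tending to
    infinity, although every orbit converges along them; this contradicts the
    uniform boundedness principle. *)
Lemma semigroup_loc_bound : exists delta : R, exists M : R,
  [/\ 0 < delta, 1 <= M
    & forall s x, 0 <= s -> s <= delta -> `|S s x| <= M * `|x|].
Proof.
case: SP => Sc S0 SD Scvg.
apply: contrapT => /forallNP noM.
have /choice[s sP] : forall n : nat, exists s : R, [/\ 0 <= s, s <= n.+1%:R^-1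
    & exists x, n.+1%:R * `|x| < `|S s x|].
  move=> n; apply: contrapT => /forallNP H.
  apply: (noM n.+1%:R^-1); exists n.+1%:R; split => //; first by rewrite ler1n.
  move=> s x s0 sn; rewrite leNgt; apply/negP => Hx.
  by apply: (H s); split => //; exists x.
have [||M M0 HM] := @uniform_boundedness R V V (fun n => S (s n)) _ _.
- by move=> n; apply: Sc; case: (sP n).
- move=> x.
  have /cvgrPdist_le/(_ _ ltr01)[dx /= dx0 Hdx] := Scvg x.
  have [N N1] := exists_invS_lt dx0.
  exists (\sum_(k < N) `|S (s k) x| + (`|x| + 1)) => n.
  have [s0 sn _] := sP n.
  have [nN|Nn] := ltnP n N.
    rewrite (bigD1 (Ordinal nN))//= -addrA lerDl addr_ge0 ?addr_ge0//.
    exact: sumr_ge0.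
  rewrite -[X in X <= _]add0r lerD ?sumr_ge0//.
  have [->|sn0] := eqVneq (s n) 0; first by rewrite S0 lerDl.
  have snp : 0 < s n by rewrite lt0r sn0.
  have : `|x - S (s n) x| <= 1.
    apply: Hdx => //=; rewrite sub0r normrN gtr0_norm//.
    apply: le_lt_trans N1; rewrite (le_trans sn)// lef_pV2 ?posrE// ler_nat.
    exact: leq_trans Nn _.
  rewrite distrC -{2}[S (s n) x](subrK x) addrC => H.
  by rewrite (le_trans (ler_normD _ _))// [leRHS]addrC lerD2r.
pose n := Num.truncn M.
have [_ _ [x]] := sP n; rewrite ltNge (le_trans (HM n x))//.
by rewrite ler_wpM2r// ltW// truncnS_gt.
Qed.

Lemma semigroup_bound T : exists2 M : R, 0 <= M
  & forall s x, 0 <= s -> s <= T -> `|S s x| <= M * `|x|.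
Proof.
have [delta [M [d0 M1 HM]]] := semigroup_loc_bound.
have M0 : 0 <= M by exact: le_trans M1.
case: SP => Sc S0 SD Scvg.
have H n s x : 0 <= s -> s <= n.+1%:R * delta -> `|S s x| <= M ^+ n.+1 * `|x|.
  elim: n s => [|n IH] s s0; first by rewrite mul1r expr1; exact: HM.
  have [sd|ds] := leP s delta.
    move=> _; rewrite (le_trans (HM _ _ s0 sd))// ler_wpM2r//.
    by rewrite exprS ler_peMr// exprn_ege1.
  rewrite -natr1 mulrDl mul1r -lerBlDr => sn.
  have sd0 : 0 <= s - delta by rewrite subr_ge0 ltW.
  rewrite -[s](subrK delta) addrC SD ?(ltW d0)// exprS -mulrA.
  rewrite (le_trans (HM _ _ (ltW d0) (lexx _)))// ler_wpM2l//.
  exact: IH.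
pose n := Num.truncn (T / delta).
exists (M ^+ n.+1) => [|s x s0 sT]; first exact: exprn_ge0.
apply: H => //; rewrite (le_trans sT)// -ler_pdivrMr// ltW//.
exact: truncnS_gt.
Qed.

(** An eigenvector of the generator spans a one-dimensional invariant space on
    which the semigroup is the exponential: the orbit multiplied by the
    inverse exponential has a vanishing right derivative. *)
Lemma semigroup_eigenvector (lam : R) v t : 0 <= lam -> 0 <= t ->
  generator S (v, - lam *: v) -> S t v = expR (- (lam * t)) *: v.
Proof.
move=> lam0 t0 /= gv; case: (SP) => Sc S0 SD Scvg.
pose q h := expR (lam * h) *: S h v - v.
have qo eps : 0 < eps -> \forall h \near 0^'+, `|q h| <= eps * h.
  move=> eps0.
  pose eps' := eps / 2 / expR lam.
  have eps'0 : 0 < eps' by rewrite !divr_gt0// expR_gt0.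
  pose c := eps / 2 / (lam ^+ 2 * `|v| + 1).
  have c1 : 0 < lam ^+ 2 * `|v| + 1 by rewrite ltr_wpDl// mulr_ge0// sqr_ge0.
  have c0 : 0 < c by rewrite !divr_gt0.
  near=> h.
  have h0 : 0 < h by near: h; exact: nbhs_right_gt.
  have h1 : h <= 1 by near: h; exact: nbhs_right_le.
  have hc : h <= c by near: h; exact: nbhs_right_le.
  have lh1 : lam * h <= 1.
    have : h <= (lam + 1)^-1.
      by near: h; apply: nbhs_right_le; rewrite invr_gt0 ltr_wpDl.
    move=> /(ler_wpM2l lam0) /le_trans; apply.
    by rewrite ler_pdivrMr ?ltr_wpDl// mul1r lerDl.
  have lh0 : 0 <= lam * h by rewrite mulr_ge0// ltW.
  have gh : `|S h v - v + (lam * h) *: v| <= eps' * h.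
    have : `|- lam *: v - h^-1 *: (S h v - v)| <= eps'.
      by near: h; move/cvgrPdist_le : gv; apply.
    rewrite -(ler_pM2r h0); apply: le_trans.
    have -> : S h v - v + (lam * h) *: v =
        (- h) *: (- lam *: v - h^-1 *: (S h v - v)).
      rewrite scalerBr !scalerA mulrNN mulNr divff ?gt_eqF// scaleN1r opprK.
      by rewrite addrC (mulrC h).
    by rewrite normrZ normrN gtr0_norm// mulrC.
  have -> : q h = expR (lam * h) *: (S h v - v + (lam * h) *: v) +
      (expR (lam * h) * (1 - lam * h) - 1) *: v.
    rewrite /q scalerDr scalerBr scalerA -!addrA; congr (_ + _).
    rewrite -scalerDl -scaleNr -scalerDl -scaleN1r; congr (_ *: _); ring.
  have E1 : expR (lam * h) * (1 - lam * h) <= 1.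
    rewrite -[leRHS](expRxMexpNx_1 (lam * h)) ler_wpM2l ?expR_ge0//.
    exact: expR_ge1Dx.
  have E2 : 1 - (lam * h) ^+ 2 <= expR (lam * h) * (1 - lam * h).
    have -> : 1 - (lam * h) ^+ 2 = (1 + lam * h) * (1 - lam * h) by ring.
    by rewrite ler_wpM2r ?subr_ge0// expR_ge1Dx.
  rewrite (le_trans (ler_normD _ _))// [eps in leRHS]splitr mulrDl lerD//.
    rewrite normrZ gtr0_norm ?expR_gt0//.
    apply: (@le_trans _ _ (expR lam * (eps' * h))).
      by apply: ler_pM; rewrite ?expR_ge0// ler_expR ler_piMr.
    by rewrite mulrA /eps' [expR _ * _]mulrC divfK// gt_eqF// expR_gt0.
  rewrite normrZ ler0_norm ?subr_le0//.
  apply: (@le_trans _ _ ((lam * h) ^+ 2 * `|v|)).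
    by rewrite ler_wpM2r//; lra.
  apply: (@le_trans _ _ ((lam ^+ 2 * `|v| + 1) * c * h)).
    have -> : (lam * h) ^+ 2 * `|v| = (lam ^+ 2 * `|v|) * h * h by ring.
    rewrite ler_wpM2r ?(ltW h0)//; apply: ler_pM => //.
    - by rewrite mulr_ge0// sqr_ge0.
    - by rewrite lerDl.
  by rewrite /c mulrC [X in h * X]mulrC divfK ?gt_eqF// mulrC.
have [M M0 HM] := semigroup_bound t.
pose u s := `|expR (lam * s) *: S s v - v|.
have step s h : 0 <= s -> s <= t -> 0 <= h ->
    u (s + h) <= u s + expR (lam * t) * (M * `|q h|).
  move=> s0 st h0.
  have -> : u (s + h) = `|expR (lam * s) *: S s v - v + expR (lam * s) *: S s (q h)|.
    congr `|_|; rewrite /q linearB linearZ/= SD// scalerBr scalerA -expRD -mulrDr.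
    by rewrite [RHS]addrC addrA subrK.
  rewrite (le_trans (ler_normD _ _))// lerD2l normrZ gtr0_norm ?expR_gt0//.
  by apply: ler_pM; rewrite ?expR_ge0// ?ler_expR ?ler_wpM2l// HM.
have C0 : 0 < expR (lam * t) * M + 1 by rewrite ltr_wpDl// mulr_ge0// expR_ge0.
have stepe eps : 0 < eps -> \forall h \near 0^'+,
    forall s, 0 <= s -> s <= t -> u (s + h) <= u s + eps * h.
  move=> eps0; have e0 : 0 < eps / (expR (lam * t) * M + 1) by rewrite divr_gt0.
  near=> h => s s0 st; have h0 : 0 < h by near: h; exact: nbhs_right_gt.
  rewrite (le_trans (step s h s0 st (ltW h0)))// lerD2l mulrA.
  have qh : `|q h| <= eps / (expR (lam * t) * M + 1) * h.
    by near: h; exact: qo.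
  apply: (@le_trans _ _ ((expR (lam * t) * M + 1) * `|q h|)).
    by rewrite ler_wpM2r// lerDl.
  apply: (@le_trans _ _ ((expR (lam * t) * M + 1) * (eps / (expR (lam * t) * M + 1) * h))).
    by rewrite ler_pM2l.
  by rewrite mulrA mulrCA divff ?gt_eqF// mulr1.
suff : u t <= u 0.
  rewrite /u mulr0 expR0 scale1r S0 subrr normr0 normr_le0 subr_eq0 => /eqP E.
  by rewrite -[v in RHS]E scalerA -expRD addNr expR0 scale1r.
apply: le_of_dini => //.
  move=> s eps s0 /ltW st eps0; near=> h; move: s s0 st.
  by near: h; exact: stepe.
move=> s eps delta s0 st eps0 d0.
have : \forall h \near 0^'+, [/\ 0 < h, h < delta, h <= s, h <= 1 &
    forall s, 0 <= s -> s <= t -> u (s + h) <= u s + eps * h].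
  near=> h; split.
  - near: h; exact: nbhs_right_gt.
  - near: h; exact: nbhs_right_lt.
  - near: h; exact: nbhs_right_le.
  - near: h; exact: nbhs_right_le.
  - near: h; exact: stepe.
move=> /filter_ex[h [h0 hd hs h1 Hh]]; exists (s - h); split.
- by rewrite subr_ge0.
- by rewrite ltrD2l ltrN2.
- by rewrite ltrBlDr ltrDl.
- have := Hh (s - h); rewrite subrK subr_ge0 => /(_ hs) H.
  rewrite (le_trans (H _)) ?lerD2l//; last by rewrite ler_piMr// ltW.
  by rewrite (le_trans _ st)// gerBl ltW.
Unshelve. all: by end_near. Qed.

End Semigroup.

Section DissipativeSemigroup.
Context {R : realType} {H : completeNormedModType R}.
Variables (ip : H -> H -> R) (DA : set H) (A : H -> H) (S : R -> {linear H -> H}).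
Variables (e : nat -> H) (lam : nat -> R) (omega : R).
Hypothesis ipP : inner_product_of ip.
Hypothesis linP : linear_part ip DA A S e lam omega.

Lemma eigenvalue_ge k : omega <= lam k.
Proof.
case: linP => _ _ [eP /(_ k)[De Ae _] _ _] _ /(_ _ De).
rewrite Ae (ipZl ipP) (ipxx ipP).
by rewrite (basis_norm1 ipP eP) expr1n !mulr1 lerN2.
Qed.

Lemma semigroup_coord k t x : 0 <= t ->
  ip (S t x) (e k) = expR (- (lam k * t)) * ip x (e k).
Proof.
case: linP => _ [SP gS] [eP leP _ _] _ _ t0.
have St := let: And4 Sc _ _ _ := SP in Sc t t0.
have Sek l : S t (e l) = expR (- (lam l * t)) *: e l.
  have [De Ae l0] := leP l.
  apply: semigroup_eigenvector => //; first exact: ltW.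
  by rewrite gS; split.
have xc := @coord_sum_cvg R H ip e eP x.
have h1 : ip (S t (coord_sum ip e n x)) (e k) @[n --> \oo] --> ip (S t x) (e k).
  apply: cvg_ipl => //; apply: (@continuous_cvg _ _ _ \oo _ _ (S t)) => //.
  exact: St.
apply/esym; apply: (cvg_unique _ _ h1) => //.
apply: cvg_near_cst; exists k.+1 => // n /= kn.
rewrite /coord_sum linear_sum/=; under eq_bigr do rewrite linearZ/= Sek scalerA.
rewrite (ip_span ipP eP n (fun l => ip x (e l) * expR (- (lam l * t)))).
by rewrite kn mulrC.
Qed.

Lemma semigroup_contraction t x : 0 <= t -> `|S t x| <= expR (- (omega * t)) * `|x|.
Proof.
move=> t0; case: (linP) => _ _ [eP _ _ _] _ _.
apply: (norm_le_coord ipP eP); first exact: expR_ge0.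
move=> k; rewrite semigroup_coord// normrM gtr0_norm ?expR_gt0// ler_wpM2r//.
by rewrite ler_expR lerN2 ler_wpM2r// eigenvalue_ge.
Qed.

Lemma semigroup_norm_le t x : 0 <= t -> `|S t x| <= `|x|.
Proof.
move=> t0; rewrite (le_trans (semigroup_contraction x t0))// ler_piMl//.
rewrite expR_le1 oppr_le0 mulr_ge0//; case: linP => _ _ _ + _; exact: ltW.
Qed.

End DissipativeSemigroup.

(** * Uniform bounds for the projections *)

Section Projections.
Context {R : realType} {H B : completeNormedModType R}.
Variables (ip : H -> H -> R) (j : {linear B -> H}).
Hypothesis ipP : inner_product_of ip.

(** For an orthonormal list b this says that x lies in its span.
    Orthonormality is replaced by the expansion of the members of b, which is
    all that the computations use and is easier to carry through an induction. *)
Definition expands (b : seq B) x := x = \sum_(y <- b) ip (j x) (j y) *: y.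

Lemma expands_linear b a x y : expands b x -> expands b y ->
  expands b (a *: x + y).
Proof.
move=> bx by_; rewrite /expands {1}bx {1}by_ scaler_sumr -big_split/=.
apply: eq_bigr => z _.
by rewrite linearP/= (ip_linl ipP) scalerDl scalerA.
Qed.

Lemma expands_ip b x h : expands b x ->
  ip (j x) h = \sum_(y <- b) ip (j x) (j y) * ip (j y) h.
Proof.
move=> bx; rewrite {1}bx linear_sum (ip_suml ipP); apply: eq_bigr => y _.
by rewrite linearZ/= (ipZl ipP).
Qed.

(** Gram-Schmidt for the inner product induced on B: a list whose own members
    satisfy the expansion formula is orthonormal as far as that formula goes,
    and it can be extended to reach one more vector. *)
Lemma exists_expansion (s : seq B) : injective j ->
  exists b : seq B, {in b, forall y, expands b y} /\ {in s, forall x, expands b x}.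
Proof.
move=> jinj; elim: s => [|v s [b [bb sb]]]; first by exists [::]; split.
pose p := \sum_(y <- b) ip (j v) (j y) *: y.
have [vp|vNp] := eqVneq v p.
  by exists b; split => // x; rewrite inE => /predU1P[->|/sb].
pose u := v - p.
have ju0 : `|j u| != 0.
  rewrite normr_eq0; apply: contra_neq vNp => E.
  by apply/eqP; rewrite -subr_eq0; apply/eqP/jinj; rewrite linear0.
have uy : {in b, forall y, ip (j u) (j y) = 0}.
  move=> y yb; rewrite /u linearB (ipBl ipP) linear_sum (ip_suml ipP).
  rewrite (ipC ipP) (expands_ip _ (bb y yb)); apply/eqP; rewrite subr_eq0.
  apply/eqP/eq_bigr => z _; rewrite linearZ/= (ipZl ipP) mulrC.
  by rewrite (ipC ipP (j z)) (ipC ipP (j z)).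
have ux x : expands b x -> ip (j x) (j u) = 0.
  move=> bx; rewrite (expands_ip _ bx) big_seq big1// => y yb.
  by rewrite (ipC ipP (j y)) uy// mulr0.
have bp : expands b p.
  rewrite /expands {1}/p; apply: eq_big_seq => y yb; congr (_ *: _).
  rewrite /p linear_sum (ip_suml ipP) (ipC ipP) (expands_ip _ (bb y yb)).
  apply: eq_bigr => z _; rewrite linearZ/= (ipZl ipP) mulrC.
  by rewrite (ipC ipP (j z)) (ipC ipP (j z)).
pose u' := `|j u|^-1 *: u.
have ju' : j u' = `|j u|^-1 *: j u by rewrite linearZ.
have bx' x : expands b x -> expands (u' :: b) x.
  move=> bx; rewrite /expands big_cons ju' (ipZr ipP) ux//.
  by rewrite mulr0 scale0r add0r.
have bu' : expands (u' :: b) u'.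
  have u1 : ip (j u') (j u') = 1.
    by rewrite ju' (ipZr ipP) (ipZl ipP) (ipxx ipP); field.
  rewrite /expands big_cons u1 scale1r big_seq big1 ?addr0// => y yb.
  by rewrite ju' (ipZl ipP) uy// mulr0 scale0r.
exists (u' :: b); split => x; rewrite inE => /predU1P[->//|].
- by move=> /bb; exact: bx'.
- have -> : v = `|j u| *: u' + p by rewrite scalerA divff// scale1r subrK.
  by apply: expands_linear => //; exact: bx'.
- by move=> /sb; exact: bx'.
Qed.

Lemma finite_dim_expansion E : injective j -> finite_dim_subspace E ->
  exists b, forall x, E x -> expands b x.
Proof.
move=> jinj [n [v ->]].
have [b [_ vb]] := exists_expansion (codom v) jinj.
exists b => _ [c ->]; apply: (big_ind (expands b)).
- by rewrite /expands linear0 big1// => y _; rewrite (ip0l ipP) scale0r.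
- by move=> x y bx by_; rewrite -[x]scale1r; exact: expands_linear.
- move=> i _; rewrite -[_ *: _]addr0; apply: expands_linear.
    by apply: vb; exact: codom_f.
  by rewrite /expands linear0 big1// => y _; rewrite (ip0l ipP) scale0r.
Qed.

Variables (Bn : nat -> set B) (Pi : nat -> {linear H -> B}).
Hypothesis jP : banach_embedding j.
Hypothesis PiP : projections ip j Bn Pi.

Lemma embedding_bound : exists2 C : R, 0 <= C & forall x, `|j x| <= C * `|x|.
Proof. by case: jP => _ jc _ _ _; exact: linear_continuous_bound. Qed.

(** The range of Pi n is finite-dimensional, so its elements have expansions;
    symmetry then writes Pi n as a finite sum of continuous functionals of h. *)
Lemma projection_bound n : exists2 K : R, 0 <= K & forall h, `|Pi n h| <= K * `|h|.
Proof.
case: jP => _ _ jinj _ _; case: PiP => fd rg sym _.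
have [b bE] := finite_dim_expansion jinj (fd n).
exists (\sum_(y <- b) `|j (Pi n (j y))| * `|y|) => [|h].
  by apply: sumr_ge0 => y _; rewrite mulr_ge0.
have -> : Pi n h = \sum_(y <- b) ip h (j (Pi n (j y))) *: y.
  rewrite {1}(bE (Pi n h)); last by rewrite -rg; exists h.
  by apply: eq_bigr => y _; rewrite sym.
rewrite (le_trans (ler_norm_sum _ _ _))// mulr_suml; apply: ler_sum => y _.
rewrite normrZ mulrAC ler_wpM2r// mulrC.
by rewrite (le_trans (cauchy_schwarz ipP _ _)).
Qed.

Lemma projection_continuous n : continuous (Pi n).
Proof. by have [K _] := projection_bound n; exact: linear_bound_continuous. Qed.

(** The uniform boundedness principle on B, where these operators converge
    pointwise. *)
Lemma projection_bound_B : exists2 M : R, 0 < M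
  & forall n x, `|Pi n (j x)| <= M * `|x|.
Proof.
case: jP => _ jc _ _ _; case: PiP => _ _ _ Picvg.
have [||M M0 HM] := @uniform_boundedness R B B (fun n => [the {linear B -> B} of Pi n \o j]) _ _.
- move=> n x /=; apply: continuous_comp; first exact: jc.
  exact: projection_continuous.
- move=> x; have /cvgP/cvg_seq_bounded[M [Mr HM]] := Picvg x.
  exists (M + 1) => n; apply: (HM (M + 1)) => //; by rewrite ltrDl.
exists (M + 1) => [|n x]; first by rewrite ltr_wpDl.
by rewrite (le_trans (HM n x))// ler_wpM2r// lerDl.
Qed.

(** A symmetric operator on H which is bounded for the norm of the smaller
    space B is bounded on H with the same constant: by symmetry the norms of
    the iterates of a vector are log-convex, so that their growth rate,
    bounded by the norm on B, dominates the first ratio. *)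
Lemma projection_bound_H : exists2 M : R, 0 < M
  & forall n h, `|j (Pi n h)| <= M * `|h|.
Proof.
have [M M0 HM] := projection_bound_B; exists M => // n.
have [C C0 HC] := embedding_bound; have [K K0 HK] := projection_bound n.
case: (jP) => _ _ _ jd _; case: (PiP) => _ _ sym _.
have onB x : `|j (Pi n (j x))| <= M * `|j x|.
  pose a k := `|j (iter k (Pi n \o j) x)|.
  have aconv k : a k.+1 ^+ 2 <= a k * a k.+2.
    rewrite /a -(ipxx ipP) [in X in ip X _]iterS /= sym.
    by rewrite (le_trans (ler_norm _))// (cauchy_schwarz ipP).
  have aC k : a k <= C * M ^+ k * `|x|.
    rewrite /a (le_trans (HC _))// -mulrA ler_wpM2l//.
    elim: k => [|k IH]; first by rewrite mul1r.
    by rewrite iterS (le_trans (HM _ _))// exprS -mulrA ler_pM2l.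
  rewrite leNgt; apply/negP => a1; rewrite -/(a 0%N) -/(a 1%N) in a1.
  have a1p : 0 < a 1%N by apply: le_lt_trans a1; rewrite mulr_ge0 ?normr_ge0// ltW.
  have a0p : 0 < a 0%N.
    rewrite lt0r normr_ge0 andbT; apply: contraTneq a1p => a00.
    have jx0 : j x = 0 by apply/normr0_eq0.
    by rewrite /a /= jx0 !linear0 normr0 ltxx.
    (* The ratios of consecutive norms increase with k, so they all are at
     least the first one. *)
have aratio k : 0 < a k /\ a 1%N * a k <= a k.+1 * a 0%N.
    elim: k => [|k [ak IH]]; first by split.
    have akp : 0 < a k.+1.
      by rewrite -(pmulr_lgt0 _ a0p); apply: lt_le_trans IH; rewrite mulr_gt0.
    split => //; rewrite -(ler_pM2l ak).
    apply: (@le_trans _ _ (a k.+1 * (a k.+1 * a 0%N))).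
      by rewrite mulrCA mulrA mulrC ler_pM2l.
    by rewrite mulrA -expr2 mulrA ler_pM2r.
  pose q := a 1%N / a 0%N / M.
  have q1 : 1 < q by rewrite ltr_pdivlMr// mul1r ltr_pdivlMr.
  have aq k : q ^+ k * M ^+ k * a 0%N <= a k.
    elim: k => [|k IH]; first by rewrite !mul1r.
    have [ak ar] := aratio k.
    rewrite -(ler_pM2r a0p); apply: le_trans ar.
    have -> : q ^+ k.+1 * M ^+ k.+1 * a 0%N * a 0%N = a 1%N * (q ^+ k * M ^+ k * a 0%N).
      rewrite !exprS {1}/q; field; by rewrite !gt_eqF.
    by rewrite ler_pM2l.
  have qb k : q ^+ k <= C * `|x| / a 0%N.
    rewrite ler_pdivlMr// -(ler_pM2r (exprn_gt0 k M0)).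
    by rewrite mulrAC (le_trans (aq k))// (le_trans (aC k))// mulrAC.
  have qB k : 1 + k%:R * (q - 1) <= q ^+ k.
    elim: k => [|k IH]; first by rewrite mul0r addr0.
    rewrite exprS; apply: (@le_trans _ _ (q * (1 + k%:R * (q - 1)))).
      rewrite -natr1 -subr_ge0.
      have -> : q * (1 + k%:R * (q - 1)) - (1 + (k%:R + 1) * (q - 1)) = k%:R * (q - 1) ^+ 2 by ring.
      by rewrite mulr_ge0// sqr_ge0.
    by rewrite ler_pM2l// (lt_trans _ q1).
  pose N := (Num.truncn (C * `|x| / a 0%N / (q - 1))).+1.
  have := le_trans (qB N) (qb N); rewrite leNgt => /negP; apply.
  rewrite ltr_wpDl// -ltr_pdivrMr ?subr_gt0//; exact: truncnS_gt.
move=> h; apply/ler_addgt0Pr => eps eps0.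
pose c := M + C * K + 1.
have c0 : 0 < c by rewrite ltr_wpDl// addr_ge0 ?mulr_ge0// ltW.
have ec : 0 < eps / c by rewrite divr_gt0.
have [z [+ [y _ yz]]] := jd (ball h (eps / c)) (ex_intro _ h (ballxx h ec)) (ball_open _ _).
rewrite -ball_normE /= -{z}yz => hy.
have -> : j (Pi n h) = j (Pi n (j y)) + j (Pi n (h - j y)) by rewrite -!linearD addrC subrK.
rewrite (le_trans (ler_normD _ _))//.
have h1 : `|j y| <= `|h| + eps / c.
  have -> : j y = h - (h - j y) by rewrite opprB addrC subrK.
  by rewrite (le_trans (ler_normB _ _))// lerD2l ltW.
have h2 : `|j (Pi n (h - j y))| <= C * K * (eps / c).
  rewrite (le_trans (HC _))// -mulrA ler_wpM2l// (le_trans (HK _))// ler_wpM2l//.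
  exact: ltW.
apply: (@le_trans _ _ (M * (`|h| + eps / c) + C * K * (eps / c))).
  rewrite lerD// (le_trans (onB y))// ler_pM2l//.
rewrite mulrDr -addrA lerD2l -mulrDl.
apply: (@le_trans _ _ (c * (eps / c))).
  by rewrite ler_wpM2r ?(ltW ec)// lerDl.
by rewrite mulrC divfK// gt_eqF.
Qed.

Lemma projection_cvg_H h : j (Pi n h) @[n --> \oo] --> h.
Proof.
have [M M0 HM] := projection_bound_H.
case: (jP) => _ jc _ jd _; case: (PiP) => _ _ _ Picvg.
apply/cvgrPdist_le => eps eps0; pose c := M + 2.
have c0 : 0 < c by rewrite ltr_wpDl// ltW.
have ec : 0 < eps / c by rewrite divr_gt0.
have [z [+ [y _ yz]]] := jd (ball h (eps / c)) (ex_intro _ h (ballxx h ec)) (ball_open _ _).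
rewrite -ball_normE /= -{z}yz => hy.
have jPy : j (Pi n (j y)) @[n --> \oo] --> j y.
  by apply: (@continuous_cvg _ _ _ \oo _ _ j) => //; exact: jc.
near=> n.
have -> : h - j (Pi n h) = (h - j y) + (j y - j (Pi n (j y))) - j (Pi n (h - j y)).
  have -> : j (Pi n (h - j y)) = j (Pi n h) - j (Pi n (j y)) by rewrite !linearB.
  by rewrite opprB !addrA !subrK.
have h1 : `|j (Pi n (h - j y))| <= M * (eps / c).
  by rewrite (le_trans (HM _ _))// ler_pM2l// ltW.
have h2 : `|j y - j (Pi n (j y))| <= eps / c.
  by near: n; move/cvgrPdist_le : jPy; apply.
have -> : eps = eps / c + eps / c + M * (eps / c).
  by rewrite -[X in X + X]mul1r -!mulrDl addrC /c mulrC divfK ?gt_eqF// -/c.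
by rewrite (le_trans (ler_normB _ _))// lerD// (le_trans (ler_normD _ _))// lerD// ltW.
Unshelve. all: by end_near. Qed.

End Projections.

(** * The diagonal operator applied to the noise *)

Section DiagonalOperator.
Context {R : realType} {H : completeNormedModType R}.
Variables (ip : H -> H -> R) (e : nat -> H) (b rho : nat -> R).
Hypotheses (ipP : inner_product_of ip) (eP : orthonormal_basis ip e).

Let part (x : nat -> R) n := \sum_(k < n) (b k * x k) *: e k.
Let sqr (x : nat -> R) n := \sum_(k < n) (b k * x k) ^+ 2.

Lemma diag_opE x : diag_op e b x = lim (part x n @[n --> \oo]).
Proof.
rewrite /diag_op; congr (lim (_ @ \oo)); apply/funext => n.
by rewrite /series/= big_mkord.
Qed.

Lemma diag_part_dist x m n : (m <= n)%N ->
  `|part x n - part x m| ^+ 2 = sqr x n - sqr x m.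
Proof.
move=> mn; rewrite -(ipxx ipP) (ipBl ipP) !(ipBr ipP) !(ipxx ipP).
have nE k : `|part x k| ^+ 2 = sqr x k by exact: (norm_span ipP eP k (fun k => b k * x k)).
have -> : ip (part x n) (part x m) = sqr x m.
  rewrite {2}/part (ip_sumr ipP); apply: eq_bigr => k _.
  rewrite (ipZr ipP) (ip_span ipP eP n (fun k => b k * x k)).
  by rewrite (leq_trans (ltn_ord k) mn) expr2.
rewrite (ipC ipP) [ip _ _](_ : _ = sqr x m) ?nE; last first.
  rewrite {2}/part (ip_sumr ipP); apply: eq_bigr => k _.
  rewrite (ipZr ipP) (ip_span ipP eP n (fun k => b k * x k)).
  by rewrite (leq_trans (ltn_ord k) mn) expr2.
by rewrite subrr subr0.
Qed.

Lemma diag_part_cvgP x :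
  cvg (part x n @[n --> \oo]) <-> exists M : R, forall n, sqr x n <= M.
Proof.
have nE k : `|part x k| ^+ 2 = sqr x k by exact: (norm_span ipP eP k (fun k => b k * x k)).
have sqr_mono : {homo sqr x : m n / (m <= n)%N >-> m <= n}.
  by move=> m n mn; rewrite -subr_ge0 -diag_part_dist// sqr_ge0.
split => [/cvg_seq_bounded[M [Mr HM]]|[M HM]].
  exists ((`|M| + 1) ^+ 2) => n; rewrite -nE.
  rewrite ler_pXn2r ?nnegrE// ?addr_ge0//.
  by apply: (HM (`|M| + 1)) => //; rewrite (le_lt_trans (ler_norm M))// ltrDl.
have /cvgrPdist_lt sc : sqr x n @[n --> \oo] --> lim (sqr x n @[n --> \oo]).
  by apply: nondecreasing_is_cvgn => //; exists M => _ [n _ <-].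
apply: cauchy_cvg; apply: cauchy_exP => eps eps0.
have e2 : 0 < eps ^+ 2 / 2 by rewrite divr_gt0// exprn_gt0.
have [N _ HN] := sc _ e2; exists (part x N); exists N => // n /= Nn.
rewrite -ball_normE /= distrC -(@ltr_pXn2r _ 2)// ?nnegrE ?(ltW eps0)//.
rewrite diag_part_dist//.
have := HN n Nn; have := HN N (leqnn _) => /=.
set l := lim _; rewrite !ltr_norml => /andP[h1 h2] /andP[h3 h4]; lra.
Qed.

(** Where the series diverges its limit is the default point of H, hence the
    case distinction. Convergence is decided by a bound on the partial sums of
    squares, so this formula exhibits the coordinates as measurable functions
    of the sequence. *)
Lemma diag_op_coord x k :
  ip (diag_op e b x) (e k) =
  if `[< exists M : R, forall n, sqr x n <= M >] then b k * x k
  else ip point (e k).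
Proof.
rewrite diag_opE; case: asboolP => [/diag_part_cvgP xc|nxc]; last first.
  by rewrite dvgP// => /diag_part_cvgP.
have h : ip (part x n) (e k) @[n --> \oo] --> ip (lim (part x n @[n --> \oo])) (e k).
  exact: cvg_ipl.
apply/esym; apply: (cvg_unique _ _ h) => //.
apply: cvg_near_cst; exists k.+1 => // n /= kn.
by rewrite (ip_span ipP eP n (fun k => b k * x k)) kn.
Qed.

Lemma measurable_diag_op {d : measure_display} {Om : measurableType d}
    (x : Om -> nat -> R) : (forall k, measurable_fun setT (x ^~ k)) ->
  measurable_fun setT ((fun w => diag_op e b (x w)) : Om -> borel H).
Proof.
move=> mx; apply: (weakly_measurable ipP eP) => k.
under eq_fun do rewrite diag_op_coord.
apply: measurable_fun_ifT => //; last by apply: measurable_funM.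
apply: (@measurable_fun_bool _ _ _ _ true).
rewrite setTI (_ : _ @^-1` _ =
    \bigcup_m \bigcap_n [set w | sqr (x w) n <= m%:R]).
  apply: bigcupT_measurable => m; apply: bigcapT_measurable => n.
  rewrite -[X in measurable X]setTI; apply: measurable_fun_le => //.
  apply: measurable_sum => i; apply: measurable_funX; exact: measurable_funM.
apply/seteqP; split => w /=.
  move=> /asboolP[M HM]; exists (Num.truncn `|M|).+1 => // n _ /=.
  rewrite (le_trans (HM n))// (le_trans (ler_norm M))// ltW//.
  exact: truncnS_gt.
by move=> [m _ H']; apply/asboolP; exists m%:R => n; exact: H'.
Qed.

Hypotheses (rho0 : forall k, 0 < rho k) (brho : bounded_diag rho b).

Lemma diag_op_wl2 : exists2 C : R, 0 <= C & forall x, (wl2 rho x < +oo)%E ->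
  cvg (part x n @[n --> \oo]) /\ `|diag_op e b x| ^+ 2 <= C * fine (wl2 rho x).
Proof.
have [C HC] := brho; exists (C ^+ 2); first exact: sqr_ge0.
have C0 : 0 <= C by apply: le_trans (HC 0%N); rewrite divr_ge0// ltW.
move=> x xoo.
have x0 : (0 <= wl2 rho x)%E.
  by apply: nneseries_ge0 => k _ _; rewrite lee_fin mulr_ge0// sqr_ge0.
have xfin : wl2 rho x \is a fin_num by rewrite ge0_fin_numE.
have bd n : sqr x n <= C ^+ 2 * fine (wl2 rho x).
  apply: (@le_trans _ _ (C ^+ 2 * \sum_(k < n) (x k ^+ 2 * rho k ^+ 2))).
    rewrite mulr_sumr; apply: ler_sum => k _.
    rewrite [x k ^+ 2 * _]mulrC mulrA -exprMn [(b k * x k) ^+ 2]exprMn.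
    rewrite ler_wpM2r ?sqr_ge0// -[b k ^+ 2]real_normK ?num_real//.
    have := HC k; rewrite ler_pdivrMr// => h.
    by rewrite ler_pXn2r// nnegrE mulr_ge0// ltW.
  rewrite ler_wpM2l ?sqr_ge0// -lee_fin fineK// -sumEFin.
  rewrite -(big_mkord xpredT (fun k => ((x k ^+ 2 * rho k ^+ 2)%:E))).
  by apply: nneseries_lim_ge => k _ _; rewrite lee_fin mulr_ge0// sqr_ge0.
have xc : cvg (part x n @[n --> \oo]) by apply/diag_part_cvgP; eexists; exact: bd.
split => //; rewrite diag_opE.
have h : `|part x n| ^+ 2 @[n --> \oo] --> `|lim (part x n @[n --> \oo])| ^+ 2.
  rewrite expr2; under eq_fun do rewrite expr2.
  by apply: cvgM; exact: cvg_norm.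
apply: (ler_cvg_to h (cvg_cst _)); apply: nearW => n.
have -> : `|part x n| ^+ 2 = sqr x n by exact: (norm_span ipP eP n (fun k => b k * x k)).
exact: bd.
Qed.

Lemma diag_opB x y : (wl2 rho x < +oo)%E -> (wl2 rho y < +oo)%E ->
  diag_op e b (x \- y) = diag_op e b x - diag_op e b y.
Proof.
move=> xoo yoo; have [C _ HC] := diag_op_wl2.
have [xc _] := HC x xoo; have [yc _] := HC y yoo.
rewrite !diag_opE; apply: cvg_lim => //.
rewrite (_ : part (x \- y) = part x \- part y); first exact: cvgB.
apply/funext => n /=; rewrite /part -sumrB; apply: eq_bigr => k _.
by rewrite mulrBr scalerBl.
Qed.

Lemma diag_op_cadlag_bound (u : R -> nat -> R) t : cadlag_wl2 rho u ->
  exists A : R, forall s, 0 <= s -> s <= t -> `|diag_op e b (u s)| <= A.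
Proof.
move=> [uoo ur ul]; have [C C0 HC] := diag_op_wl2.
have close l (Q : set_system R) : Filter Q -> (wl2 rho l < +oo)%E ->
    (\forall s \near Q, 0 <= s) -> wl2 rho (u s \- l) @[s --> Q] --> 0%E ->
    exists M : R, \forall s \near Q, `|diag_op e b (u s)| <= M.
  move=> FQ loo Q0 /fine_cvgP[ffin /cvgrPdist_lt/(_ _ ltr01) f1].
  exists (`|diag_op e b l| + (C + 1)); apply: filterS3 Q0 ffin f1 => s s0 fs.
  rewrite /= sub0r normrN => /ltW/(le_trans (ler_norm _)) {}f1.
  have sloo : (wl2 rho (u s \- l)%R < +oo)%E by rewrite ltey_eq fs.
  have -> : diag_op e b (u s) = diag_op e b l + diag_op e b (u s \- l).
    by rewrite diag_opB ?uoo// addrC subrK.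
  rewrite (le_trans (ler_normD _ _))// lerD2l.
  rewrite -(@ler_pXn2r _ 2)// ?nnegrE ?addr_ge0// (le_trans (HC _ sloo).2)//.
  apply: (@le_trans _ _ C); first by rewrite ler_piMr.
  nra.
apply: (@bounded_of_one_sided R (fun s => `|diag_op e b (u s)|)) => s s0.
  apply: close (ur s s0); first exact: uoo.
  by near=> v; rewrite (le_trans s0)// ltW//; near: v; exact: nbhs_right_gt.
have [l loo lP] := ul s s0; apply: close lP => //.
by near=> v; apply/ltW; near: v; exact: nbhs_left_gt.
Unshelve. all: by end_near. Qed.

End DiagonalOperator.

(** * Increments of the stochastic convolutions *)

Section SmallExceptionalSets.
Context {R : realType} {d : measure_display} {Om : measurableType d}.
Variable P : probability Om R.

(** A point where the conclusion fails for some delta lies in all the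
    exceptional sets of small parameter, whose probabilities tend to 0. *)
Lemma ae_exists_small (Q : R -> Om -> Prop) (K : R) :
  (forall eps : R, 0 < eps -> exists E, [/\ measurable E, (P E <= (K * eps)%:E)%E
     & forall w, ~ E w -> Q eps w]) ->
  {ae P, forall w, forall delta : R, 0 < delta ->
     exists eps : R, [/\ 0 < eps, eps < delta & Q eps w]}.
Proof.
move=> H; have n0 n : 0 < n.+1%:R^-1 :> R by [].
have /choice[E EP] : forall n : nat, exists E, [/\ measurable E,
    (P E <= (K * n.+1%:R^-1)%:E)%E & forall w, ~ E w -> Q n.+1%:R^-1 w].
  by move=> n; exact: H.
have /ae_foralln : forall N : nat, {ae P, forall w, exists n, ~ E (N + n)%N w}.
  move=> N; pose F := \bigcap_n E (N + n)%N.
  have mF : measurable F by apply: bigcapT_measurable => n; case: (EP (N + n)%N).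
  exists F; split => //; last first.
    by move=> w /= /forallNP Hw n _; exact: contrapT.
  have Ffin : P F \is a fin_num by exact: fin_num_measure.
  have FK n : fine (P F) <= K * (N + n).+1%:R^-1.
    rewrite -lee_fin fineK//; have [mE PE _] := EP (N + n)%N.
    apply: le_trans PE; apply: le_measure; rewrite ?inE//.
    by move=> w; apply.
  apply/eqP; rewrite -(fineK Ffin) eqe; apply: contraT => F0.
  have Fp : 0 < fine (P F) by rewrite lt0r F0 fine_ge0.
  pose n := Num.truncn (K / fine (P F)).
  have := FK n; rewrite ler_pdivlMr// leNgt => /negP FKn; exfalso; apply: FKn.
  rewrite mulrC -ltr_pdivrMr//; apply: (lt_le_trans (truncnS_gt _)).
  by rewrite ler_nat ltnS leq_addl.
apply: filterS => w Hw delta delta0.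
have [N Nd] := exists_invS_lt delta0; have [n nE] := Hw N.
exists (N + n).+1%:R^-1; split => //.
  by apply: le_lt_trans Nd; rewrite lef_pV2 ?posrE// ler_nat ltnS leq_addr.
by have [_ _] := EP (N + n)%N; apply.
Qed.

End SmallExceptionalSets.

Section StochasticIntegral.
Context {R : realType} {d : measure_display} {Om : measurableType d}.
Variable P : probability Om R.
Context {H : completeNormedModType R}.
Variables (ip : H -> H -> R) (DA : set H) (A : H -> H) (S : R -> {linear H -> H}).
Variables (e : nat -> H) (lam : nat -> R) (omega : R) (b : nat -> R).
Hypothesis ipP : inner_product_of ip.
Hypothesis linP : linear_part ip DA A S e lam omega.

Let eP : orthonormal_basis ip e. Proof. by case: linP => _ _ []. Qed.
Let Sc t : 0 <= t -> continuous (S t).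
Proof. by case: linP => _ [[+ _ _ _] _] _ _ _; apply. Qed.

(** The operator G is the identity for the stochastic convolution and a
    projection for its approximations. *)
Definition semigroup_integrand (G : H -> H) (t : R) : R -> (nat -> R) -> H :=
  fun u x => S (t - u) (G (diag_op e b x)).

Lemma measurable_riemann_sum (G : H -> H) t (L : R -> Om -> nat -> R) a s :
  continuous G -> path <%R a s -> last a s <= t ->
  (forall u k, a <= u -> measurable_fun setT (fun w => L u w k)) ->
  measurable_fun setT ((fun w => riemann_sum (semigroup_integrand G t) L a s w) : Om -> borel H).
Proof.
move=> Gc ps ls mL; apply: (weakly_measurable ipP eP) => k.
have -> : (fun w => ip (riemann_sum (semigroup_integrand G t) L a s w) (e k)) =
    fun w => partition_sum (fun x y =>
      ip (semigroup_integrand G t x (L y w \- L x w)) (e k)) a s.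
  by apply/funext => w; rewrite /riemann_sum (ip_suml ipP).
elim: s a ps ls mL => [|c s IH] a /=.
  move=> _ _ _; under eq_fun do rewrite /partition_sum big_ord0.
  exact: measurable_cst.
move=> /andP[ac ps] ls mL; under eq_fun do rewrite partition_sum_cons.
have cl := path_le_last ps.
apply: measurable_funD; last first.
  by apply: IH => // u l cu; apply: mL; apply: le_trans cu; exact: ltW.
have ta : 0 <= t - a by rewrite subr_ge0 (le_trans (ltW ac))// (le_trans cl).
apply: (continuous_measurable_comp (f := fun h => ip (S (t - a) (G h)) (e k))).
  move=> h; apply: (cvg_ipl ipP).
  by apply: continuous_comp; [exact: Gc|exact: Sc].
apply: (measurable_diag_op b ipP eP (x := fun w => L c w \- L a w)) => l; apply: measurable_funB; apply: mL => //.
exact: ltW.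
Qed.

(** In the eigenbasis the semigroup is a scalar weight, and the symmetric
    operator G can be moved to the basis vector. *)
Lemma riemann_sum_coord (G : H -> H) k t (L : R -> Om -> nat -> R) a s w :
  (forall x y, ip (G x) y = ip x (G y)) -> path <%R a s -> last a s <= t ->
  expR (lam k * t) * ip (riemann_sum (semigroup_integrand G t) L a s w) (e k) =
  partition_sum (fun x y => expR (lam k * x) *
    ip (diag_op e b (L y w \- L x w)) (G (e k))) a s.
Proof.
move=> Gs ps ls.
have -> : ip (riemann_sum (semigroup_integrand G t) L a s w) (e k) =
    partition_sum (fun x y => ip (semigroup_integrand G t x (L y w \- L x w)) (e k)) a s.
  by rewrite /riemann_sum (ip_suml ipP).
elim: s a ps ls => [|c s IH] a /=; first by rewrite /partition_sum !big_ord0 mulr0.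
move=> /andP[ac ps] ls; rewrite !partition_sum_cons mulrDr IH//; congr (_ + _).
have cl := path_le_last ps.
have ta : 0 <= t - a by rewrite subr_ge0 (le_trans (ltW ac))// (le_trans cl).
rewrite /semigroup_integrand (semigroup_coord ipP linP)// mulrA -expRD Gs.
congr (expR _ * _); ring.
Qed.

Lemma stoch_integral_approx (G : H -> H) t (L : R -> Om -> nat -> R) a Y (eps : R) :
  continuous G -> a <= t ->
  (forall u k, a <= u -> measurable_fun setT (fun w => L u w k)) ->
  is_stoch_integral P (semigroup_integrand G t) L a t Y -> 0 < eps ->
  exists2 delta : R, 0 < delta &
    forall s, path (finer_than delta) a s -> last a s = t ->
    let E := [set w | eps <= `|Y w - riemann_sum (semigroup_integrand G t) L a s w|] in
    measurable E /\ (P E <= eps%:E)%E.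
Proof.
move=> Gc at_ mL [mY HY] eps0; have [delta d0 Hd] := HY _ eps0.
exists delta => // s ps ls; have [itv mesh] := finer_partitionP ps ls.
split; last exact: Hd.
apply: (measurable_dist_ge ipP eP) => //; apply: measurable_riemann_sum => //.
  by case: itv.
by rewrite ls.
Qed.

Lemma eq_partition_sum (V : zmodType) (f g : R -> R -> V) a s :
  path <%R a s -> (forall x y, a <= x -> x <= y -> y <= last a s -> f x y = g x y) ->
  partition_sum f a s = partition_sum g a s.
Proof.
elim: s a => [|c s IH] a /=; first by rewrite /partition_sum !big_ord0.
move=> /andP[ac ps] fg; rewrite !partition_sum_cons.
have cl := path_le_last ps.
rewrite fg ?(ltW ac)// IH// => x y cx; apply: fg; apply: le_trans cx; exact: ltW.
Qed.

Variables (rho : nat -> R) (L Lbar : R -> Om -> nat -> R).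
Hypotheses (rho0 : forall k, 0 < rho k) (brho : bounded_diag rho b).
Hypothesis LbarL : forall t, 0 <= t -> Lbar t = L t.
Hypothesis mLbar : forall t k, measurable_fun setT (fun w => Lbar t w k).
Hypothesis Lcadlag : {ae P, forall w, cadlag_wl2 rho (L ^~ w)}.

(** The part of the noise before time 0 cancels in the increment on the left;
    the rest is compared with the stochastic convolution on Riemann sums,
    where summation by parts gives a pathwise bound. *)
Lemma stoch_integral_increment (G : H -> H) k (t : R) (Yt Y0 LAt : Om -> H) :
  continuous G -> (forall x y, ip (G x) y = ip x (G y)) -> 0 <= t ->
  is_stoch_integral_ninfty P (semigroup_integrand G t) Lbar t Yt ->
  is_stoch_integral_ninfty P (semigroup_integrand G 0) Lbar 0 Y0 ->
  is_stoch_integral P (semigroup_integrand id t) L 0 t LAt ->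
  {ae P, forall w, forall M : R,
    (forall s, 0 <= s -> s <= t -> `|diag_op e b (L s w)| <= M) ->
    `|expR (lam k * t) * ip (Yt w) (e k) - ip (Y0 w) (e k)
      - expR (lam k * t) * ip (LAt w) (e k)|
    <= 2 * (M * `|G (e k) - e k|) * expR (lam k * t)}.
Proof.
move=> Gc Gs t0 [mYt [It [Its Itc]]] [mY0 [I0 [I0s I0c]]] LAs.
(* The constants 3 E + 2 and 5, with E the exponential, count the errors
   collected below: two integrals truncated at -a and three Riemann sums. *)
pose c := 3 * expR (lam k * t) + 2.
have lam0 : 0 <= lam k by case: linP => _ _ [_ /(_ k)[_ _ /ltW]].
pose Q (eps : R) w := (forall s, 0 <= s -> (wl2 rho (L s w) < +oo)%E) ->
  forall M : R,
    (forall s, 0 <= s -> s <= t -> `|diag_op e b (L s w)| <= M) ->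
    `|expR (lam k * t) * ip (Yt w) (e k) - ip (Y0 w) (e k)
      - expR (lam k * t) * ip (LAt w) (e k)|
    <= 2 * (M * `|G (e k) - e k|) * expR (lam k * t) + c * eps.
have e1 := basis_norm1 ipP eP k.
have cont_id : continuous (@id H) by move=> x; exact: cvg_id.
suff /ae_exists_small : forall eps : R, 0 < eps -> exists E, [/\ measurable E,
    (P E <= (5 * eps)%:E)%E & forall w, ~ E w -> Q eps w].
  apply: filterS2 Lcadlag => w Lw Hw M HM; apply/ler_addgt0Pr => z z0.
  have c0 : 0 < c by rewrite ltr_wpDl// mulr_ge0// expR_ge0.
  have zc : 0 < z / c by rewrite divr_gt0.
  have [eps [eps0 epsz Qw]] := Hw _ zc.
  case: Lw => Loo _ _; apply: (le_trans (Qw Loo M HM)); rewrite lerD2l.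
  by rewrite -ler_pdivlMl// mulrC ltW.
move=> eps eps0.
have [a [a0 Ita I0a mEa mE0]] : exists a : R, [/\ 0 < a,
    is_stoch_integral P (semigroup_integrand G t) Lbar (- a) t (It a),
    is_stoch_integral P (semigroup_integrand G 0) Lbar (- a) 0 (I0 a),
    (P [set w | (eps <= `|It a w - Yt w|)%R] <= eps%:E)%E
  & (P [set w | (eps <= `|I0 a w - Y0 w|)%R] <= eps%:E)%E].
  have small (Z : R -> set Om) : P (Z a) @[a --> +oo] --> 0%E ->
      \forall a \near +oo, (P (Z a) <= eps%:E)%E.
    move=> /fine_cvgP[ffin /cvgrPdist_le/(_ _ eps0)].
    apply: filterS2 ffin => a' fa; rewrite sub0r normrN => h.
    by rewrite -(fineK fa) lee_fin (le_trans (ler_norm _)).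
  have h1 := small _ (Itc _ eps0); have h2 := small _ (I0c _ eps0).
  have : \forall a \near +oo, 0 < a :> R by apply: nbhs_pinfty_gt; exact: num_real.
  move=> h0; apply: (@filter_ex _ (nbhs +oo)); near=> a.
  by split => //; near: a.
have at_ : - a <= t by rewrite (le_trans _ t0)// oppr_le0 ltW.
have a0' : - a <= 0 by rewrite oppr_le0 ltW.
have mLb c' : forall u l, c' <= u -> measurable_fun setT (fun w => Lbar u w l).
  by [].
have mL u l : 0 <= u -> measurable_fun setT (fun w => L u w l).
  by move=> u0; rewrite -LbarL.
have [d1 d10 H1] := stoch_integral_approx Gc at_ (mLb _) Ita eps0.
have [d2 d20 H2] := stoch_integral_approx Gc a0' (mLb _) I0a eps0.
have [d3 d30 H3] := stoch_integral_approx cont_id t0 mL LAs eps0.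
pose dm := Num.min d1 (Num.min d2 d3).
have dm0 : 0 < dm by rewrite !lt_min d10 d20 d30.
have sub_finer x r (D : R) : dm <= D -> path (finer_than dm) x r -> path (finer_than D) x r.
  move=> dD; apply: sub_path => u v /andP[uv h]; rewrite /finer_than uv/=.
  exact: lt_le_trans dD.
have dm1 : dm <= d1 by rewrite ge_min lexx.
have dm2 : dm <= d2 by rewrite !ge_min lexx orbT.
have dm3 : dm <= d3 by rewrite !ge_min lexx !orbT.
have lt_finer x r : path (finer_than dm) x r -> path <%R x r.
  by apply: sub_path => u v /andP[].
(* One partition of [-a, t] passes through 0, so that its sum over [-a, 0] is
   the Riemann sum of the integral up to time 0. *)
have [s0 [ps0 ls0]] := exists_finer_partition a0' dm0.
have [s1 [ps1 ls1]] := exists_finer_partition t0 dm0.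
have ps : path (finer_than dm) (- a) (s0 ++ s1) by rewrite cat_path ps0 ls0.
have ls : last (- a) (s0 ++ s1) = t by rewrite last_cat ls0.
have [mE1 PE1] := H1 _ (sub_finer _ _ _ dm1 ps) ls.
have [mE2 PE2] := H2 _ (sub_finer _ _ _ dm2 ps0) ls0.
have [mE3 PE3] := H3 _ (sub_finer _ _ _ dm3 ps1) ls1.
have mE4 : measurable [set w | eps <= `|It a w - Yt w|].
  by apply: (measurable_dist_ge ipP eP) => //; case: Ita.
have mE5 : measurable [set w | eps <= `|I0 a w - Y0 w|].
  by apply: (measurable_dist_ge ipP eP) => //; case: I0a.
set E1 := [set w | _] in mE1 PE1; set E2 := [set w | _] in mE2 PE2.
set E3 := [set w | _] in mE3 PE3; set E4 := [set w | _] in mE4 mEa.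
set E5 := [set w | _] in mE5 mE0.
have mU2 (U V : set Om) (x y : R) : measurable U -> measurable V ->
    (P U <= x%:E)%E -> (P V <= y%:E)%E -> (P (U `|` V) <= (x + y)%:E)%E.
  move=> mU mV Ux Vy; apply: (le_trans (measureU2 P mU mV)).
  by rewrite EFinD leeD.
have m45 : measurable (E4 `|` E5) by exact: measurableU.
have m35 : measurable (E3 `|` (E4 `|` E5)) by exact: measurableU.
have m25 : measurable (E2 `|` (E3 `|` (E4 `|` E5))) by exact: measurableU.
exists (E1 `|` (E2 `|` (E3 `|` (E4 `|` E5)))); split; first exact: measurableU.
- have -> : 5 * eps = eps + (eps + (eps + (eps + eps))) by ring.
  exact: (mU2 _ _ _ _ mE1 m25 PE1 (mU2 _ _ _ _ mE2 m35 PE2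
    (mU2 _ _ _ _ mE3 m45 PE3 (mU2 _ _ _ _ mE4 mE5 mEa mE0)))).
move=> w /not_orP[h1 /not_orP[h2 /not_orP[h3 /not_orP[h4 h5]]]] Loo M HM.
have n1 : `|It a w - riemann_sum (semigroup_integrand G t) Lbar (- a) (s0 ++ s1) w| <= eps.
  by rewrite leNgt; apply/negP => /ltW.
have n2 : `|I0 a w - riemann_sum (semigroup_integrand G 0) Lbar (- a) s0 w| <= eps.
  by rewrite leNgt; apply/negP => /ltW.
have n3 : `|LAt w - riemann_sum (semigroup_integrand id t) L 0 s1 w| <= eps.
  by rewrite leNgt; apply/negP => /ltW.
have n4 : `|It a w - Yt w| <= eps by rewrite leNgt; apply/negP => /ltW.
have n5 : `|I0 a w - Y0 w| <= eps by rewrite leNgt; apply/negP => /ltW.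
have toip x y : `|x - y| <= eps -> `|ip x (e k) - ip y (e k)| <= eps.
  by move=> h; rewrite -(ipBl ipP) (le_trans (cauchy_schwarz ipP _ _))// e1 mulr1.
have {}n1 := toip _ _ n1; have {}n2 := toip _ _ n2; have {}n3 := toip _ _ n3.
have {}n4 := toip _ _ n4; have {}n5 := toip _ _ n5.
have ltt0 : last (- a) s0 <= 0 by rewrite ls0.
have ltt1 : last 0 s1 <= t by rewrite ls1.
have ltt : last (- a) (s0 ++ s1) <= t by rewrite ls.
have r1 := riemann_sum_coord k Lbar w Gs (lt_finer _ _ ps) ltt.
have r2 := riemann_sum_coord k Lbar w Gs (lt_finer _ _ ps0) ltt0.
have r3 := @riemann_sum_coord id k t L 0 s1 w (fun _ _ => erefl) (lt_finer _ _ ps1) ltt1.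
rewrite mulr0 expR0 mul1r in r2.
rewrite partition_sum_cat ls0 -r2 in r1.
set RS1 := ip (riemann_sum _ Lbar _ (s0 ++ s1) _) _ in n1 r1.
set RS2 := ip (riemann_sum _ Lbar _ s0 _) _ in n2 r1.
set RS3 := ip (riemann_sum _ _ _ _ _) _ in n3 r3.
pose l x := ip (diag_op e b (L x w)) (G (e k) - e k).
have main : `|expR (lam k * t) * RS1 - RS2 - expR (lam k * t) * RS3| <=
    2 * (M * `|G (e k) - e k|) * expR (lam k * t).
  rewrite r1 r3 [RS2 + _]addrC addrK /partition_sum -sumrB.
  rewrite (_ : \sum_(i < _) _ =
    partition_sum (fun x y => expR (lam k * x) * (l y - l x)) 0 s1); last first.
    rewrite -[LHS]/(partition_sum (fun x y => expR (lam k * x) *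
        ip (diag_op e b (Lbar y w \- Lbar x w)) (G (e k)) -
      expR (lam k * x) * ip (diag_op e b (L y w \- L x w)) (e k)) 0 s1).
    apply: eq_partition_sum; first exact: lt_finer ps1.
    move=> x y x0 xy yl; have y0 := le_trans x0 xy.
    rewrite !LbarL// -mulrBr -(ipBr ipP) (diag_opB ipP eP rho0 brho) ?Loo//.
    by rewrite (ipBl ipP).
  rewrite -[X in expR (_ * X)]ls1.
  apply: (@abel_bound R (fun x => expR (lam k * x)) l).
  - by move=> x y xy; rewrite ler_expR ler_wpM2l.
  - exact: expR_ge0.
  - move=> x x0; rewrite ls1 => xt; rewrite (le_trans (cauchy_schwarz ipP _ _))//.
    by rewrite ler_wpM2r// HM.
  - exact: lt_finer ps1.
move: main n1 n2 n3 n4 n5; rewrite /c.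
have := expR_gt0 (lam k * t); set Et := expR _.
set Bd := 2 * _ * Et.
move: (ip (It a w) _) (ip (I0 a w) _) (ip (Yt w) _) (ip (Y0 w) _) (ip (LAt w) _).
move=> i1 i2 y1 y2 la Et0 main n1 n2 n3 n4 n5.
have -> : Et * y1 - y2 - Et * la = (Et * RS1 - RS2 - Et * RS3) +
  (- (Et * (i1 - y1)) + Et * (i1 - RS1) + (i2 - y2) - (i2 - RS2) - Et * (la - RS3)) by ring.
rewrite (le_trans (ler_normD _ _))// lerD//.
have EN z : `|z| <= eps -> `|Et * z| <= Et * eps.
  by move=> h; rewrite normrM (gtr0_norm Et0) ler_pM2l.
have m1 := EN _ n1; have m3 := EN _ n3; have m4 := EN _ n4.
move: m1 m3 m4 n2 n5; rewrite !ler_norml => /andP[? ?] /andP[? ?] /andP[? ?] /andP[? ?] /andP[? ?].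
by apply/andP; split; lra.
Unshelve. all: by end_near. Qed.

End StochasticIntegral.

(** * A subsequence converging along the paths *)

Section RationalRightLimits.
Context {R : realType}.

Lemma right_rationals_ex (Q : R -> Prop) (t T : R) : t < T ->
  (\forall s \near t^'+, Q s) ->
  exists q : rat, [/\ t < ratr q, ratr q < T & Q (ratr q)].
Proof.
move=> tT [eps /= eps0 HQ].
have [|q] := @rat_in_itvoo R t (Num.min T (t + eps)); first by rewrite lt_min tT ltrDl.
rewrite in_itv/= lt_min => /andP[tq /andP[qT qe]]; exists q; split => //.
by apply: HQ => //=; rewrite distrC gtr0_norm ?subr_gt0// ltrBlDl.
Qed.

(** Events that are almost sure at each time hold together only at countably
    many times; right-continuity recovers the others. *)
Lemma right_cvg_le {V : normedModType R} (f : R -> V) (t T c : R) :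
  f s @[s --> t^'+] --> f t -> t < T ->
  (forall q : rat, t < ratr q -> ratr q < T -> `|f (ratr q)| <= c) -> `|f t| <= c.
Proof.
move=> ft tT H; apply/ler_addgt0Pr => eps eps0.
have /cvgrPdist_le/(_ _ eps0) near_t := ft.
have [q [tq qT Hq]] := right_rationals_ex tT near_t.
have -> : f t = f (ratr q) + (f t - f (ratr q)) by rewrite addrC subrK.
by rewrite (le_trans (ler_normD _ _))// lerD// H.
Qed.

End RationalRightLimits.

Section FastSubsequence.
Context {R : realType} {d : measure_display} {Om : measurableType d}.
Variable P : probability Om R.
Context {H B : completeNormedModType R}.
Variables (ip : H -> H -> R) (e : nat -> H) (j : {linear B -> H}).
Hypotheses (ipP : inner_product_of ip) (eP : orthonormal_basis ip e).
Variables (Bn : nat -> set B) (Pi : nat -> {linear H -> B}).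
Hypothesis jP : banach_embedding j.
Hypothesis PiP : projections ip j Bn Pi.

(** This writes the norm of B as a countable supremum of functions that are
    continuous on H, hence measurable. *)
Lemma norm_le_projections (x : B) (c : R) :
  (forall n, `|Pi n (j x)| <= c) -> `|x| <= c.
Proof.
case: PiP => _ _ _ /(_ x) Pix H'.
by apply: (ler_cvg_to (cvg_norm Pix) (cvg_cst c)); exact: nearW.
Qed.

Variables (m0 : nat) (rnm : nat -> nat -> R -> Om -> H) (r : R -> Om -> H).
Hypothesis rP : limit_process P j m0 rnm r.
Hypothesis mrnm : forall n m t, (m0 <= m)%N ->
  measurable_fun setT (rnm n m t : Om -> borel H).

(** The paths are compared at rational times and through the projections in
    order to get a measurable event. *)
Let bad n m (T c : R) := [set w | exists (l : nat) (q : rat),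
  [/\ 0 <= ratr q :> R, ratr q <= T & c < `|Pi l (rnm n m (ratr q) w - r (ratr q) w)|]].

Lemma measurable_bad n m T c : (m0 <= m)%N -> measurable (bad n m T c).
Proof.
move=> m0m; case: rP => mr _ _ _ _.
have -> : bad n m T c = \bigcup_(p : nat * rat)
    [set w | [/\ 0 <= ratr p.2 :> R, ratr p.2 <= T
      & c < `|Pi p.1 (rnm n m (ratr p.2) w - r (ratr p.2) w)|]].
  apply/seteqP; split => w /=.
    by move=> [l [q qP]]; exists (l, q).
  by move=> [[l q] _ /= qP]; exists l, q.
apply: countable_bigcupT_measurable => // -[l q] /=.
have [q0|q0] := leP 0 (ratr q : R); last first.
  by rewrite (_ : mkset _ = set0)//; apply/seteqP; split => w // [].
have [qT|qT] := leP (ratr q : R) T; last first.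
  by rewrite (_ : mkset _ = set0)//; apply/seteqP; split => w // [].
rewrite (_ : mkset _ = [set w | c < `|Pi l (rnm n m (ratr q) w - r (ratr q) w)|]); last first.
  by apply/seteqP; split => w // [].
have mD : measurable_fun setT ((fun w => rnm n m (ratr q) w - r (ratr q) w) : Om -> borel H).
  apply: (weakly_measurable ipP eP) => k; under eq_fun do rewrite (ipBl ipP).
  apply: measurable_funB;
    apply: (continuous_measurable_comp (f := ip ^~ (e k))) => //;
    first [exact: mrnm | exact: mr | by move=> y; exact: cvg_ipl].
rewrite (_ : mkset _ = ~` (setT `&`
    [set w | `|Pi l (rnm n m (ratr q) w - r (ratr q) w)| <= c])); last first.
  by rewrite setTI; apply/seteqP; split => w /=; [move=> h; apply/negP; rewrite -ltNge
    | move/negP; rewrite -ltNge].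
apply: measurableC; apply: measurable_fun_le => //.
apply: (continuous_measurable_comp (f := fun h => `|Pi l h|)) => // h.
apply: cvg_norm; exact: (projection_continuous ipP jP PiP).
Qed.

(** By Markov's inequality the bad events have small probability, because the
    supremum whose expectation tends to 0 is at least c / M on them; M is the
    uniform bound of the projections on B. Indices with summable probabilities
    are chosen and the Borel-Cantelli lemma applies. *)
Lemma fast_subsequence : exists K : nat -> nat,
  (forall i, (m0 <= K i)%N /\ (i <= K i)%N) /\
  {ae P, forall w, exists N, forall i, (N <= i)%N ->
    forall (l : nat) (q : rat), 0 <= ratr q :> R -> ratr q <= i%:R :> R ->
    `|Pi l (rnm (K i) (K i) (ratr q) w - r (ratr q) w)| <= (2 ^ i.+1)%:R^-1}.
Proof.
have [M M0 HM] := projection_bound_B ipP jP PiP.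
case: (rP) => _ _ _ lim _.
pose f n m T w := poweR (ereal_sup [set enorm j (rnm n m t w - r t w) | t in `[0, T]]) 1.
have badf n m T c : (m0 <= m)%N -> 0 <= c ->
    ((c / M)%:E * P (bad n m T c) <= \int[P]_w f n m T w)%E.
  move=> m0m c0; have mb := measurable_bad n T c m0m.
  have -> : ((c / M)%:E * P (bad n m T c) =
      \int[P]_w ((c / M)%:E * (\1_(bad n m T c) w)%:E))%E.
    rewrite ge0_integralZl//.
    - by rewrite integral_indic// setIT.
    - exact/measurable_EFinP/measurable_indic.
    - by rewrite lee_fin divr_ge0// ltW.
  apply: ge0_le_integral_ae => //.
  - apply: emeasurable_funM => //; exact/measurable_EFinP/measurable_indic.
  - by move=> w _; rewrite mule_ge0// lee_fin// divr_ge0// ltW.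
  - by move=> w _; exact: poweR_ge0.
  - apply: aeW => w _; rewrite /f.
    have [wb|wb] := pselect (bad n m T c w); last first.
      by rewrite indicE memNset// mule0 poweR_ge0.
    rewrite indicE mem_set// mule1; case: wb => l [q [q0 qT cq]].
    set s := ereal_sup _.
    suff cs : ((c / M)%:E <= s)%E.
      by rewrite poweRe1// (le_trans _ cs)// lee_fin divr_ge0// ltW.
    apply: (@le_trans _ _ (enorm j (rnm n m (ratr q) w - r (ratr q) w))); last first.
      by apply: ereal_sup_ubound; exists (ratr q) => //=; rewrite in_itv/= q0.
    apply: le_ereal_inf_tmp => _ [y /= jy <-]; rewrite lee_fin ler_pdivrMr// mulrC.
    by rewrite (le_trans (ltW cq))// -jy HM.
have /choice[K KP] : forall i : nat, exists k : nat, [/\ (m0 <= k)%N, (i <= k)%N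
    & (P (bad k k i%:R (2 ^ i.+1)%:R^-1) <= (1 / (2 ^ i.+1)%:R)%:E)%E].
  move=> i; pose c : R := (2 ^ i.+1)%:R^-1.
  have c0 : 0 < c by rewrite invr_gt0 ltr0n expn_gt0.
  have small : 0 < c / M * c by rewrite mulr_gt0// divr_gt0.
  have i0 : 0 < i.+1%:R :> R by [].
  have /fine_cvgP[ffin /cvgrPdist_lt/(_ _ small) fsmall] := lim 1 i.+1%:R (lexx _) i0.
  have [[Q1 Q2] /= [[n1 _ H1] [n2 _ H2]] Hs] := filterI ffin fsmall.
  pose k := maxn (maxn n1 n2) (maxn m0 i).
  have [|fk ck] := Hs (k, k).
    by split; [apply: H1|apply: H2]; rewrite /= /k; lia.
  exists k; split; [rewrite /k; lia | rewrite /k; lia |].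
  have m0k : (m0 <= k)%N by rewrite /k; lia.
  have bsub : bad k k i%:R c `<=` bad k k i.+1%:R c.
    move=> w [l [q [q0 qi cq]]]; exists l, q; split => //.
    by rewrite (le_trans qi)// ler_nat.
  apply: (@le_trans _ _ (P (bad k k i.+1%:R c))).
    by apply: le_measure; rewrite ?inE//; exact: measurable_bad.
  have := badf k k i.+1%:R c m0k (ltW c0).
  move: fk ck => /=; rewrite -/(f k k i.+1%:R) => fk.
  rewrite sub0r normrN => ck Pb.
  have cM : 0 < c / M by rewrite divr_gt0.
  rewrite -(@lee_pmul2l _ (c / M)%:E) ?lte_fin//.
  apply: (le_trans Pb); rewrite -EFinM -[X in (X <= _)%E](fineK fk) lee_fin.
  by rewrite mul1r (le_trans (ler_norm _))// ltW.
exists K; split; first by move=> i; case: (KP i).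
pose F i := bad (K i) (K i) i%:R (2 ^ i.+1)%:R^-1.
have mF i : measurable (F i) by apply: measurable_bad; case: (KP i).
exists (lim_sup_set F); split.
- apply: bigcapT_measurable => n; apply: bigcup_measurable => k _; exact: mF.
- apply: lim_sup_set_cvg0 => //.
  apply: (@le_lt_trans _ _ (\sum_(0 <= i <oo) (1 / (2 ^ i.+1)%:R)%:E)%E).
    by apply: lee_nneseries => // i _; case: (KP i).
  apply: (@le_lt_trans _ _ 1%:E); last exact: ltry.
  exact: epsilon_trick0.
- move=> w /= /forallNP Hw n _.
  have /existsNP[i /not_implyP[ni Hi]] := Hw n.
  exists i => //; apply: contrapT => nF; apply: Hi => l q q0 qi.
  by rewrite leNgt; apply/negP => cq; apply: nF; exists l, q.
Qed.

(** The paths are right-continuous in B, so that rational times suffice. *)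
Lemma fast_subsequence_paths : exists K : nat -> nat,
  (forall i, (m0 <= K i)%N /\ (i <= K i)%N) /\
  {ae P, forall w, exists (Y : nat -> R -> B) (y : R -> B) (N : nat),
    [/\ forall i, cadlag (Y i) /\ forall t, 0 <= t -> j (Y i t) = rnm (K i) (K i) t w,
        cadlag y, forall t, 0 <= t -> j (y t) = r t w
      & forall i t, (N <= i)%N -> 0 <= t -> t < i%:R ->
          `|Y i t - y t| <= (2 ^ i.+1)%:R^-1]}.
Proof.
have [K [KP Kae]] := fast_subsequence; exists K; split => //.
case: (rP) => _ rnmc rc _ _.
have /ae_foralln Yae : forall i, {ae P, forall w, cadlag_in j (fun t => rnm (K i) (K i) t w)}.
  by move=> i; apply: rnmc; case: (KP i).
apply: filterS3 Kae Yae rc => w [N HN] /choice[Y YP] [y [yc jy]].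
exists Y, y, N; split => // i t Ni t0 ti.
have [Yc jY] := YP i.
apply: (@right_cvg_le R B (fun s => Y i s - y s) t i%:R) => //.
  by apply: cvgB; [case: Yc => h _; exact: h | case: yc => h _; exact: h].
move=> q tq qi; apply: norm_le_projections => n.
have q0 : 0 <= ratr q :> R by rewrite (le_trans t0)// ltW.
rewrite linearB/= jY// jy//; apply: HN => //; exact: ltW.
Qed.

End FastSubsequence.

(** * The approximate equations and their limit *)

Section ScalarEquations.
Context {R : realType} {H B : completeNormedModType R}.
Variables (ip : H -> H -> R) (DA : set H) (A : H -> H) (S : R -> {linear H -> H}).
Variables (e : nat -> H) (lam : nat -> R) (omega : R).
Hypothesis ipP : inner_product_of ip.
Hypothesis linP : linear_part ip DA A S e lam omega.
Let leb : {measure set _ -> \bar R} := @lebesgue_measure R.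

Let eP : orthonormal_basis ip e. Proof. by case: linP => _ _ []. Qed.

(** In the eigenbasis the convolution with the semigroup becomes, after
    multiplication by the inverse exponential, a primitive. *)
Lemma convolution_coord (D : set (measurableTypeR R)) (g : R -> H) k (t : R) (v : H) :
  measurable D -> (forall s, D s -> s <= t) ->
  is_bochner_integral leb D (fun s => S (t - s) (g s)) v ->
  ae_integral leb D (fun s => expR (lam k * s) * ip (g s) (e k))
    (expR (lam k * t) * ip v (e k)).
Proof.
move=> mD Dt vP.
have e1 := basis_norm1 ipP eP k.
pose l z := ip z (e k).
have lin (a : R) x y : l (a *: x + y) = a * l x + l y by exact: (ip_linl ipP).
have lb x : `|l x| <= 1 * `|x|.
  by rewrite mul1r (le_trans (cauchy_schwarz ipP _ _))// e1 mulr1.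
have h := bochner_ae_integral mD lin lb vP.
have h0 : ae_integral leb D (fun=> 0) 0.
  exists (cst 0); split; [exact: integrable0 | exact: aeW | by rewrite integral0].
have := ae_integral_linear (expR (lam k * t)) mD h h0; rewrite addr0.
apply: eq_ae_integral; apply: aeW => s Ds.
rewrite addr0 /l (semigroup_coord ipP linP) ?subr_ge0 ?Dt// mulrA -expRD.
congr (expR _ * _); ring.
Qed.

Lemma convolution_increment (g : R -> H) k (t : R) (vt v0 : H) : 0 <= t ->
  is_bochner_integral leb `]-oo, t] (fun s => S (t - s) (g s)) vt ->
  is_bochner_integral leb `]-oo, 0] (fun s => S (0 - s) (g s)) v0 ->
  ae_integral leb `]0, t] (fun s => expR (lam k * s) * ip (g s) (e k))
    (expR (lam k * t) * ip vt (e k) - ip v0 (e k)).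
Proof.
move=> t0 vtP v0P.
have h1 : ae_integral leb `]-oo, t] (fun s => expR (lam k * s) * ip (g s) (e k))
    (expR (lam k * t) * ip vt (e k)).
  by apply: convolution_coord => // s /=; rewrite in_itv.
have h0 : ae_integral leb `]-oo, 0] (fun s => expR (lam k * s) * ip (g s) (e k))
    (expR (lam k * 0) * ip v0 (e k)).
  by apply: convolution_coord => // s /=; rewrite in_itv.
rewrite mulr0 expR0 mul1r in h0.
have E : `]-oo, t]%classic = `]-oo, 0] `|` `]0, t] :> set R.
  apply/seteqP; split => s /=; rewrite !in_itv/=.
    by move=> st; case: (leP s 0) => s0; [left | right; rewrite st andbT].
  by move=> [s0|/andP[]//]; exact: le_trans t0.
rewrite E in h1; apply: ae_integral_diff h1 h0 => //.
apply/disj_setPLR => s /=; rewrite !in_itv/= => s0; apply/negP.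
by rewrite negb_and -leNgt s0.
Qed.

Lemma mild_increment (g : R -> H) k (t : R) (v : H) : 0 <= t ->
  is_bochner_integral leb `[0, t] (fun s => S (t - s) (g s)) v ->
  ae_integral leb `]0, t] (fun s => expR (lam k * s) * ip (g s) (e k))
    (expR (lam k * t) * ip v (e k)).
Proof.
move=> t0 vP.
have h1 : ae_integral leb `[0, t] (fun s => expR (lam k * s) * ip (g s) (e k))
    (expR (lam k * t) * ip v (e k)).
  by apply: convolution_coord => // s /=; rewrite in_itv => /andP[].
have h0 : ae_integral leb [set 0] (fun s => expR (lam k * s) * ip (g s) (e k)) 0.
  by apply: ae_integral_null; [exact: measurable_set1 | exact: lebesgue_measure_set1].
have E : `[0, t]%classic = [set 0] `|` `]0, t] :> set R by rewrite setU1itv.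
rewrite E in h1; have := ae_integral_diff _ _ _ h1 h0; rewrite subr0; apply => //.
by apply/disj_setPLR => s /= -> ; rewrite in_itv/= ltxx.
Qed.

End ScalarEquations.

Lemma cadlag_bounded {R : realType} {B : normedModType R} (y : R -> B) (t : R) :
  cadlag y -> exists c : R, forall s, 0 <= s -> s <= t -> `|y s| <= c.
Proof.
move=> [yr yl].
have close (l : B) (Q : set_system R) : Filter Q -> y s @[s --> Q] --> l ->
    exists M : R, \forall s \near Q, `|y s| <= M.
  move=> FQ /cvgrPdist_le/(_ _ ltr01) yQ; exists (`|l| + 1); apply: filterS yQ => s h.
  have -> : y s = l - (l - y s) by rewrite opprB addrC subrK.
  by rewrite (le_trans (ler_normB _ _))// lerD2l.
apply: (@bounded_of_one_sided R (fun s => `|y s|)) => s s0.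
  exact: close (yr s s0).
by have [l /close] := yl s s0; apply.
Qed.

Section YosidaLimit.
Context {R : realType} {H B : completeNormedModType R}.
Variables (ip : H -> H -> R) (j : {linear B -> H}).
Hypothesis ipP : inner_product_of ip.
Variables (Bn : nat -> set B) (Pi : nat -> {linear H -> B}).
Hypothesis jP : banach_embedding j.
Hypothesis PiP : projections ip j Bn Pi.
Variables (DF : set H) (F : H -> H) (eta : R) (m0 : nat) (Fm : nat -> H -> H).
Hypothesis Fcont : {within DF, continuous F}.
Hypothesis jDF : range j `<=` DF.
Hypothesis Fbounded : forall C : set B, bounded_set C -> bounded_set [set F (j x) | x in C].
Hypothesis FmP : yosida_approximations ip DF F eta m0 Fm.

Lemma F_bounded_on_balls (c : R) : exists2 K : R, 0 <= K
  & forall x, `|x| <= c -> `|F (j x)| <= K.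
Proof.
have [|M [Mr HM]] := Fbounded (C := [set x | `|x| <= c]).
  by exists c; split; [exact: num_real | move=> M cM x /= /le_trans; apply; exact: ltW].
exists (`|M| + 1) => [|x xc]; first by rewrite addr_ge0.
apply: (HM (`|M| + 1)) => /=; last by exists x.
by rewrite (le_lt_trans (ler_norm M))// ltrDl.
Qed.

Lemma yosida_projection_bound (c : R) : exists2 K : R, 0 <= K
  & forall n m x, (m0 <= m)%N -> `|x| <= c -> `|Fm m (j (Pi n (j x)))| <= K.
Proof.
have [M M0 HM] := projection_bound_B ipP jP PiP.
have [K K0 HK] := F_bounded_on_balls (M * c); exists K => // n m x m0m xc.
case: FmP => _ _ _ _ Fb; rewrite (le_trans (Fb _ _ m0m _))//.
  by apply: jDF; exists (Pi n (j x)).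
by apply: HK; rewrite (le_trans (HM _ _))// ler_pM2l.
Qed.

(** The Yosida approximation of u is F at a point whose distance to u is the
    norm of that value divided by m, so bounded values force convergence along
    any convergent sequence of arguments. *)
Lemma yosida_projection_cvg (K : nat -> nat) (y : nat -> B) (x : B) (c : R) :
  (forall i, (m0 <= K i)%N /\ (i <= K i)%N) ->
  (forall i, `|y i| <= c) -> y i @[i --> \oo] --> x ->
  Fm (K i) (j (Pi (K i) (j (y i)))) @[i --> \oo] --> F (j x).
Proof.
move=> KP yc yx.
have [C C0 HC] := yosida_projection_bound c.
have [M M0 HM] := projection_bound_H ipP jP PiP.
have [Cj Cj0 HCj] := embedding_bound jP.
case: (FmP) => etam0 Fy _ _ _.
pose u i := j (Pi (K i) (j (y i))).
have /choice[z zP] : forall i, exists z, [/\ DF z, z - (K i)%:R^-1 *: F z = u i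
    & Fm (K i) (u i) = F z].
  by move=> i; apply: Fy; case: (KP i).
have Koo : K i @[i --> \oo] --> \oo.
  move=> Q [N _ HN]; exists N => // i /= Ni; apply: HN => /=.
  by case: (KP i) => _; exact: leq_trans.
have Pjx : j (Pi (K i) (j x)) @[i --> \oo] --> j x.
  exact: (cvg_comp _ _ Koo (projection_cvg_H ipP jP PiP (h := j x))).
have zc : z i @[i --> \oo] --> j x.
  apply/cvgrPdist_le => eps eps0; have e3 : 0 < eps / 3 by rewrite divr_gt0.
  have eM : 0 < eps / 3 / (M * Cj + 1) by rewrite divr_gt0// ltr_wpDl// mulr_ge0// ltW.
  near=> i.
  have -> : j x - z i = (j x - j (Pi (K i) (j x))) + j (Pi (K i) (j (x - y i)))
      + (u i - z i).
    have -> : j (Pi (K i) (j (x - y i))) = j (Pi (K i) (j x)) - u i by rewrite !linearB.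
    by rewrite !addrA !subrK.
  have h1 : `|j x - j (Pi (K i) (j x))| <= eps / 3.
    by near: i; move/cvgrPdist_le : Pjx; apply.
  have h2 : `|j (Pi (K i) (j (x - y i)))| <= eps / 3.
    have h : `|x - y i| <= eps / 3 / (M * Cj + 1).
      by near: i; move/cvgrPdist_le : yx; apply.
    move: h; rewrite ler_pdivlMr ?ltr_wpDl ?mulr_ge0 ?(ltW M0)// => h.
    rewrite (le_trans (HM _ _))// (le_trans _ h)//.
    rewrite (@le_trans _ _ (M * (Cj * `|x - y i|)))//.
      by rewrite ler_pM2l.
    by rewrite mulrA mulrC ler_wpM2l// lerDl.
  have h3 : `|u i - z i| <= eps / 3.
    have [_ zu Fz] := zP i.
    have -> : u i - z i = - ((K i)%:R^-1 *: F (z i)) by rewrite -zu addrAC subrr add0r.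
    rewrite normrN normrZ.
    have KC : C * (eps / 3)^-1 <= (K i)%:R.
      have : C * (eps / 3)^-1 <= i%:R by near: i; exact: nbhs_infty_ger.
      by move=> /le_trans; apply; rewrite ler_nat; case: (KP i).
    have FC : `|F (z i)| <= C by rewrite -Fz /u HC//; case: (KP i).
    rewrite normfV ger0_norm//.
    have [K0|K0] := eqVneq (K i) 0%N; first by rewrite K0 invr0 mul0r ltW.
    have Kp : 0 < (K i)%:R :> R by rewrite ltr0n lt0n.
    rewrite ler_pdivrMl// (le_trans FC)//.
    by move: KC; rewrite ler_pdivrMr.
  have -> : eps = eps / 3 + eps / 3 + eps / 3 by lra.
  by rewrite (le_trans (ler_normD _ _))// lerD// (le_trans (ler_normD _ _))// lerD.
have Fx : F @ within DF (nbhs (j x)) --> F (j x).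
  by move/subspace_continuousP : Fcont; apply; apply: jDF; exists x.
have zw : z i @[i --> \oo] --> within DF (nbhs (j x)).
  move=> Q /= wQ; have [n _ Hn] := zc _ wQ; exists n => // i ni.
  by apply: (Hn i ni); case: (zP i).
have := cvg_comp _ _ zw Fx; rewrite (_ : F \o z = fun i => Fm (K i) (u i))//.
by apply/funext => i /=; case: (zP i).
Unshelve. all: by end_near. Qed.

Variables (DA : set H) (A : H -> H) (S : R -> {linear H -> H}).
Variables (e : nat -> H) (lam : nat -> R) (omega : R).
Hypothesis linP : linear_part ip DA A S e lam omega.
Let leb : {measure set _ -> \bar R} := @lebesgue_measure R.

(** Dominated convergence: eventually the paths stay in a ball of B, where the
    functions Pi_n F_m Pi_n are bounded in H uniformly in n and m. The outer
    projection is moved to the basis vector by symmetry. *)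
Lemma limit_increment (K : nat -> nat) (Y : nat -> R -> B) (y : R -> B) (N : nat)
    k (t : R) (Z : nat -> R) (z : R) :
  (forall i, (m0 <= K i)%N /\ (i <= K i)%N) ->
  cadlag y -> 0 <= t ->
  (forall i s, (N <= i)%N -> 0 <= s -> s < i%:R ->
     `|Y i s - y s| <= (2 ^ i.+1)%:R^-1) ->
  (forall i, ae_integral leb `]0, t]
     (fun s => expR (lam k * s) *
        ip (j (Pi (K i) (Fm (K i) (j (Pi (K i) (j (Y i s))))))) (e k))
     (expR (lam k * t) * ip (j (Y i t)) (e k) - ip (j (Y i 0)) (e k) - Z i)) ->
  Z i @[i --> \oo] --> z ->
  ae_integral leb `]0, t] (fun s => expR (lam k * s) * ip (F (j (y s))) (e k))
    (expR (lam k * t) * ip (j (y t)) (e k) - ip (j (y 0)) (e k) - z).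
Proof.
move=> KP yc t0 HY HI Zz.
have [cy ycy] := cadlag_bounded t yc.
pose N' := (maxn N (Num.truncn t).+1).
have close i s : 0 <= s -> s <= t -> `|Y (i + N')%N s - y s| <= (2 ^ i.+1)%:R^-1.
  move=> s0 st; apply: (le_trans (HY _ _ _ s0 _)).
  - by rewrite /N'; lia.
  - rewrite (le_lt_trans st)//; apply: (lt_le_trans (truncnS_gt t)).
    by rewrite ler_nat (leq_trans (leq_maxr N _))// leq_addl.
  - by rewrite lef_pV2 ?posrE ?ltr0n ?expn_gt0// ler_nat leq_exp2l// ltnS leq_addr.
have pow0 : (2 ^ i.+1)%:R^-1 @[i --> \oo] --> (0 : R).
  apply/cvgrPdist_le => eps eps0; near=> i; rewrite sub0r normrN ger0_norm//.
  have ie : eps^-1 <= i%:R by near: i; exact: nbhs_infty_ger.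
  rewrite invf_ple ?posrE ?ltr0n ?expn_gt0//.
  by rewrite (le_trans ie)// ler_nat ltnW// (leq_ltn_trans (leqnSn i))// ltn_expl.
have Ycvg s : 0 <= s -> s <= t -> Y (i + N')%N s @[i --> \oo] --> y s.
  move=> s0 st; apply/cvgrPdist_le => eps eps0; near=> i.
  rewrite distrC (le_trans (close i s s0 st))//.
  have : `|0 - (2 ^ i.+1)%:R^-1| <= eps by near: i; move/cvgrPdist_le : pow0; apply.
  by rewrite sub0r normrN ger0_norm.
have Ybd i s : 0 <= s -> s <= t -> `|Y (i + N')%N s| <= cy + 1.
  move=> s0 st; have -> : Y (i + N')%N s = y s + (Y (i + N')%N s - y s) by rewrite addrC subrK.
  rewrite (le_trans (ler_normD _ _))// lerD ?ycy// (le_trans (close i s s0 st))//.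
  by rewrite invf_le1 ?ltr0n ?expn_gt0// ler1n expn_gt0.
have [C C0 HC] := yosida_projection_bound (cy + 1).
have [M M0 HM] := projection_bound_H ipP jP PiP.
have [_ _ [eP /(_ k)[_ _ lk] _ _] _ _] := linP.
have e1 := basis_norm1 ipP eP k.
pose f_ i s := expR (lam k * s) *
  ip (j (Pi (K (i + N')%N) (Fm (K (i + N')%N) (j (Pi (K (i + N')%N) (j (Y (i + N')%N s))))))) (e k).
have KP' i : (m0 <= K (i + N')%N)%N /\ (i <= K (i + N')%N)%N.
  by have [? h] := KP (i + N')%N; split => //; apply: leq_trans h; exact: leq_addr.
have symP : forall n x z, ip (j (Pi n x)) z = ip x (j (Pi n z)) by case: PiP.
apply: (@ae_integral_dominated _ _ _ leb `]0, t] f_ _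
  (fun i => expR (lam k * t) * ip (j (Y (i + N')%N t)) (e k)
     - ip (j (Y (i + N')%N 0)) (e k) - Z (i + N')%N) _ (expR (lam k * t) * (M * C))) => //.
- by rewrite [leb _](lebesgue_measure_itv `]0%R, t])/= lte_fin; case: ifP => _; rewrite -?EFinB ltry.
- move=> i; exact: HI.
- move=> i s /=; rewrite in_itv/= => /andP[s0 st].
  rewrite /f_ normrM gtr0_norm ?expR_gt0//; apply: ler_pM; rewrite ?expR_ge0//.
    by rewrite ler_expR ler_pM2l.
  rewrite (le_trans (cauchy_schwarz ipP _ _))// e1 mulr1 (le_trans (HM _ _))//.
  by rewrite ler_pM2l// HC//; [case: (KP' i) | apply: Ybd => //; exact: ltW].
- move=> s /=; rewrite in_itv/= => /andP[s0 st].
  apply: cvgM; first exact: cvg_cst.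
  have Fc := yosida_projection_cvg KP' (fun i => Ybd i s (ltW s0) st) (Ycvg s (ltW s0) st).
  under eq_fun do rewrite symP.
  have Koo : K (i + N')%N @[i --> \oo] --> \oo.
    move=> Q [n _ Hn]; exists n => // i /= ni; apply: Hn => /=.
    by case: (KP' i) => _; exact: leq_trans.
  have Pe : j (Pi (K (i + N')%N) (e k)) @[i --> \oo] --> e k.
    exact: (cvg_comp _ _ Koo (projection_cvg_H ipP jP PiP (h := e k))).
  set u := fun i => Fm _ _ in Fc *.
  have -> : (fun i => ip (Fm (K (i + N')%N) (j (Pi (K (i + N')%N) (j (Y (i + N')%N s)))))
       (j (Pi (K (i + N')%N) (e k)))) =
     (fun i => ip (u i) (e k) + ip (u i) (j (Pi (K (i + N')%N) (e k)) - e k)).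
    by apply/funext => i; rewrite -(ipDr ipP) addrC subrK.
  rewrite -[ip (F (j (y s))) (e k)]addr0; apply: cvgD; first exact: cvg_ipl.
  apply/cvgrPdist_le => eps eps0.
  have eC : 0 < eps / (C + 1) by rewrite divr_gt0// ltr_wpDl.
  near=> i; rewrite sub0r normrN (le_trans (cauchy_schwarz ipP _ _))//.
  have ei : `|e k - j (Pi (K (i + N')%N) (e k))| <= eps / (C + 1).
    by near: i; move/cvgrPdist_le : Pe; apply.
  rewrite distrC; apply: (@le_trans _ _ ((C + 1) * (eps / (C + 1)))).
    apply: ler_pM => //; rewrite (@le_trans _ _ C)// ?lerDl//.
    by rewrite /u HC//; [case: (KP' i) | apply: Ybd => //; exact: ltW].
  by rewrite mulrC divfK// gt_eqF// ltr_wpDl.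
- have jY s : 0 <= s -> s <= t -> ip (j (Y (i + N')%N s)) (e k) @[i --> \oo] --> ip (j (y s)) (e k).
    move=> s0 st; apply: cvg_ipl => //; apply: (@continuous_cvg _ _ _ \oo _ _ j).
      by case: jP => _ jc _ _ _; exact: jc.
    exact: Ycvg.
  apply: cvgB; last by rewrite (cvg_shiftn N' Z).
  by apply: cvgB; [apply: cvgM; [exact: cvg_cst|exact: jY] | exact: jY].
Unshelve. all: by end_near. Qed.

End YosidaLimit.

(** * Contraction for the noiseless difference equation *)

Section Contraction.
Context {R : realType} {H : completeNormedModType R}.
Variables (ip : H -> H -> R) (DA : set H) (A : H -> H) (S : R -> {linear H -> H}).
Variables (e : nat -> H) (lam : nat -> R) (omega eta : R).
Hypothesis ipP : inner_product_of ip.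
Hypothesis linP : linear_part ip DA A S e lam omega.
Hypothesis etaP : 0 < eta.
Hypothesis eta_omega : eta < omega.
Let leb : {measure set _ -> \bar R} := @lebesgue_measure R.

Let eP : orthonormal_basis ip e. Proof. by case: linP => _ _ []. Qed.

Lemma lebesgue_measure_oc (s t : R) : s <= t -> leb (`]s, t]%classic : set R) = (t - s)%:E.
Proof.
move=> st; rewrite [leb _](lebesgue_measure_itv `]s, t])/= lte_fin -EFinB.
by case: ltP => // ts; congr EFin; apply/esym/eqP; rewrite subr_eq0 eq_le ts st.
Qed.

Lemma itv_oc_split (s t : R) : 0 <= s -> s <= t ->
  `]0, t]%classic = `]0, s] `|` `]s, t] :> set R.
Proof.
move=> s0 st; apply/seteqP; split => x /=; rewrite !in_itv/=.
  by move=> /andP[x0 xt]; case: (leP x s) => xs; [left; rewrite x0|right].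
by move=> [/andP[-> /le_trans]|/andP[sx ->]]; [apply|rewrite (le_lt_trans s0)].
Qed.

Lemma itv_oc_disj (s t : R) : [disjoint `]0, s]%classic & `]s, t]%classic : set R].
Proof.
apply/disj_setPLR => x /=; rewrite !in_itv/= => /andP[_ xs]; apply/negP.
by rewrite negb_and -leNgt xs.
Qed.

Variables D G : R -> H.
Hypothesis Dr : forall t : R, 0 <= t -> D s @[s --> t^'+] --> D t.
Hypothesis Gr : forall t : R, 0 <= t -> G s @[s --> t^'+] --> G t.
Hypothesis Gb : forall T : R, exists K : R, forall s, 0 <= s -> s <= T -> `|G s| <= K.
Hypothesis GD : forall t, 0 <= t -> ip (G t) (D t) <= eta * `|D t| ^+ 2.

Let prim k t := expR (lam k * t) * ip (D t) (e k) - ip (D 0) (e k).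

Hypothesis DG : forall (q : rat) k, 0 <= ratr q :> R ->
  ae_integral leb `]0, ratr q] (fun s => expR (lam k * s) * ip (G s) (e k))
    (prim k (ratr q)).

(** Rational times are enough, because the integral and the coordinate of D
    are both right-continuous in t; for the integral this is so because the
    integrand is locally bounded. *)
Lemma increment_real t k : 0 <= t ->
  ae_integral leb `]0, t] (fun s => expR (lam k * s) * ip (G s) (e k)) (prim k t).
Proof.
move=> t0; have [K HK] := Gb (t + 1).
have K0 : 0 <= K by apply: le_trans (HK 0 _ _); rewrite ?addr_ge0.
have lam0 : 0 <= lam k by case: linP => _ _ [_ /(_ k)[_ _ /ltW]].
have [q0 [tq0 _ _]] : exists q : rat, [/\ t < ratr q, ratr q < t + 1 & True].
  by apply: (right_rationals_ex (Q := fun=> True)); [rewrite ltrDl | exact: nearW].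
have q00 : 0 <= ratr q0 :> R by rewrite (le_trans t0)// ltW.
have [J HJ] : exists J, ae_integral leb `]0, t]
    (fun s => expR (lam k * s) * ip (G s) (e k)) J.
  apply: ae_integral_restrict (DG k q00) => //.
  by move=> x /=; rewrite !in_itv/= => /andP[-> /le_trans]; apply; exact: ltW.
suff -> : prim k t = J by [].
have primc : prim k s @[s --> t^'+] --> prim k t.
  apply: cvgB; last exact: cvg_cst.
  apply: cvgM; last by apply: cvg_ipl => //; exact: Dr.
  apply: cvg_at_right_filter; apply: continuous_comp; last exact: continuous_expR.
  by apply: cvgM; [exact: cvg_cst|exact: cvg_id].
pose C := expR (lam k * (t + 1)) * K.
have C0 : 0 <= C by rewrite mulr_ge0// expR_ge0.
have close (q : rat) : t < ratr q -> ratr q < t + 1 -> `|prim k (ratr q) - J| <= C * (ratr q - t).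
  move=> tq q1; have qt0 : 0 <= ratr q :> R by rewrite (le_trans t0)// ltW.
  have h := DG k qt0; rewrite (itv_oc_split t0 (ltW tq)) in h.
  have h' : ae_integral leb `]t, ratr q] (fun s => expR (lam k * s) * ip (G s) (e k))
      (prim k (ratr q) - J).
    by apply: ae_integral_diff h HJ => //; exact: itv_oc_disj.
  apply: (ae_integral_bound _ (lebesgue_measure_oc (ltW tq)) _ h') => //.
  move=> x /=; rewrite in_itv/= => /andP[tx xq].
  rewrite normrM gtr0_norm ?expR_gt0//; apply: ler_pM; rewrite ?expR_ge0//.
    by rewrite ler_expR ler_wpM2l// (le_trans xq)// ltW.
  rewrite (le_trans (cauchy_schwarz ipP _ _))// (basis_norm1 ipP eP) mulr1 HK//.
    by rewrite (le_trans t0)// ltW.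
  by rewrite (le_trans xq)// ltW.
apply/eqP; rewrite -subr_eq0 -normr_le0; apply/ler_addgt0Pr => eps eps0; rewrite add0r.
have e2 : 0 < eps / 2 by rewrite divr_gt0.
have /cvgrPdist_le/(_ _ e2) nearp := primc.
have d0 : 0 < Num.min 1 (eps / 2 / (C + 1)) by rewrite lt_min ltr01 divr_gt0// ltr_wpDl.
have [q [tq qd pq]] : exists q : rat, [/\ t < ratr q,
    ratr q < t + Num.min 1 (eps / 2 / (C + 1)) & `|prim k t - prim k (ratr q)| <= eps / 2].
  by apply: (right_rationals_ex (Q := fun s => `|prim k t - prim k s| <= eps / 2)); rewrite ?ltrDl.
have q1 : ratr q < t + 1 by apply: lt_le_trans qd _; rewrite lerD2l ge_min lexx.
have q2 : ratr q - t <= eps / 2 / (C + 1).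
  by rewrite lerBlDl; apply: (le_trans (ltW qd)); rewrite lerD2l ge_min lexx orbT.
have := close q tq q1.
have -> : prim k t - J = (prim k t - prim k (ratr q)) + (prim k (ratr q) - J).
  by rewrite addrA subrK.
move=> h; rewrite (le_trans (ler_normD _ _))// [eps in leRHS]splitr lerD//.
apply: (le_trans h); apply: (@le_trans _ _ ((C + 1) * (eps / 2 / (C + 1)))).
  apply: ler_pM => //; last by rewrite lerDl.
  by rewrite subr_ge0 ltW.
by rewrite mulrC divfK// gt_eqF// ltr_wpDl.
Qed.

(** The variation of constants formula in the form of an estimate, obtained by
    testing against finite combinations of the eigenvectors. *)
Lemma variation_of_constants s t (C : H) (eps : R) : 0 <= s -> s <= t -> 0 <= eps ->
  (forall x, s < x -> x <= t -> `|S (t - x) (G x) - C| <= eps) ->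
  `|D t - S (t - s) (D s) - (t - s) *: C| <= eps * (t - s).
Proof.
move=> s0 st eps0 HC; have t0 := le_trans s0 st.
have ts0 : 0 <= t - s by rewrite subr_ge0.
set V := _ - _ - _; apply: (norm_le_span ipP eP); first by rewrite mulr_ge0.
move=> n a; set h := \sum_(i < n) _.
have coordk k : ae_integral leb `]s, t]
    (fun x => ip (S (t - x) (G x) - C) (e k)) (ip V (e k)).
  have h1 := increment_real k t0; rewrite (itv_oc_split s0 st) in h1.
  have h2 : ae_integral leb `]s, t] (fun x => expR (lam k * x) * ip (G x) (e k))
      (prim k t - prim k s).
    by apply: ae_integral_diff h1 (increment_real k s0) => //; exact: itv_oc_disj.
  have mst : measurable (`]s, t]%classic : set (measurableTypeR R)) by [].
  have h3 := ae_integral_cst (- ip C (e k)) mst (lebesgue_measure_oc st).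
  have h4 := ae_integral_linear (expR (- (lam k * t))) mst h2 h3.
  have -> : ip V (e k) = expR (- (lam k * t)) * (prim k t - prim k s) + - ip C (e k) * (t - s).
    rewrite /V /prim !(ipBl ipP) (semigroup_coord ipP linP)// (ipZl ipP).
    rewrite opprB [_ - _ + (_ - _)](_ : _ = expR (lam k * t) * ip (D t) (e k) -
       expR (lam k * s) * ip (D s) (e k)); last by rewrite addrA subrK.
    have -> : expR (- (lam k * (t - s))) = expR (- (lam k * t)) * expR (lam k * s).
      by rewrite -expRD; congr expR; ring.
    have : expR (- (lam k * t)) * expR (lam k * t) = 1 by rewrite -expRD addNr expR0.
    move: (expR (- _)) (expR (lam k * t)) (expR (lam k * s)) => x y z xy.
    have -> : x * (y * ip (D t) (e k) - z * ip (D s) (e k)) =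
      x * y * ip (D t) (e k) - x * z * ip (D s) (e k) by ring.
    by rewrite xy; ring.
  apply: eq_ae_integral h4; apply: aeW => x /=; rewrite in_itv/= => /andP[sx xt].
  rewrite (ipBl ipP) (semigroup_coord ipP linP) ?subr_ge0// mulrA -expRD.
  by congr (expR _ * _ - _); ring.
have mst : measurable (`]s, t]%classic : set (measurableTypeR R)) by [].
have hs := ae_integral_sum (fun k : 'I_n => a k) mst (fun k : 'I_n => coordk k).
rewrite (le_trans (ler_norm _))// mulrAC.
have -> : ip V h = \sum_(k < n) a k * ip V (e k).
  by rewrite /h (ip_sumr ipP); apply: eq_bigr => k _; rewrite (ipZr ipP).
apply: (ae_integral_bound mst (lebesgue_measure_oc st) _ hs).
move=> x /=; rewrite in_itv/= => /andP[sx xt].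
have -> : \sum_(k < n) a k * ip (S (t - x) (G x) - C) (e k) = ip (S (t - x) (G x) - C) h.
  by rewrite /h (ip_sumr ipP); apply: eq_bigr => k _; rewrite (ipZr ipP).
by rewrite (le_trans (cauchy_schwarz ipP _ _))// ler_wpM2r// HC.
Qed.

(** Half of the gap leaves room for the quadratic term in the product of 1 +
    omega h and 1 - eta h. *)
Let c := (omega - eta) / 2.

(** Up to o(h), D(t + h) - h G(t + h) is S(h) D(t), whose norm is at most that
    of D(t) divided by 1 + omega h, while by the one-sided bound on G its norm
    is at least 1 - eta h times that of D(t + h). Hence 1 + c h times the norm
    of D(t + h) is at most the norm of D(t) plus o(h). A factor 1 + c t that
    grows linearly is enough, and it is multiplicative up to a term of the
    right sign. *)
Lemma orbit_contraction t : 0 <= t -> (1 + c * t) * `|D t| <= `|D 0|.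
Proof.
move=> T0; have c0 : 0 < c by rewrite divr_gt0// subr_gt0.
have omega0 : 0 < omega by exact: lt_trans eta_omega.
case: (linP) => _ [[_ _ _ Scvg] _] _ _ _.
have [K HK] := Gb t.
have K0 : 0 <= K by apply: le_trans (HK 0 _ _).
have lip s r : 0 <= s -> s <= r -> r <= t -> `|D r| <= `|D s| + K * (r - s).
  move=> s0 sr rt; have rs0 : 0 <= r - s by rewrite subr_ge0.
  have := @variation_of_constants s r 0 K s0 sr K0; rewrite scaler0 subr0 => h.
  have -> : D r = S (r - s) (D s) + (D r - S (r - s) (D s)) by rewrite addrC subrK.
  rewrite (le_trans (ler_normD _ _))// lerD//.
    exact: (semigroup_norm_le ipP linP).
  apply: h => x sx xr; rewrite subr0 (le_trans (semigroup_norm_le ipP linP _ _)) ?subr_ge0//.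
  by rewrite HK// ?(le_trans xr)// (le_trans s0)// ltW.
pose u r := (1 + c * r) * `|D r|.
suff : u t <= u 0 by rewrite /u mulr0 addr0 mul1r.
apply: le_of_dini => //; last first.
  move=> r eps delta r0 rt eps0 delta0.
  pose K2 := `|D 0| + K * t.
  have K20 : 0 <= K2 by rewrite addr_ge0// mulr_ge0.
  pose C := c * K2 + (1 + c * t) * K + 1.
  have ct0 : 0 <= c * t by rewrite mulr_ge0// ltW.
  have C0 : 0 < C by rewrite ltr_wpDl// addr_ge0// mulr_ge0// ?addr_ge0// ltW.
  pose h := Num.min (r / 2) (Num.min (delta / 2) (eps / C)).
  have h0 : 0 < h by rewrite !lt_min !divr_gt0.
  have hr : h <= r / 2 by rewrite ge_min lexx.
  have hd : h <= delta / 2 by rewrite !ge_min lexx orbT.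
  have he : h <= eps / C by rewrite !ge_min lexx !orbT.
  exists (r - h); split; [lra | lra | lra |].
  have s0 : 0 <= r - h by lra.
  have sr : r - h <= r by lra.
  have h1 := lip _ _ s0 sr rt.
  have sT : r - h <= t by lra.
  have h2 := lip _ _ (lexx 0) s0 sT.
  have K2s : `|D (r - h)| <= K2.
    by rewrite (le_trans h2)// /K2 lerD2l ler_wpM2l//; lra.
  rewrite /u; apply: (@le_trans _ _ ((1 + c * r) * (`|D (r - h)| + K * h))).
    have cr0 : 0 <= c * r by rewrite mulr_ge0// ltW.
    apply: ler_wpM2l; first by rewrite addr_ge0.
    by move: h1; rewrite opprB addrCA subrr addr0.
  have -> : (1 + c * r) * (`|D (r - h)| + K * h) = (1 + c * (r - h)) * `|D (r - h)| +
     h * (c * `|D (r - h)| + (1 + c * r) * K) by ring.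
  rewrite lerD2l; apply: (@le_trans _ _ (h * C)).
    rewrite ler_wpM2l ?(ltW h0)// /C -[X in X <= _]addr0 lerD// lerD//.
      by rewrite ler_wpM2l// ltW.
    by rewrite ler_wpM2r// lerD2l ler_wpM2l// ltW.
  by rewrite -ler_pdivlMr.
move=> r eps r0 rt eps0.
pose ct := 1 + c * t.
have ct0 : 0 < ct by rewrite ltr_wpDr// mulr_ge0// ltW.
pose z := eps / (4 * ct).
have z0 : 0 < z by rewrite divr_gt0// mulr_gt0.
have z2 : 0 < z / 2 by rewrite divr_gt0.
have /cvgrPdist_le/(_ _ z2) [d1 /= d10 Hd1] := Gr r0.
have /cvgrPdist_le/(_ _ z2) [d2 /= d20 Hd2] := Scvg (G r).
near=> h.
have h0 : 0 < h by near: h; exact: nbhs_right_gt.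
have hd1 : h < d1 by near: h; exact: nbhs_right_lt.
have hd2 : h < d2 by near: h; exact: nbhs_right_lt.
have ho : h <= omega^-1 by near: h; apply: nbhs_right_le; rewrite invr_gt0.
have hc : h <= c / (omega * eta).
  by near: h; apply: nbhs_right_le; rewrite divr_gt0// mulr_gt0.
have oh1 : omega * h <= 1 by rewrite mulrC -ler_pdivlMr// div1r.
have oehc : omega * eta * h <= c by rewrite mulrC -ler_pdivlMr// mulr_gt0.
have rh : r <= r + h by rewrite lerDl ltW.
have Gclose x : r < x -> x <= r + h -> `|G x - G r| <= z / 2.
  move=> rx xh; rewrite distrC; apply: Hd1 => //=.
  rewrite distrC gtr0_norm ?subr_gt0//; lra.
have Sclose y : 0 <= y -> y <= h -> `|S y (G r) - G r| <= z / 2.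
  move=> y0 yh; have [->|yn0] := eqVneq y 0.
    by case: (linP) => _ [[_ S0 _ _] _] _ _ _; rewrite S0 subrr normr0 ltW.
  have yp : 0 < y by rewrite lt0r yn0.
  rewrite distrC; apply: Hd2 => //=; rewrite sub0r normrN gtr0_norm//; lra.
have var : `|D (r + h) - S h (D r) - h *: G r| <= z * h.
  have := @variation_of_constants r (r + h) (G r) z r0 rh (ltW z0).
  have -> : r + h - r = h by rewrite addrC addKr.
  apply => x rx xh; have rhx : 0 <= r + h - x by rewrite subr_ge0.
  have -> : S (r + h - x) (G x) - G r = S (r + h - x) (G x - G r) + (S (r + h - x) (G r) - G r).
    by rewrite linearB/= addrA subrK.
  rewrite (le_trans (ler_normD _ _))// [z in leRHS]splitr lerD//.
    by rewrite (le_trans (semigroup_norm_le ipP linP _ _))// Gclose.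
  apply: Sclose => //; lra.
have dis : (1 - eta * h) * `|D (r + h)| <= `|D (r + h) - h *: G (r + h)|.
  have [->|Dn0] := eqVneq (D (r + h)) 0; first by rewrite normr0 mulr0.
  rewrite -(@ler_pM2r _ `|D (r + h)|) ?normr_gt0//.
  apply: le_trans (le_trans (ler_norm _) (cauchy_schwarz ipP _ _)).
  rewrite (ipBl ipP) (ipxx ipP) (ipZl ipP).
  have := GD (le_trans r0 rh) => /(ler_wpM2l (ltW h0)).
  set X := `|_|; set Y := ip _ _; rewrite mulrBl mul1r mulrBl -!expr2; nra.
have main : (1 - eta * h) * `|D (r + h)| <= (1 + omega * h)^-1 * `|D r| + 2 * z * h.
  apply: (le_trans dis).
  have -> : D (r + h) - h *: G (r + h) = S h (D r) + (D (r + h) - S h (D r) - h *: G r)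
     - h *: (G (r + h) - G r).
    rewrite scalerBr opprB; move: (D _) (S _ _) (_ *: G r) (_ *: G _) => a' s' g' b'.
    by rewrite [s' + _]addrA [s' + (_ - _)]addrC subrK addrA subrK.
  have g1 : `|S h (D r)| <= (1 + omega * h)^-1 * `|D r|.
    rewrite (le_trans (semigroup_contraction ipP linP _ (ltW h0)))// ler_wpM2r//.
    by rewrite expRN lef_pV2 ?posrE ?expR_gt0 ?expR_ge1Dx// ltr_wpDr// mulr_ge0// ltW.
  have g2 : `|h *: (G (r + h) - G r)| <= z * h.
    rewrite normrZ gtr0_norm// mulrC ler_wpM2r ?(ltW h0)//.
    by rewrite (le_trans (Gclose _ _ _))// ?ltrDl//; lra.
  rewrite (le_trans (ler_normB _ _))//.
  have -> : 2 * z * h = z * h + z * h by ring.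
  rewrite [leRHS]addrA; apply: lerD => //.
  by apply: (le_trans (ler_normD _ _)); exact: lerD.
have oh0 : 0 <= omega * h by rewrite mulr_ge0// ltW.
have main2 : (1 + c * h) * `|D (r + h)| <= `|D r| + 4 * z * h.
  have p1 : 0 < 1 + omega * h by rewrite ltr_wpDr.
  have := main; rewrite -(ler_pM2l p1) mulrDr [X in _ <= X + _]mulrA divff ?gt_eqF// mul1r => m.
  apply: (@le_trans _ _ ((1 + omega * h) * ((1 - eta * h) * `|D (r + h)|))).
    rewrite mulrA ler_wpM2r// -subr_ge0.
    have -> : (1 + omega * h) * (1 - eta * h) - (1 + c * h) = h * (c - omega * eta * h).
      by rewrite /c; field.
    by rewrite mulr_ge0 ?subr_ge0// ltW.
  apply: (le_trans m); rewrite lerD2l.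
  have zh0 : 0 <= z * h by rewrite mulr_ge0// ltW.
  nra.
rewrite /u.
have cr0 : 0 <= c * r by rewrite mulr_ge0// ltW.
have ch0 : 0 <= c * h by rewrite mulr_ge0// ltW.
apply: (@le_trans _ _ ((1 + c * r) * ((1 + c * h) * `|D (r + h)|))).
  rewrite mulrA ler_wpM2r//; nra.
apply: (@le_trans _ _ ((1 + c * r) * (`|D r| + 4 * z * h))).
  by rewrite ler_wpM2l// addr_ge0.
rewrite mulrDr lerD2l.
have -> : eps * h = ct * (4 * z * h).
  by rewrite /z; field; rewrite gt_eqF.
have zh0 : 0 <= 4 * z * h.
  by apply: mulr_ge0; [apply: mulr_ge0 => //; exact: ltW | exact: ltW].
apply: ler_wpM2r => //.
by rewrite /ct lerD2l ler_wpM2l// ltW.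
Unshelve. all: by end_near. Qed.

End Contraction.

(** * Comparison of the solutions with the limit process *)

Lemma ae_forall_countable {R : realType} {d : measure_display} {Om : measurableType d}
    (P : {measure set Om -> \bar R}) (I : countType) (Q : I -> Om -> Prop) :
  (forall i, {ae P, forall w, Q i w}) -> {ae P, forall w, forall i, Q i w}.
Proof.
move=> H.
have /ae_foralln : forall n, {ae P, forall w, if unpickle n is Some i then Q i w else True}.
  by move=> n; case: unpickle => [i|]; [exact: H | exact: aeW].
by apply: filterS => w Hw i; have := Hw (pickle i); rewrite pickleK.
Qed.

Section Comparison.
Context {R : realType} {d : measure_display} {Om : measurableType d}
  {P : probability Om R} {H B : completeNormedModType R}
  {ip : H -> H -> R} {j : {linear B -> H}}
  {DA : set H} {A : H -> H} {S : R -> {linear H -> H}}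
  {e : nat -> H} {lam : nat -> R} {omega : R}
  {DF : set H} {F : H -> H} {eta : R}
  {nu : {measure set R -> \bar R}} {beta rho b : nat -> R}
  {Lk : nat -> R -> Om -> R} {L Lbar : R -> Om -> nat -> R}
  {LA : R -> Om -> H}
  {Bn : nat -> set B} {Pi : nat -> {linear H -> B}}
  {m0 : nat} {Fm : nat -> H -> H} {Linf : nat -> R -> Om -> H} {C : R -> R}
  {rnm : nat -> nat -> R -> Om -> H} {r : R -> Om -> H}.
Let filt := natural_filtration P Lbar.
Let BL := diag_op e b.
Let leb : {measure set _ -> \bar R} := @lebesgue_measure R.
Hypothesis ipP : inner_product_of ip.
Hypothesis linP : linear_part ip DA A S e lam omega.
Hypothesis nonlinP : nonlinear_part ip DF F eta.
Hypothesis eta_omega : eta < omega.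
Hypothesis jP : banach_embedding j.
Hypothesis resP : restriction_to_B j DA A omega DF F.
Hypothesis levyP : cylindrical_levy P nu beta rho Lk L.
Hypothesis brho : bounded_diag rho b.
Hypothesis dsP : double_sided P L Lbar.
Hypothesis convP : stoch_convolution P j DA A F S BL L filt LA.
Hypothesis PiP : projections ip j Bn Pi.
Hypothesis FmP : yosida_approximations ip DF F eta m0 Fm.
Hypothesis approxP : approximate_processes P j S BL Lbar filt Pi m0 Fm Linf C rnm.
Hypothesis limP : limit_process P j m0 rnm r.

Let eP : orthonormal_basis ip e. Proof. by case: linP => _ _ []. Qed.
Let rho0 k : 0 < rho k. Proof. by case: levyP => /(_ k)[]. Qed.
Let Lcadlag : {ae P, forall w, cadlag_wl2 rho (L ^~ w)}.
Proof. by case: levyP => _ _ _ _ []. Qed.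

(** For each rational time and each coordinate, the approximate equations and
    the bound on the difference of the noises hold almost surely. There are
    countably many of them, so that they hold together on almost every path,
    and the limit is taken path by path. *)
Lemma limit_process_equation : {ae P, forall w, exists y : R -> B,
  [/\ cadlag y, forall t, 0 <= t -> j (y t) = r t w &
    forall (q : rat) k, 0 <= ratr q :> R ->
      ae_integral leb `]0, ratr q] (fun s => expR (lam k * s) * ip (F (j (y s))) (e k))
        (expR (lam k * ratr q) * ip (j (y (ratr q))) (e k) - ip (j (y 0)) (e k)
         - expR (lam k * ratr q) * ip (LA (ratr q) w) (e k))]}.
Proof.
have [Linfs rnmP] := approxP.
have mrnm n m t : (m0 <= m)%N -> measurable_fun setT (rnm n m t : Om -> borel H).
  by move=> m0m; have [[+ _ _] _ _] := rnmP n m m0m => /(_ t I)[].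
have [K [KP paths]] := fast_subsequence_paths ipP eP jP PiP limP mrnm.
case: (nonlinP) => Fcont _ _ _; case: (resP) => _ _ jDF Fb.
case: (dsP) => LbarL mLbar _ _; case: (convP) => LAs _ _ _ _.
have Ki i : (m0 <= K i)%N by case: (KP i).
pose G i (h : H) := j (Pi (K i) h).
have Gc i : continuous (G i).
  have [M M0 HM] := projection_bound_H ipP jP PiP.
  by apply: (linear_bound_continuous (f := [the {linear H -> H} of j \o Pi (K i)])) (HM (K i)).
have Gs i x y : ip (G i x) y = ip x (G i y) by case: PiP => _ _ + _; apply.
have incr : {ae P, forall w, forall p : nat * rat * nat, 0 <= ratr p.1.2 :> R -> forall M : R,
    (forall s, 0 <= s -> s <= ratr p.1.2 -> `|diag_op e b (L s w)| <= M) ->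
    `|expR (lam p.2 * ratr p.1.2) * ip (Linf (K p.1.1) (ratr p.1.2) w) (e p.2)
      - ip (Linf (K p.1.1) 0 w) (e p.2)
      - expR (lam p.2 * ratr p.1.2) * ip (LA (ratr p.1.2) w) (e p.2)|
    <= 2 * (M * `|G p.1.1 (e p.2) - e p.2|) * expR (lam p.2 * ratr p.1.2)}.
  apply: ae_forall_countable => -[[i q] k] /=.
  have [q0|q0] := leP 0 (ratr q : R); last by apply: aeW.
  have := stoch_integral_increment ipP linP rho0 brho LbarL mLbar Lcadlag k
    (Gc i) (Gs i) q0 (Linfs (K i) (ratr q)) (Linfs (K i) 0) (LAs _ q0).1.
  by apply: filterS => w Hw _.
have eqs : {ae P, forall w, forall p : nat * rat, exists v,
    is_bochner_integral leb `]-oo, ratr p.2] (fun s => S (ratr p.2 - s)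
      (j (Pi (K p.1) (Fm (K p.1) (j (Pi (K p.1) (rnm (K p.1) (K p.1) s w))))))) v /\
    rnm (K p.1) (K p.1) (ratr p.2) w = v + Linf (K p.1) (ratr p.2) w}.
  apply: ae_forall_countable => -[i q] /=.
  by have [[_ + _] _ _] := rnmP (K i) (K i) (Ki i); apply.
have Lc := Lcadlag.
apply: filterS2 (filterI paths Lc) (filterI incr eqs) => w [[Y [y [N [YP yc jy Yy]]]] Lw] [incw eqw].
exists y; split => // q k q0.
have [M HM] := diag_op_cadlag_bound ipP eP rho0 brho (ratr q) Lw.
pose Z i := expR (lam k * ratr q) * ip (Linf (K i) (ratr q) w) (e k) - ip (Linf (K i) 0 w) (e k).
have Koo : K i @[i --> \oo] --> \oo.
  move=> Q [n _ Hn]; exists n => // i /= ni; apply: Hn => /=.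
  by case: (KP i) => _; exact: leq_trans.
have Ge : G i (e k) @[i --> \oo] --> e k.
  exact: (cvg_comp _ _ Koo (projection_cvg_H ipP jP PiP (h := e k))).
have Zc : Z i @[i --> \oo] --> expR (lam k * ratr q) * ip (LA (ratr q) w) (e k).
  apply/cvgrPdist_le => eps eps0.
  pose c := 2 * `|M| * expR (lam k * ratr q) + 1.
  have c0 : 0 < c by rewrite ltr_wpDl// !mulr_ge0// expR_ge0.
  have ec : 0 < eps / c by rewrite divr_gt0.
  near=> i; rewrite distrC; have := incw (i, q, k) q0 M HM => /= h.
  apply: (le_trans h).
  have ge : `|e k - G i (e k)| <= eps / c by near: i; move/cvgrPdist_le : Ge; apply.
  apply: (@le_trans _ _ (c * (eps / c))); last by rewrite mulrC divfK// gt_eqF.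
  have -> : 2 * (M * `|G i (e k) - e k|) * expR (lam k * ratr q) =
    2 * M * expR (lam k * ratr q) * `|G i (e k) - e k| by ring.
  rewrite distrC; apply: (@le_trans _ _ (c * `|e k - G i (e k)|)); last by rewrite ler_pM2l.
  rewrite ler_wpM2r// /c.
  have : M * expR (lam k * ratr q) <= `|M| * expR (lam k * ratr q).
    by rewrite ler_wpM2r ?expR_ge0// ler_norm.
  lra.
apply: (limit_increment ipP jP PiP Fcont jDF Fb FmP linP KP yc q0 Yy _ Zc) => i.
have [vq [vqP rq]] := eqw (i, q); have [v0 [v0P r0]] := eqw (i, 0 : rat).
rewrite /= raddf0 in v0P r0; rewrite /= in vqP rq.
have [_ jY] := YP i.
have h := convolution_increment ipP linP k q0 vqP v0P.
rewrite !jY// rq r0 !(ipDl ipP).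
have <- : expR (lam k * ratr q) * ip vq (e k) - ip v0 (e k) =
   expR (lam k * ratr q) * (ip vq (e k) + ip (Linf (K i) (ratr q) w) (e k)) -
     (ip v0 (e k) + ip (Linf (K i) 0 w) (e k)) - Z i by rewrite /Z; ring.
apply: eq_ae_integral h; apply: aeW => s /=; rewrite in_itv/= => /andP[s0 _].
by rewrite jY// ltW.
Unshelve. all: by end_near. Qed.

Let c := (omega - eta) / 2.

(** The two equations contain the same noise, which cancels in the difference
    of the paths. *)
Lemma mild_solution_contraction y0 X : mild_solution P j S F filt LA y0 X ->
  {ae P, forall w, forall t, 0 <= t ->
    (1 + c * t) * `|X t w - r t w| <= `|j y0 - r 0 w|}.
Proof.
move=> [_ Xc Xeq].
case: (nonlinP) => Fcont _ eta0 FD; case: (resP) => _ _ jDF Fb.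
case: (jP) => _ jc _ _ _.
apply: filterS3 limit_process_equation Xc Xeq => w [y [yc jy yeq]] [g [gc jg]] Xw.
pose D t := j (g t) - j (y t); pose G t := F (j (g t)) - F (j (y t)).
have jr (u : R -> B) t : cadlag u -> 0 <= t -> j (u s) @[s --> t^'+] --> j (u t).
  move=> [ur _] t0; apply: (@continuous_cvg _ _ _ _ _ _ j); first exact: jc.
  exact: ur.
have Fr (u : R -> B) t : cadlag u -> 0 <= t -> F (j (u s)) @[s --> t^'+] --> F (j (u t)).
  move=> uc t0.
  have Fx : F @ within DF (nbhs (j (u t))) --> F (j (u t)).
    by move/subspace_continuousP : Fcont; apply; apply: jDF; exists (u t).
  have uw : j (u s) @[s --> t^'+] --> within DF (nbhs (j (u t))).
    move=> Q wQ; have := jr u t uc t0 _ wQ => h.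
    have {}h : \forall s \near t^'+, DF (j (u s)) -> Q (j (u s)) by exact: h.
    apply: filterS h => s; apply; apply: jDF; by exists (u s).
  exact: (cvg_comp _ _ uw Fx).
have incr (q : rat) k : 0 <= ratr q :> R ->
    ae_integral leb `]0, ratr q] (fun s => expR (lam k * s) * ip (G s) (e k))
      (expR (lam k * ratr q) * ip (D (ratr q)) (e k) - ip (j y0 - j (y 0)) (e k)).
  move=> q0; have [v [vP Xq]] := Xw _ q0.
  have h1 := mild_increment ipP linP k q0 vP.
  have m0q : measurable (`]0, ratr q]%classic : set (measurableTypeR R)) by [].
  have h2 := ae_integral_linear (-1) m0q (yeq q k q0) h1.
  have <- : -1 * (expR (lam k * ratr q) * ip (j (y (ratr q))) (e k) - ip (j (y 0)) (e k)
       - expR (lam k * ratr q) * ip (LA (ratr q) w) (e k))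
      + expR (lam k * ratr q) * ip v (e k) =
      expR (lam k * ratr q) * ip (D (ratr q)) (e k) - ip (j y0 - j (y 0)) (e k).
    rewrite /D !(ipBl ipP) jg// Xq !(ipDl ipP) (semigroup_coord ipP linP)//.
    have : expR (lam k * ratr q) * expR (- (lam k * ratr q)) = 1 by rewrite expRxMexpNx_1.
    move: (expR (- _)) (expR _) => x z xz.
    have -> : z * (x * ip (j y0) (e k) + ip v (e k) + ip (LA (ratr q) w) (e k) - ip (j (y (ratr q))) (e k)) =
      z * x * ip (j y0) (e k) + z * (ip v (e k) + ip (LA (ratr q) w) (e k) - ip (j (y (ratr q))) (e k)) by ring.
    by rewrite xz; ring.
  apply: eq_ae_integral h2; apply: aeW => s /=; rewrite in_itv/= => /andP[s0 _].
  by rewrite /G (ipBl ipP) -jg ?(ltW s0)//; ring.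
(* The equation at time 0 identifies the initial difference. *)
have D0 : D 0 = j y0 - j (y 0).
  apply: (eq_coord ipP eP) => k.
  have := incr 0 k; rewrite raddf0 => /(_ (lexx _)) h.
  have m00 : measurable (`]0 : R, 0]%classic : set (measurableTypeR R)) by [].
  have := ae_integral_bound (K := 0) m00 (lebesgue_measure_oc (lexx _)) _ h.
  rewrite mul0r mulr0 expR0 mul1r normr_le0 subr_eq0 => E; apply/eqP; apply: E.
  by move=> x /=; rewrite in_itv/= => /andP[x0 /(lt_le_trans x0)]; rewrite ltxx.
move=> t t0; rewrite -jg// -jy// -(jy 0)// -D0 -/(D t).
apply: (orbit_contraction ipP linP eta0 eta_omega (G := G)) => //.
- by move=> s s0; apply: cvgB; exact: jr.
- by move=> s s0; apply: cvgB; exact: Fr.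
- move=> T.
  have [cg Hcg] := cadlag_bounded T gc; have [cy Hcy] := cadlag_bounded T yc.
  have [Kg _ HKg] := F_bounded_on_balls Fb cg; have [Ky _ HKy] := F_bounded_on_balls Fb cy.
  exists (Kg + Ky) => s s0 sT; rewrite (le_trans (ler_normB _ _))// lerD//.
    by apply: HKg; exact: Hcg.
  by apply: HKy; exact: Hcy.
- move=> s s0; have [E|uv] := eqVneq (j (g s)) (j (y s)).
    by rewrite /D E subrr (ip0r ipP) normr0 expr0n mulr0.
  have := FD (j (g s)) (j (y s)); rewrite (ipBl ipP) (ipZl ipP) (ipxx ipP).
  move=> /(_ _ _ uv) h; rewrite -subr_le0 ltW//; apply: h; apply: jDF;
    by [exists (g s) | exists (y s)].
- by move=> q k q0; rewrite D0; exact: incr.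
Qed.

Lemma generalized_solution_contraction x X : generalized_solution P j S F filt LA x X ->
  {ae P, forall w, forall t, 0 <= t ->
    (1 + c * t) * `|X t w - r t w| <= `|x - r 0 w|}.
Proof.
move=> [_ [y [Y [yx YP YX]]]].
have /ae_foralln Yc n : {ae P, forall w, forall t, 0 <= t ->
    (1 + c * t) * `|Y n t w - r t w| <= `|j (y n) - r 0 w|}.
  exact: mild_solution_contraction (YP n).
apply: filterS2 Yc YX => w Yw Xw t t0.
have t1 : 0 < t + 1 by rewrite ltr_wpDl.
have Yt : Y n t w @[n --> \oo] --> X t w.
  apply/cvgrPdist_le => eps eps0.
  have /fine_cvgP[ffin /cvgrPdist_le/(_ _ eps0)] := Xw _ t1.
  apply: filterS2 ffin => n fs /=; rewrite sub0r normrN => h.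
  rewrite distrC -lee_fin; apply: (@le_trans _ _ (ereal_sup
     [set (`|Y n t w - X t w|)%:E | t in `[0, t + 1]])).
    apply: ereal_sup_ubound; exists t => //=; rewrite in_itv/= t0 lerDl; exact: ler01.
  by rewrite -(fineK fs) lee_fin (le_trans (ler_norm _)).
have h1 : (1 + c * t) * `|Y n t w - r t w| @[n --> \oo] --> (1 + c * t) * `|X t w - r t w|.
  apply: cvgM; first exact: cvg_cst.
  by apply: cvg_norm; apply: cvgB => //; exact: cvg_cst.
have h2 : `|j (y n) - r 0 w| @[n --> \oo] --> `|x - r 0 w|.
  by apply: cvg_norm; apply: cvgB => //; exact: cvg_cst.
by apply: (ler_cvg_to h1 h2); apply: nearW => n; exact: Yw.
Qed.

End Comparison.

(** * Laws of merging processes *)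

Section Laws.
Context {R : realType} {H : normedModType R}.
Implicit Types (U : set H) (m : nat).

(** The points at distance at least 1 / (m + 1) from the complement of U, in a
    form that covers an empty complement. *)
Definition core U m : set H := [set h | forall z, `|h - z| < m.+1%:R^-1 -> U z].

Lemma closed_core U m : closed (core U m).
Proof.
move=> h hc z hz.
have e0 : 0 < m.+1%:R^-1 - `|h - z| by rewrite subr_gt0.
have [y [Uy hy]] := hc _ (nbhsx_ballx h _ e0); apply: (Uy z).
rewrite -ball_normE /= in hy.
by rewrite (le_lt_trans (ler_distD h y z))// [`|y - h|]distrC -ltrBrDr.
Qed.

Lemma nondecreasing_core U : nondecreasing_seq (core U).
Proof.
move=> m n mn; apply/subsetPset => h Uh z hz; apply: Uh; apply: (lt_le_trans hz).
by rewrite lef_pV2 ?posrE// ler_nat.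
Qed.

Lemma bigcup_core U : open U -> \bigcup_m core U m = U.
Proof.
move=> oU; apply/seteqP; split => [h [m _]|h Uh].
  by apply; rewrite subrr normr0.
have /nbhs_ballP[e /= e0 eU] : nbhs h U by exact: open_nbhs_nbhs.
have /cvgrPdist_lt/(_ _ e0)[n _ /(_ n (leqnn n))] := @cvg_harmonic R.
rewrite /= sub0r normrN ger0_norm ?invr_ge0// => ne.
by exists n => // z hz; apply: eU; rewrite -ball_normE /=; exact: lt_trans ne.
Qed.

Lemma measurable_core U m : measurable (core U m : set (borel H)).
Proof.
rewrite -[core U m]setCK; apply: measurableC; apply: sub_sigma_algebra.
exact: closed_openC (closed_core (m := m)).
Qed.

Lemma cvg_core (mu : {measure set (borel H) -> \bar R}) U : open U ->
  mu (core U m) @[m --> \oo] --> mu U.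
Proof.
move=> oU; rewrite -{2}(bigcup_core oU); apply: nondecreasing_cvg_mu.
- by move=> i; exact: measurable_core.
- by rewrite bigcup_core//; exact: sub_sigma_algebra.
- exact: nondecreasing_core.
Qed.

(** Open sets are increasing unions of closed sets, so an inequality between
    two probabilities on open sets passes to closed sets by complements and
    comes back reversed. *)
Lemma probability_eq_of_le_open (mu rho : probability (borel H) R) :
  (forall U, open U -> (rho U <= mu U)%E) ->
  forall E : set (borel H), measurable E -> mu E = rho E.
Proof.
move=> le_rho.
have muE U : open U -> mu U = rho U.
  move=> oU; apply/eqP; rewrite eq_le le_rho// andbT.
  have mU : measurable (U : set (borel H)) by exact: sub_sigma_algebra.
  apply: (cvge_to_le (cvg_core (mu := mu) oU)).
  apply: nearW => m; have := le_rho _ (closed_openC (closed_core (U := U) (m := m))).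
  have mC := measurable_core U m.
  rewrite !probability_setC// => h.
  apply: (@le_trans _ _ (rho (core U m))); last first.
    by apply: le_measure; rewrite ?inE// -[X in _ `<=` X](bigcup_core oU) => y; exists m.
  suff : (mu (core U m) <= rho (core U m))%E by [].
  move: h; rewrite -[rho (core U m)]fineK ?fin_num_measure// -[mu (core U m)]fineK ?fin_num_measure//.
  by rewrite -!EFinB !lee_fin; lra.
apply: (@g_sigma_algebra_measure_unique _ R (borel H) (@open H) _ (fun=> setT)) => //.
- by move=> U oU; exact: sub_sigma_algebra.
- by move=> _; exact: openT.
- by rewrite bigcup_const//; exists 0%N.
- by move=> U V; exact: openI.
- by move=> _; rewrite (le_lt_trans (probability_le1 _ _))// ltry.
Qed.

End Laws.

Section Limits.
Context {R : realType} {d : measure_display} {Om : measurableType d}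
  {P : probability Om R}.

Lemma cvg_probability_tail (Y : Om -> R) (eps c : R) : 0 < eps -> 0 < c ->
  measurable_fun setT Y ->
  P [set w | eps * (1 + c * n%:R) <= Y w] @[n --> \oo] --> 0%E.
Proof.
move=> eps0 c0 mY; rewrite -(measure0 P).
have <- : \bigcap_n [set w | eps * (1 + c * n%:R) <= Y w] = set0.
  apply/seteqP; split => // w Yw.
  have := Yw (Num.bound (Y w / eps / c)) I => /=.
  have : Y w / eps / c < (Num.bound (Y w / eps / c))%:R.
    exact: unstable.ltr_bound.
  rewrite ltr_pdivrMr// ltr_pdivrMr// => h1 h2.
  have := le_lt_trans h2 h1; rewrite mulrDr mulr1 [_ * eps]mulrC [_ * c]mulrC.
  by rewrite ltNge lerDr ltW.
have mF n : measurable [set w | eps * (1 + c * n%:R) <= Y w].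
  by rewrite -[X in measurable X]setTI; exact: measurable_fun_le.
apply: nonincreasing_cvg_mu => //.
- by rewrite (le_lt_trans (probability_le1 _ _))// ltry.
- exact: bigcapT_measurable.
- move=> m n mn; apply/subsetPset => w /=; apply: le_trans.
  by rewrite ler_pM2l// lerD2l ler_pM2l// ler_nat.
Qed.

Lemma limn_einf_ge (u : nat -> \bar R) (a : R) :
  (forall eps, 0 < eps -> \forall n \near \oo, ((a - eps)%:E <= u n)%E) ->
  (a%:E <= limn_einf u)%E.
Proof.
move=> au; apply/lee_addgt0Pr => eps eps0; rewrite -leeBlDr// -EFinB limn_einf_lim.
have [N _ Nu] := au _ eps0.
apply: lime_ge; first exact: is_cvg_einfs.
exists N => // n /= Nn; apply: le_ereal_inf_tmp => _ [k /= nk <-].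
by apply: Nu; exact: leq_trans nk.
Qed.

End Limits.

Section Merging.
Context {R : realType} {d : measure_display} {Om : measurableType d}
  {P : probability Om R} {H : completeNormedModType R}
  {ip : H -> H -> R} {e : nat -> H}.
Hypothesis ipP : inner_product_of ip.
Hypothesis eP : orthonormal_basis ip e.

(** A set U contains X as soon as the core of U contains Z and X is close to
    Z; hence, if X n and Z n merge in probability and all Z n have the same
    law, this law is a lower bound for the laws of X n on open sets, in the
    limit. *)
Lemma limn_einf_merging (rho : probability (borel H) R) (X Z : nat -> Om -> H) U :
  (forall n, measurable_fun setT (X n : Om -> borel H)) ->
  (forall n, measurable_fun setT (Z n : Om -> borel H)) ->
  (forall n (E : set (borel H)), measurable E -> P (Z n @^-1` E) = rho E) ->
  (forall eps, 0 < eps -> P [set w | eps <= `|X n w - Z n w|] @[n --> \oo] --> 0%E) ->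
  open U -> (rho U <= limn_einf (fun n => P (X n @^-1` U)))%E.
Proof.
move=> mX mZ ZE XZ oU.
apply: (cvge_to_le (cvg_core (mu := rho) oU)).
apply: nearW => m.
have mC := measurable_core U m.
suff : (rho (core U m) <= limn_einf (fun n => P (X n @^-1` U)))%E by [].
rewrite -[rho (core U m)]fineK ?fin_num_measure//.
apply: limn_einf_ge => eps eps0.
have m0 : 0 < m.+1%:R^-1 :> R by rewrite invr_gt0.
have /fine_cvgP[pfin /cvgrPdist_le/(_ _ eps0)] := XZ _ m0.
apply: filterS2 pfin => n pf /=; rewrite sub0r normrN => pe.
set D := [set w | m.+1%:R^-1 <= `|X n w - Z n w|] in pf pe.
have mD : measurable D by apply: (measurable_dist_ge ipP eP); [exact: mX|exact: mZ].
have mXU : measurable (X n @^-1` U).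
  by rewrite -[X in measurable X]setTI; apply: mX => //; exact: sub_sigma_algebra.
have sub : Z n @^-1` core U m `<=` (X n @^-1` U) `|` D.
  move=> w Zw; have [|XZw] := leP m.+1%:R^-1 `|X n w - Z n w|; [by right|left].
  by apply: Zw; rewrite distrC.
have mZU : measurable (Z n @^-1` core U m).
  by rewrite -[X in measurable X]setTI; apply: mZ => //; exact: measurable_core.
have : (rho (core U m) <= P (X n @^-1` U) + P D)%E.
  rewrite -(ZE n); last exact: measurable_core.
  apply: (le_trans _ (measureU2 P mXU mD)).
  by apply: le_measure; rewrite ?inE//; exact: measurableU.
rewrite -(fineK pf) -[rho (core U m)]fineK ?fin_num_measure// -[P (X n @^-1` U)]fineK ?fin_num_measure//.
rewrite -EFinD !lee_fin => h; move: pe; rewrite ger0_norm ?fine_ge0 ?measure_ge0//; lra.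
Qed.

End Merging.

(** Fatou's lemma: an invariant measure averages the kernels, so it inherits
    any lower bound that they satisfy in the limit from every starting point. *)
Lemma invariant_ge_of_limit {R : realType} {H : completeNormedModType R}
    (Pt : R -> R.-pker borel H ~> borel H) (mu : probability (borel H) R)
    (U : set (borel H)) (a : \bar R) :
  Defs.invariant Pt mu -> measurable U ->
  (forall x, (a <= limn_einf (fun n => Pt n%:R x U))%E) -> (0 <= a)%E ->
  (a <= mu U)%E.
Proof.
move=> inv mU aU a0.
have mf n : measurable_fun setT (fun x => Pt n%:R x U) by exact: measurable_kernel.
have f0 n x : setT x -> (0 <= Pt n%:R x U)%E by [].
have := @fatou _ (borel H) R mu setT measurableT (fun n x => Pt n%:R x U) mf f0.
have -> : (fun n : nat => \int[mu]_(x in setT) Pt n%:R x U)%E = cst (mu U).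
  by apply/funext => n; rewrite /= -inv// ler0n.
rewrite (is_cvg_limn_einfE (u := cst (mu U)) (is_cvg_cst _)) lim_cst//.
apply: le_trans.
have <- : (\int[mu]_(x in setT) a = a)%E.
  by rewrite integral_cst// -[RHS]mule1; congr (_ * _)%E; exact: probability_setT.
apply: ge0_le_integral => //.
- apply: measurableT_comp (@oppe_measurable R setT) (measurable_fun_limn_esup _) => n.
  exact: measurableT_comp (@oppe_measurable R setT) (mf n).
Qed.

(** * The invariant measure *)

Theorem theorem4p5
  (R : realType) (d : measure_display) (Om : measurableType d)
  (P : probability Om R)
  (H B : completeNormedModType R) (ip : H -> H -> R) (j : {linear B -> H})
  (DA : set H) (A : H -> H) (S : R -> {linear H -> H})
  (e : nat -> H) (lam : nat -> R) (omega : R)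
  (DF : set H) (F : H -> H) (eta : R)
  (nu : {measure set R -> \bar R}) (beta rho b : nat -> R)
  (Lk : nat -> R -> Om -> R) (L Lbar : R -> Om -> nat -> R)
  (LA : R -> Om -> H)
  (x : H) (X : R -> Om -> H) (Pt : R -> R.-pker borel H ~> borel H)
  (Bn : nat -> set B) (Pi : nat -> {linear H -> B})
  (m0 : nat) (Fm : nat -> H -> H) (Linf : nat -> R -> Om -> H) (C : R -> R)
  (rnm : nat -> nat -> R -> Om -> H) (r : R -> Om -> H) :
  let filt := natural_filtration P Lbar in
  let BL := diag_op e b in
  inner_product_of ip ->
  linear_part ip DA A S e lam omega ->
  nonlinear_part ip DF F eta ->
  eta < omega ->
  mdissipative (graph (DA `&` DF) (fun u => A u + F u)) ->
  banach_embedding j ->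
  restriction_to_B j DA A omega DF F ->
  cylindrical_levy P nu beta rho Lk L ->
  bounded_diag rho b ->
  double_sided P L Lbar ->
  stoch_convolution P j DA A F S BL L filt LA ->
  well_posed P j S F filt LA ->
  DF x ->
  solution P j S F filt LA x X ->
  transition_semigroup P j S F filt LA Pt ->
  (exists mu, unique_invariant Pt mu) ->
  projections ip j Bn Pi ->
  yosida_approximations ip DF F eta m0 Fm ->
  approximate_processes P j S BL Lbar filt Pi m0 Fm Linf C rnm ->
  limit_process P j m0 rnm r ->
  exists mu : probability (borel H) R,
    unique_invariant Pt mu /\
    forall t (E : set (borel H)), 0 <= t -> measurable E ->
      mu E = P (r t @^-1` E).
Proof.
move=> filt BL ipP linP nonlinP eta_omega _ jP resP levyP brho dsP convP wp _ _.
move=> [PtX _ _] [mu [inv uniq]] PiP FmP approxP limP.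
exists mu; split=> // t E t0 mE.
have eP : orthonormal_basis ip e by case: linP => _ _ [].
case: (limP) => mr _ _ _ statr.
have rE s (E' : set (borel H)) : 0 <= s -> measurable E' ->
    P (r s @^-1` E') = P (r 0 @^-1` E').
  move=> s0 mE'.
  have /(_ 1%N (fun=> 0) (fun=> E') (fun=> lexx _) (fun=> mE')) :=
    statr s (fun u (u0 : 0 <= u) => addr_ge0 u0 s0).
  by rewrite !bigcap_mkord !big_ord1 add0r.
rewrite rE//.
pose r0 : {mfun Om >-> borel H} := HB.pack_for {mfun Om >-> borel H}
  (r 0 : Om -> borel H) (isMeasurableFun.Build _ _ _ _ (r 0 : Om -> borel H) (mr _ (lexx _))).
have -> : P (r 0 @^-1` E) = distribution P r0 E by [].
apply: probability_eq_of_le_open => // U oU.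
have mU : measurable (U : set (borel H)) by exact: sub_sigma_algebra.
apply: (invariant_ge_of_limit inv) => // y.
have [Y Ysol] := wp.2 y.
have mY n : measurable_fun setT (Y n%:R : Om -> borel H).
  by case: Ysol => + _ => /(_ n%:R (ler0n _ _))[].
have := @limn_einf_merging _ _ _ P _ _ _ ipP eP (distribution P r0) (fun n => Y n%:R) (fun n => r n%:R) U
  mY (fun n => mr _ (ler0n _ n)).
have -> : (fun n : nat => Pt n%:R y U) = (fun n => P (Y n%:R @^-1` U)).
  by apply/funext => n; apply: PtX => //; right.
apply=> //; first by move=> n E' mE'; rewrite rE.
move=> eps eps0.
have c0 : 0 < (omega - eta) / 2 by rewrite divr_gt0// subr_gt0.
have mN : measurable_fun setT (fun w => `|y - r 0 w|).
  apply: (continuous_measurable_comp (f := fun h : H => `|y - h|)) (mr _ (lexx _)) => h.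
  by apply: cvg_norm; apply: cvgB => //; exact: cvg_cst.
have := @cvg_probability_tail _ _ _ P _ eps _ eps0 c0 mN.
apply: (squeeze_cvge _ (cvg_cst 0%E)).
apply: nearW => n; rewrite measure_ge0/=.
have [N [mN0 PN0 sub]] := generalized_solution_contraction ipP linP nonlinP eta_omega jP
  resP levyP brho dsP convP PiP FmP approxP limP Ysol.
have mD : measurable [set w | eps <= `|Y n%:R w - r n%:R w|].
  by apply: (measurable_dist_ge ipP eP) => //; exact: (mr _ (ler0n _ _)).
have mG : measurable [set w | eps * (1 + (omega - eta) / 2 * n%:R) <= `|y - r 0 w|].
  by rewrite -[X in measurable X]setTI; exact: measurable_fun_le.
rewrite -[leRHS]adde0 -PN0; apply: (le_trans _ (measureU2 P mG mN0)).
apply: le_measure; rewrite ?inE//; first exact: measurableU.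
move=> w /= Dw; have [Nw|Nw] := pselect (N w); [by right|left].
have {}Nw : forall t0, 0 <= t0 -> (1 + (omega - eta) / 2 * t0) * `|Y t0 w - r t0 w| <= `|y - r 0 w|.
  by apply: contrapT => /sub.
apply: (le_trans _ (Nw _ (ler0n _ n))).
by rewrite mulrC ler_wpM2l// addr_ge0// mulr_ge0// ltW.
Qed.
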